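(* Let $w\in\iota$ and let $M$ be a special partial matching (SPM) of $[e,w]_\iota$. Then, for any $u\in[e,w]_\iota$, $$Q_{u,w}(q)=\begin{cases}Q_{M(u),M(w)}(q) & \text{if } M(u)\lhd u,\\ qQ_{M(u),M(w)}(q)+(q-1)Q_{u,M(w)}(q) & \text{if } u\lhd M(u),\\ qQ_{u,M(w)}(q) & \text{if } M(u)=u.\end{cases}$$
   Context: Let $n\ge1$ and let $W=S_{2n}$ be the group of permutations of $[2n]=\{1,\dots,2n\}$ (products are compositions of functions), with Coxeter generators $S=\{s_1,\dots,s_{2n-1}\}$, $s_i=(i\ \ i+1)$, length function $\ell$ (number of inversions), identity $e$, longest element $w_0$, $w_0(i)=2n+1-i$, and Bruhat order $\le$. The right descent set is $D_{\mathrm R}(w)=\{s\in S\mid \ell(ws)<\ell(w)\}$. Let $\theta(w)=w_0ww_0$ (so $\theta(s_i)=s_{2n-i}$), $x\ast w=\theta(w^{-1})xw$ for $x,w\in W$ (twisted conjugation), and $\iota=\{\theta(w^{-1})w\mid w\in W\}$ (twisted identities). The poset $\mathrm{Br}(\iota)$ is $\iota$ with the order induced by the Bruhat order; it is graded with rank function $\rho=\ell/2$ and minimum $e$; $\lhd$ denotes its cover relation and $[u,w]_\iota=\{x\in\iota\mid u\le x\le w\}$. Special partial matching (SPM): for a finite poset $\Pi$ with a unique maximum element $\hat1$ and cover relation $\prec$, an SPM of $\Pi$ is a function $M:\Pi\to\Pi$ such that $M^2=\mathrm{id}$; $M(\hat1)\prec\hat1$; for all $x\in\Pi$, either $M(x)\prec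 x$, $M(x)=x$ or $x\prec M(x)$; and if $x\prec y$ and $M(x)\ne y$, then $M(x)<M(y)$. $Q$-polynomials: for $u,w\in\iota$, $Q_{u,w}(q)=(-q)^{\rho(w)-\rho(u)}R_{u,w}(q^{-1})$, where $R_{u,w}$ are the Kazhdan-Lusztig-Vogan $R$-polynomials for $\mathrm{Sp}(2n,\mathbb{C})$ acting on the flag variety of $\mathrm{SL}(2n,\mathbb{C})$. It is known that they are polynomials completely determined by $Q_{u,u}=1$, $Q_{u,w}=0$ if $u\not\le w$, and, for any $s\in D_{\mathrm R}(w)$: $Q_{u,w}=Q_{u\ast s,w\ast s}$ if $u\ast s\lhd u$; $Q_{u,w}=qQ_{u\ast s,w\ast s}+(q-1)Q_{u,w\ast s}$ if $u\lhd u\ast s$; $Q_{u,w}=qQ_{u,w\ast s}$ if $u\ast s=u$. *)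

(* Defs.v *)
From HB Require Import structures.
From mathcomp Require Import all_boot all_order all_fingroup all_algebra.

Set Implicit Arguments.
Unset Strict Implicit.
Unset Printing Implicit Defensive.

Import Order.TTheory GRing.Theory.

(* MathComp's (u * v)%g applies u first; pcomp u v is the composition of      *)
(* functions x |-> u (v x).                                                   *)
Definition pcomp (m : nat) (u v : 'S_m) : 'S_m := (v * u)%g.

Notation "u \oS v" := (pcomp u v) (at level 40, left associativity).

Section SymmetricGroup.

Variable m : nat.
Implicit Types u v w x s t : 'S_m.

(* The points 1, ..., m are represented by the ordinals 0, ..., m.-1. *)

Definition ell w : nat :=
  #|[set p : 'I_m * 'I_m | (p.1 < p.2)%N && (w p.2 < w p.1)%N]|.

Definition simple_reflections : {set 'S_m} :=
  [set s | [exists i : 'I_m, exists j : 'I_m,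
     (j == i.+1 :> nat) && (s == tperm i j)]].

Definition w0 : 'S_m := perm (@rev_ord_inj m).

Definition right_descents w : {set 'S_m} :=
  [set s in simple_reflections | (ell (w \oS s) < ell w)%N].

Definition bruhat_step u v : bool :=
  [exists i : 'I_m, exists j : 'I_m,
     [&& i != j, v == u \oS tperm i j & (ell u < ell v)%N]].

Definition bruhat u v : bool := connect bruhat_step u v.

Lemma bruhat_ell u v : bruhat u v -> u != v -> (ell u < ell v)%N.
Proof.
case/connectP=> p; elim: p u => [|x p IHp] u /=; first by move=> _ -> /eqP.
case/andP=> /existsP[i /existsP[j /and3P[_ _ lt_ux]]] path_p last_v _.
have [<- //|neq_xv] := eqVneq x v.
exact: ltn_trans lt_ux (IHp _ path_p last_v neq_xv).
Qed.

Lemma bruhat_refl : reflexive bruhat.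
Proof. exact: connect0. Qed.

Lemma bruhat_trans : transitive bruhat.
Proof. exact: connect_trans. Qed.

Lemma bruhat_anti : antisymmetric bruhat.
Proof.
move=> u v /andP[le_uv le_vu]; apply/eqP/contraT => neq_uv.
have := ltn_trans (bruhat_ell le_uv neq_uv).
by move/(_ (ell u)); rewrite ltnn; apply; apply: bruhat_ell; rewrite 1?eq_sym.
Qed.

End SymmetricGroup.

Fact bruhat_display : Order.disp_t. Proof. exact: Order.Disp tt tt. Qed.

(* From here on, (u <= v)%O and (u < v)%O on 'S_m denote the Bruhat order. *)
HB.instance Definition _ (m : nat) :=
  Order.Le_isPOrder.Build bruhat_display (perm_type 'I_m)
    (@bruhat_refl m) (@bruhat_anti m) (@bruhat_trans m).

Lemma le_bruhatE (m : nat) (u v : 'S_m) : (u <= v)%O = bruhat u v.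
Proof. by []. Qed.

Section SpecialPartialMatchings.

(* Finite posets are represented as subsets P of a finite partially ordered   *)
(* type, with the induced order.                                              *)

Variables (d : Order.disp_t) (T : finPOrderType d).

Definition covered_in (P : {set T}) (x y : T) : bool :=
  [&& x \in P, y \in P, (x < y)%O &
      ~~ [exists z in P, (x < z)%O && (z < y)%O]].

(* The values of M outside P are irrelevant. *)
Definition special_partial_matching (P : {set T}) (M : T -> T) : Prop :=
  [/\ {in P, forall x, M x \in P},
      {in P, forall x, M (M x) = x},
      exists top : T, [/\ top \in P, {in P, forall x, (x <= top)%O}
                        & covered_in P (M top) top],
      {in P, forall x,
         [\/ covered_in P (M x) x, M x = x | covered_in P x (M x)]}
    & {in P &, forall x y, covered_in P x y -> M x <> y -> (M x < M y)%O}].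

End SpecialPartialMatchings.

Section TwistedIdentities.

Variable m : nat.
Implicit Types u v w x s : 'S_m.

Definition theta w : 'S_m := w0 m \oS w \oS w0 m.

Definition twconj x w : 'S_m := theta w^-1 \oS x \oS w.

Definition twisted_identities : {set 'S_m} :=
  [set theta w^-1 \oS w | w : 'S_m].

Definition tw_cover u v : bool := covered_in twisted_identities u v.

Definition tw_interval u w : {set 'S_m} :=
  [set x in twisted_identities | (u <= x <= w)%O].

End TwistedIdentities.

(* Q is, on twisted identities, the family of Q-polynomials                   *)
(*   Q_{u,w}(q) = (-q)^(rho(w) - rho(u)) R_{u,w}(q^-1),   rho = ell / 2,      *)
(* where R is the family of Kazhdan-Lusztig-Vogan R-polynomials of            *)
(* Sp(2n,C) acting on the flag variety of SL(2n,C). This family is specified  *)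
(* by the recursion that determines it: by induction on ell w, the clauses    *)
(* leave at most one possible value for each Q u w with u, w twisted          *)
(* identities. Other values of Q are irrelevant.                              *)
Definition KLV_Q_polynomials (n : nat)
    (Q : 'S_(2 * n) -> 'S_(2 * n) -> {poly int}) : Prop :=
  let I := twisted_identities (2 * n) in
  [/\ {in I, forall u, Q u u = 1%R},
      {in I &, forall u w, ~~ (u <= w)%O -> Q u w = 0%R}
    & {in I &, forall u w, forall s, s \in right_descents w ->
        [/\ tw_cover (twconj u s) u ->
              Q u w = Q (twconj u s) (twconj w s),
            tw_cover u (twconj u s) ->
              Q u w = ('X * Q (twconj u s) (twconj w s)
                       + ('X - 1) * Q u (twconj w s))%R
          & twconj u s = u ->
              Q u w = ('X * Q u (twconj w s))%R]}].

(* Main.v *)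
(* The map x |-> w0 x identifies twisted identities with the fixed point free  *)
(* involutions of [2n]; twisted conjugation by s_k becomes conjugation by     *)
(* (k k+1). The proof is by induction on the rank of w. If M is twisted       *)
(* conjugation by some s, the claim is the defining recursion. Otherwise w    *)
(* has a descent s such that M w <> w * s and M (x * s) = M x * s whenever    *)
(* M x <> x * s. Then M (w * s) = M w * s, M restricts to [e, w * s], and the *)
(* claim for w follows from the claim for w * s because the two recursion     *)
(* operators, attached to M and to s, commute on each common orbit.           *)
(* To find s: elements of rank at least 3 are determined by their coatoms, so *)
(* M is determined by its values in ranks 0 and 1. If M e = e, then M is      *)
(* twisted conjugation by s_n. If M e = e * s_i = e * s_(2n-i), each adjacent *)
(* atom a has M a equal to a * s_i or to a * s_(2n-i); if these choices agree,*)
(* M is twisted conjugation by the chosen generator. Otherwise both           *)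
(* neighbours of s_i occur with different choices, M commutes with all        *)
(* descents of w but two exceptional ones, and an explicit computation shows  *)
(* that some descent s with w * s <> M w is not exceptional.                  *)

Require Import Defs.
From HB Require Import structures.
From mathcomp Require Import all_boot all_order all_fingroup all_algebra.
From mathcomp Require Import zify ring.

Set Implicit Arguments.
Unset Strict Implicit.
Unset Printing Implicit Defensive.

(** * The Bruhat order *)

(** Read the right-hand side of the recursion attached to a matching [M] as an operator [step _ M]
    on functions. The theorem becomes [q_spm]: this operator turns the Q-polynomials ending at [M w]
    into those ending at [w]. For twisted conjugation by a descent, which is a matching by
    [spm_tcj], this is the definition of Q. For any other [M] there is a descent [s] of [w], with
    [w * s <> M w], with which [M] commutes. Expand Q at [w] along [s], apply induction at [w * s],
    exchange the two operators by [step_comm], and fold the recursion at [M w] along [s].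

    So everything rests on [spm_classification]: either [M] is a twisted conjugation, or such an [s]
    exists. Its engine consists of two facts about coatoms of twisted identities: an element with a
    single coatom has rank at most 2 ([single_coatom]), and elements of rank at least 3 with the
    same coatoms are equal ([same_coatoms_eq]). When [M x] covers [x], its coatoms other than [x]
    are images under [M] of coatoms of [x] ([spm_coatom]), so properties of [M] spread upwards from
    the bottom: [spm_unique] recognizes a twisted conjugation from ranks 0 and 1, and [keeps] with
    [spm_comm] derive commutation with a letter [r] from the values of [M] at [e] and at [e * r].

    The remaining case is [M e = e * t] with the two neighbours [p], [q] of [t] making different
    choices. Then only [p] and the mirror image [q'] of [q] can fail to commute with [M]
    ([mixed_keeps]), and [w] cannot lie above a certain element of rank 3 ([Zel_not_tle]). An
    element other than [e] that is not above it and has no descents besides [p] and [q'] is unique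
    ([two_descents]), which leads to the required descent ([mixed_letter]).

    Facts about one or two letters are checked on the involution [F x], written on natural numbers,
    by comparing its values at the few points that the letters move. *)

Section BruhatOrder.

Variable m : nat.
Implicit Types (u v x : 'S_m) (i j : 'I_m).

Lemma pcompE u v i : (u \oS v) i = u (v i).
Proof. by rewrite permM. Qed.

Lemma pcompA u v x : u \oS v \oS x = u \oS (v \oS x).
Proof. by apply/permP => i; rewrite !permM. Qed.

Definition inversions u : {set 'I_m * 'I_m} :=
  [set p : 'I_m * 'I_m | (p.1 < p.2)%N && (u p.2 < u p.1)%N].

(** An injection between the inversions of [u] and those of [u \oS tperm i j] other than [(i, j)].
    Used in one direction it shows that the length grows, in the other that an adjacent
    transposition adds only one. *)
Definition swap_pair i j (p : 'I_m * 'I_m) :=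
  if (tperm i j p.1 < tperm i j p.2)%N then (tperm i j p.1, tperm i j p.2)
  else p.

Lemma swap_pairK i j (p : 'I_m * 'I_m) : (p.1 < p.2)%N -> swap_pair i j (swap_pair i j p) = p.
Proof.
case: p => a b /= lt_ab; rewrite {2}/swap_pair /=.
by case: ifP => h; rewrite /swap_pair /= ?tpermK ?lt_ab ?h.
Qed.

Lemma swap_pair_inv i j u (p : 'I_m * 'I_m) : (i < j)%N -> (u i < u j)%N ->
  p \in inversions u ->
  swap_pair i j p \in inversions (u \oS tperm i j) :\ (i, j).
Proof.
case: p => a b lt_ij lt_u; rewrite !inE /= => /andP[lt_ab lt_ba].
rewrite /swap_pair /=; case: ifP => h /=.
  rewrite !permM !tpermK lt_ba h /= andbT xpair_eqE.
  apply/negP => /andP[/eqP ha /eqP hb].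
  have := congr1 (tperm i j) ha; have := congr1 (tperm i j) hb.
  rewrite !tpermK tpermL tpermR => eb ea; rewrite ea eb in lt_ab; lia.
rewrite xpair_eqE !permM lt_ab /= andbC.
apply/andP; split; last first.
  by apply/negP => /andP[/eqP ea /eqP eb]; rewrite ea eb in lt_ba; lia.
move: h; case: tpermP => [ea|ea|/eqP na1 /eqP na2];
  case: tpermP => [eb|eb|/eqP nb1 /eqP nb2]; subst=> // ?; try lia.
Qed.

Lemma swap_pair_inj_in i j u : {in inversions u &, injective (swap_pair i j)}.
Proof.
move=> p q; rewrite !inE => /andP[hp _] /andP[hq _] e.
by rewrite -(swap_pairK i j hp) e swap_pairK.
Qed.

Lemma ell_tperm u i j :
  (i < j)%N -> (u i < u j)%N -> (ell u < ell (u \oS tperm i j))%N.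
Proof.
move=> lt_ij lt_u; rewrite /ell -!/(inversions _).
have ijI : (i, j) \in inversions (u \oS tperm i j).
  by rewrite inE /= lt_ij !permM tpermL tpermR lt_u.
rewrite (cardsD1 (i, j) (inversions (_ \oS _))) ijI add1n ltnS.
rewrite -(card_in_imset (@swap_pair_inj_in i j u)).
by apply/subset_leq_card/subsetP => _ /imsetP[p hp ->]; apply: swap_pair_inv.
Qed.

Lemma ell_simple u i j :
  j = i.+1 :> nat -> (u i < u j)%N -> ell (u \oS tperm i j) = (ell u).+1.
Proof.
move=> ej lt_u; have lt_ij : (i < j)%N by lia.
apply/eqP; rewrite eqn_leq ell_tperm // andbT.
rewrite /ell -!/(inversions _).
rewrite (cardsD1 (i, j) (inversions (_ \oS _))).
rewrite -[leqRHS]add1n; apply: leq_add; first by case: (_ \in _).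
rewrite -(card_in_imset (f := swap_pair i j)); last first.
  by move=> p q /setD1P[_ hp] /setD1P[_ hq]; apply: swap_pair_inj_in hp hq.
apply/subset_leq_card/subsetP => _ /imsetP[[a b] hp ->].
move: hp; rewrite !inE /= xpair_eqE => /and3P[nij lt_ab].
rewrite !permM /swap_pair /=.
have [h|h] := ltnP (tperm i j a) (tperm i j b); first by rewrite /= h.
move=> ?; exfalso; move: h nij.
case: tpermP => [ea|ea|/eqP na1 /eqP na2];
  case: tpermP => [eb|eb|/eqP nb1 /eqP nb2]; subst; rewrite ?eqxx //=;
  move=> ??; try lia.
- by move: nb1; rewrite -val_eqE /=; lia.
- by move: na2; rewrite -val_eqE /=; lia.
Qed.

Lemma tperm_flip u i j : u \oS tperm i j \oS tperm i j = u.
Proof. by apply/permP => k; rewrite !permM tpermK. Qed.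

Lemma ell_tperm_iff u i j :
  (i < j)%N -> (ell u < ell (u \oS tperm i j))%N = (u i < u j)%N.
Proof.
move=> lt_ij; case: (ltnP (u i) (u j)) => [|h]; first exact: ell_tperm.
have lt' : (u j < u i)%N.
  rewrite ltn_neqAle h andbT; apply/negP => /eqP /val_inj /perm_inj e.
  by rewrite e ltnn in lt_ij.
have := @ell_tperm (u \oS tperm i j) i j lt_ij.
rewrite tperm_flip !permM tpermL tpermR => /(_ lt'); lia.
Qed.

Lemma bruhat_stepP u v :
  reflect (exists i j, [/\ (i < j)%N, (u i < u j)%N & v = u \oS tperm i j])
          (bruhat_step u v).
Proof.
apply: (iffP existsP) => [[i /existsP[j /and3P[nij /eqP -> h]]]|].
  have [lt_ij|lt_ji|/val_inj e] := ltngtP i j.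
  - by exists i, j; split=> //; rewrite -ell_tperm_iff.
  - exists j, i; rewrite tpermC; split=> //.
    by rewrite -ell_tperm_iff // tpermC.
  - by rewrite e eqxx in nij.
case=> i [j [lt_ij lt_u ->]]; exists i; apply/existsP; exists j.
by rewrite eqxx ell_tperm // -val_eqE /= ltn_eqF.
Qed.

Lemma bruhat_simple u i j : (i < j)%N -> (u i < u j)%N ->
  bruhat u (u \oS tperm i j).
Proof. by move=> h1 h2; apply/connect1/bruhat_stepP; exists i, j. Qed.

(** Conjugation by an adjacent transposition keeps the order of the two points of a transposition,
    unless the two transpositions coincide. *)
Lemma step_simple u v i j : j = i.+1 :> nat -> bruhat_step u v ->
  v = u \oS tperm i j \/ bruhat_step (u \oS tperm i j) (v \oS tperm i j).
Proof.
move=> ej /bruhat_stepP[a [b [lt_ab lt_u ->]]]; set s := tperm i j.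
have [lt_s|le_s] := ltnP (s a) (s b); [right|left].
  apply/bruhat_stepP; exists (s a), (s b); rewrite !permM !tpermK.
  split=> //; apply/permP => k; rewrite !permM.
  by congr (u _); rewrite (inj_tperm (s a)) ?tpermK //; apply: perm_inj.
suff [-> ->] : a = i /\ b = j by [].
move: le_s; rewrite /s.
case: tpermP => [ea|ea|/eqP na1 /eqP na2];
  case: tpermP => [eb|eb|/eqP nb1 /eqP nb2]; subst; rewrite ?eqxx //=;
  move=> ?; try (by exfalso; lia).
- by exfalso; move: nb1; rewrite -val_eqE /=; lia.
- by exfalso; move: na2; rewrite -val_eqE /=; lia.
Qed.

(** The form of the lifting property that passes through an induction along a chain; the two usual
    halves are read off from it below. *)
Lemma bruhat_simple_pair u v i j : j = i.+1 :> nat -> bruhat u v ->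
  let s := tperm i j in
  (bruhat (u \oS s) v \/ bruhat (u \oS s) (v \oS s)) /\
  (bruhat u (v \oS s) \/ bruhat (u \oS s) (v \oS s)).
Proof.
move=> ej /connectP[p]; elim: p u => [|x p IHp] u /=.
  by move=> _ -> /=; split; right; apply: bruhat_refl.
case/andP=> st pth lst; have [h1 h2] := IHp x pth lst.
have xv : bruhat x v by apply/connectP; exists p.
have ux : bruhat u x by apply: connect1.
case: (step_simple ej st) => [ex|/connect1 st'].
  split; first by left; rewrite -ex.
  case: h2 => h; first by right; rewrite -ex.
  by left; move: h; rewrite ex tperm_flip.
split.
  by case: h1 => h; [left|right]; apply: connect_trans st' h.
case: h2 => h; first by left; apply: connect_trans ux h.
by right; apply: connect_trans st' h.
Qed.

Lemma bruhat_lift_le u v i j : j = i.+1 :> nat -> (v j < v i)%N ->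
  bruhat u v -> bruhat (u \oS tperm i j) v.
Proof.
move=> ej hv uv; have vs : bruhat (v \oS tperm i j) v.
  rewrite -{2}(tperm_flip v i j); apply: bruhat_simple; first by lia.
  by rewrite !permM tpermL tpermR.
by have [[//|h] _] := bruhat_simple_pair ej uv; apply: connect_trans h vs.
Qed.

Lemma bruhat_lift_ge u v i j : j = i.+1 :> nat -> (u i < u j)%N ->
  bruhat u v -> bruhat u (v \oS tperm i j).
Proof.
move=> ej hu uv; have us : bruhat u (u \oS tperm i j).
  by apply: bruhat_simple => //; lia.
by have [_ [//|h]] := bruhat_simple_pair ej uv; apply: connect_trans us h.
Qed.

Lemma bruhatV u v : bruhat u v -> bruhat (u^-1)%g (v^-1)%g.
Proof.
case/connectP=> p; elim: p u => [|x p IHp] u /=.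
  by move=> _ ->; apply: bruhat_refl.
case/andP=> /bruhat_stepP[i [j [lt_ij lt_u ex]]] pth lst.
apply: connect_trans (IHp _ pth lst); apply/connect1/bruhat_stepP.
exists (u i), (u j); rewrite !permK; split=> //.
rewrite ex; apply/permP => k; rewrite /pcomp invMg tpermV !permM.
rewrite -{2}(permKV u k) inj_tperm ?permK //; exact: perm_inj.
Qed.

Lemma ellV u : ell (u^-1)%g = ell u.
Proof.
rewrite /ell -!/(inversions _).
pose g (p : 'I_m * 'I_m) := (u p.2, u p.1).
have g_inj : injective g by move=> [a b] [c d] [/perm_inj -> /perm_inj ->].
rewrite -(card_imset (inversions u) g_inj); apply: eq_card => -[a b].
rewrite !inE /=; apply/idP/imsetP => [/andP[h1 h2]|[[c d]]].
  exists ((u^-1)%g b, (u^-1)%g a); last by rewrite /g /= !permKV.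
  by rewrite inE /= !permKV h1 h2.
by rewrite inE /= => /andP[h1 h2] [-> ->]; rewrite !permK h1 h2.
Qed.

End BruhatOrder.

(** * The rank matrix criterion for the Bruhat order *)

Section RankMatrix.

Variable m : nat.
Implicit Types (u v x : 'S_m) (i j : 'I_m).

(** The cardinalities of these sets are the entries of the rank matrix of [u]; the Bruhat order is
    the entrywise order on rank matrices. *)
Definition rank_set u (a b : nat) : {set 'I_m} :=
  [set k : 'I_m | (k < a)%N && (b <= u k)%N].

Lemma rank_tperm_out u i j a b : (i < j)%N -> (u i < u j)%N ->
  ~~ [&& i < a, a <= j, u i < b & b <= u j]%N ->
  #|rank_set (u \oS tperm i j) a b| = #|rank_set u a b|.
Proof.
move=> lt_ij lt_u out.
have [lt_ja|le_aj] := ltnP j a.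
  rewrite -(card_imset (rank_set u a b) (@perm_inj _ (tperm i j))).
  apply: eq_card => k; rewrite -{2}(tpermK i j k) mem_imset; last exact: perm_inj.
  rewrite !inE permM; congr (_ && _).
  by case: tpermP => [->|->|]; lia.
apply: eq_card => k; rewrite !inE permM.
by move: out; case: tpermP => [->|->|]; lia.
Qed.

(** A point counted for the new permutation is [i], or has a value above [v i], or precedes [i]:
    between [i] and [j] the values in question are excluded. Before [i] the permutations agree, and
    above [v i] the given inequality applies. *)
Lemma rank_tperm_in u v i j a b : (i < j)%N ->
    (forall k : 'I_m, (k < i)%N -> u k = v k) ->
    (u i < u j)%N -> (u j <= v i)%N ->
    (forall k : 'I_m, (i < k < j)%N -> ~~ (u i < u k <= v i)%N) ->
    [&& i < a, a <= j, u i < b & b <= u j]%N ->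
    (#|rank_set u a (v i).+1| <= #|rank_set v a (v i).+1|)%N ->
  (#|rank_set (u \oS tperm i j) a b| <= #|rank_set v a b|)%N.
Proof.
move=> lt_ij eq_uv lt_u le_v minj /and4P[lt_ia le_aj lt_b le_b] hr.
pose W := [set k : 'I_m | (k < i)%N && (b <= u k <= v i)%N].
have dW (z : 'S_m) : (forall k : 'I_m, (k < i)%N -> u k = z k) ->
    [disjoint rank_set z a (v i).+1 & W].
  move=> ez; rewrite -setI_eq0; apply/eqP/setP => k; rewrite !inE.
  have [lt_ki|] := ltnP k i; last by rewrite andbF.
  by rewrite (ez k lt_ki); lia.
have sU : rank_set (u \oS tperm i j) a b
    \subset i |: (rank_set u a (v i).+1 :|: W).
  apply/subsetP => k; rewrite !inE permM; case: tpermP => [->|->|]; rewrite ?eqxx //; first by lia.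
  move=> /eqP ki /eqP kj /andP[ka bk]; rewrite (negPf ki) /= ka bk /=.
  have [//|le_k /=] := ltnP (v i) (u k).
  have ki' : (k : nat) != i by rewrite val_eqE.
  by have := minj k; lia.
have sV : i |: (rank_set v a (v i).+1 :|: W) \subset rank_set v a b.
  apply/subsetP => k; rewrite !inE => /or3P[/eqP ->|?|/and3P[ki bk kv]].
  - by lia.
  - by lia.
  - by rewrite -eq_uv; lia.
apply: leq_trans (subset_leq_card sU) _.
apply: leq_trans _ (subset_leq_card sV).
rewrite !cardsU1 !cardsU (disjoint_setI0 (dW u _)) // (disjoint_setI0 (dW v _)) //.
rewrite cards0 !subn0.
have -> : i \in rank_set u a (v i).+1 :|: W = false by rewrite !inE; lia.
have -> : i \in rank_set v a (v i).+1 :|: W = false by rewrite !inE; lia.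
by rewrite leq_add2l leq_add2r.
Qed.

(* At the first place where u and v differ, swapping the value of u there     *)
(* with the next suitable one moves u up without leaving the ranks below v.   *)
Lemma rank_bruhat u v :
  (forall a b, (#|rank_set u a b| <= #|rank_set v a b|)%N) -> bruhat u v.
Proof.
have [N] := ubnP (m * m - ell u); elim: N u => // N IHN u ltN hr.
have [->|neq_uv] := eqVneq u v; first exact: bruhat_refl.
have [i0 hi0] : exists i, u i != v i.
  apply/existsP; rewrite -negb_forall; apply: contra neq_uv => /forallP h.
  by apply/eqP/permP => k; apply/eqP.
case: (@arg_minnP _ i0 (fun i => u i != v i) val hi0) => i hi mini.
have eq_uv (k : 'I_m) : (k < i)%N -> u k = v k.
  by move=> lt_ki; apply/eqP/contraT => /mini /=; lia.
have hi' : (u i : nat) != v i by rewrite val_eqE.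
have lt_i : (u i < v i)%N.
  rewrite ltnNge; apply/negP => le_i.
  have := hr i.+1 (u i); rewrite leqNgt => /negP[]; apply: proper_card.
  apply/properP; split; last by exists i; rewrite !inE; lia.
  apply/subsetP => k; rewrite !inE => /andP[ki ku].
  have [|] := ltnP k i; first by move=> lt_ki; rewrite (eq_uv k lt_ki); lia.
  move=> le_ik; have ek : k = i by apply: val_inj => /=; lia.
  by rewrite ek in ku *; lia.
pose j0 := (u^-1)%g (v i).
have uj0 : u j0 = v i by rewrite permKV.
have hj0 : (i < j0)%N && (u i < u j0 <= v i)%N.
  rewrite uj0 lt_i leqnn !andbT.
  have [//|lt_j0|/val_inj e] := ltngtP i j0; last first.
    by rewrite e uj0 in hi'; rewrite -e eqxx in hi'.
  have := eq_uv _ lt_j0; rewrite uj0 => /perm_inj e; by rewrite -e in lt_j0; lia.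
case: (@arg_minnP _ j0 (fun j => (i < j)%N && (u i < u j <= v i)%N) val hj0).
move=> j /and3P[lt_ij lt_u le_v] minj.
have lt_ell := ell_tperm lt_ij lt_u.
apply: connect_trans (bruhat_simple lt_ij lt_u) _.
have ell_le x : (ell x <= m * m)%N.
  by have := max_card (mem (inversions x)); rewrite card_prod card_ord.
apply: IHN.
  by have := ell_le (u \oS tperm i j); move: ltN lt_ell; set q := (m * m)%N; lia.
move=> a b.
have [hin|hout] := boolP [&& i < a, a <= j, u i < b & b <= u j]%N.
  apply: rank_tperm_in (hr _ _) => // k /andP[lt_ik lt_kj].
  by apply/negP => h; have := minj k; rewrite lt_ik h /= => /(_ isT); lia.
by rewrite rank_tperm_out.
Qed.

End RankMatrix.

(** * Twisted identities as fixed point free involutions *)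

(** The adjacent transposition on all natural numbers, so that statements about letters become
    linear arithmetic. *)
Definition sw (k j : nat) : nat :=
  if j == k then k.+1 else if j == k.+1 then k else j.

Section Theta.

Variable m : nat.
Implicit Types (u v s : 'S_m) (i j : 'I_m).

Lemma thetaE u i : theta u i = rev_ord (u (rev_ord i)).
Proof. by rewrite !permM !permE. Qed.

Lemma thetaM u v : theta (u \oS v) = theta u \oS theta v.
Proof. by apply/permP => i; rewrite !permM !permE rev_ordK. Qed.

Lemma thetaK u : theta (theta u) = u.
Proof. by apply/permP => i; rewrite !permM !permE !rev_ordK. Qed.

Lemma thetaV u : theta (u^-1)%g = ((theta u)^-1)%g.
Proof.
apply/permP => i; apply: (@perm_inj _ (theta u)); rewrite permKV.
by rewrite !thetaE rev_ordK permKV rev_ordK.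
Qed.

Lemma pcompV u v : ((u \oS v)^-1)%g = (v^-1)%g \oS (u^-1)%g.
Proof. by rewrite /pcomp invMg. Qed.

Lemma twconj_in u s :
  u \in twisted_identities m -> twconj u s \in twisted_identities m.
Proof.
case/imsetP=> v _ ->; apply/imsetP; exists (v \oS s) => //.
by rewrite /twconj pcompV thetaM !pcompA.
Qed.

Lemma theta_tperm i j : theta (tperm i j) = tperm (rev_ord i) (rev_ord j).
Proof.
apply/permP => l; rewrite thetaE (inj_tperm i) ?rev_ordK //.
exact: rev_ord_inj.
Qed.

End Theta.

Section TwistedIdentityType.

Variable n : nat.
Notation m := (2 * n)%N.

Definition tid : Type := {x : 'S_m | x \in twisted_identities m}.
HB.instance Definition _ := Finite.on tid.

Implicit Types (x y z : tid) (u v w s : 'S_m) (i j : 'I_m) (k l : nat).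

Lemma theta_tid x : theta ((val x)^-1)%g = val x.
Proof.
have /imsetP[v _ ->] := valP x.
by rewrite pcompV thetaM -!thetaV invgK thetaK.
Qed.

Definition fo x i : 'I_m := rev_ord (val x i).

Lemma tidVE x i : ((val x)^-1)%g (rev_ord i) = fo x i.
Proof. by rewrite /fo -{2}(theta_tid x) thetaE rev_ordK. Qed.

Lemma foK x : involutive (fo x).
Proof. by move=> i; rewrite -tidVE /fo rev_ordK permK. Qed.

Lemma fo_neq x i : fo x i != i.
Proof.
have /imsetP[v _ ex] := valP x; rewrite /fo ex permM thetaE rev_ordK.
apply/negP => /eqP /(congr1 v); rewrite permKV => /(congr1 val) /=.
by have := ltn_ord (v i); lia.
Qed.

(* The involution w0 x on the points 0, ..., m.-1 (the identity outside).      *)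
Definition F x k : nat := oapp (fun i : 'I_m => val (fo x i)) k (insub k).

Lemma F_ord x i : F x i = fo x i.
Proof. by rewrite /F valK. Qed.

Lemma F_lt x k : (k < m)%N -> (F x k < m)%N.
Proof. by move=> hk; rewrite (F_ord x (Ordinal hk)). Qed.

Lemma F_K x k : (k < m)%N -> F x (F x k) = k.
Proof. by move=> hk; rewrite (F_ord x (Ordinal hk)) F_ord foK. Qed.

Lemma F_neq x k : (k < m)%N -> F x k <> k.
Proof.
by move=> hk; rewrite (F_ord x (Ordinal hk)) => e; have /eqP[] :=
  fo_neq x (Ordinal hk); apply: val_inj.
Qed.

Lemma F_ext x y : (forall k, (k < m)%N -> F x k = F y k) -> x = y.
Proof.
move=> h; apply/val_inj/permP => i; apply: rev_ord_inj.
by apply: val_inj; have := h i (ltn_ord i); rewrite !F_ord.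
Qed.

(* The adjacent transposition exchanging k and k.+1, and 1 if out of range.    *)
Definition sr k : 'S_m :=
  if insub k is Some i then if insub k.+1 is Some j then tperm i j else 1%g
  else 1%g.

Lemma srE i j : j = i.+1 :> nat -> sr i = tperm i j.
Proof. by move=> e; rewrite /sr valK -e valK. Qed.

Lemma sr_ex k : (k.+1 < m)%N ->
  exists i j, [/\ i = k :> nat, j = i.+1 :> nat & sr k = tperm i j].
Proof.
move=> hk; exists (Ordinal (ltnW hk)), (Ordinal hk); split=> //.
exact: (@srE (Ordinal (ltnW hk)) (Ordinal hk)).
Qed.

Definition tcj x k : tid :=
  exist (fun u => u \in twisted_identities m) _ (twconj_in (sr k) (valP x)).
Notation "x \tw k" := (tcj x k) (at level 40, left associativity).

Lemma tperm_sw i j (l : 'I_m) : j = i.+1 :> nat -> tperm i j l = sw i l :> nat.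
Proof.
move=> e; rewrite /sw; case: tpermP => [->|->|/eqP h1 /eqP h2].
- by rewrite eqxx e.
- by rewrite e eqxx; case: eqP => //; lia.
- rewrite -val_eqE /= in h1; rewrite -val_eqE /= e in h2.
  by rewrite (negPf h1) (negPf h2).
Qed.

Lemma F_out x k : (m <= k)%N -> F x k = k.
Proof. by move=> hk; rewrite /F insubF // ltnNge hk. Qed.

Lemma F_tcj x k l : (k.+1 < m)%N -> F (x \tw k) l = sw k (F x (sw k l)).
Proof.
move=> hk; have [hl|hl] := ltnP l m; last first.
  have e : sw k l = l by rewrite /sw; do !case: eqP; lia.
  by rewrite e !F_out.
have [i [j [ei ej es]]] := sr_ex hk.
rewrite -[l]/(val (Ordinal hl)) F_ord; set o := Ordinal hl.
rewrite /fo [val (x \tw k)]/= /twconj es tpermV (pcompE (theta _ \oS _)).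
rewrite (pcompE (theta _)) thetaE rev_ordK.
by rewrite -ei -(tperm_sw _ ej) F_ord -(tperm_sw _ ej).
Qed.

(* These say that x * s_k lies below x, equals x, lies above x.                *)
Definition dn x k := (F x k < F x k.+1)%N.
Definition fx x k := (F x k == k.+1).
Definition up x k := (F x k.+1 < F x k)%N && (F x k != k.+1).

Lemma val_lt x i j : (val x i < val x j)%N = (F x j < F x i)%N.
Proof.
rewrite !F_ord /fo; move: (val x i) (val x j) => a b /=.
by have := ltn_ord a; have := ltn_ord b; lia.
Qed.

Lemma valV_lt x i j :
  (((val x)^-1)%g (rev_ord i) < ((val x)^-1)%g (rev_ord j))%N = (F x i < F x j)%N.
Proof. by rewrite !tidVE !F_ord. Qed.

Definition tle x y := bruhat (val x) (val y).

Lemma tle_refl x : tle x x.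
Proof. exact: bruhat_refl. Qed.

Lemma tle_trans y x z : tle x y -> tle y z -> tle x z.
Proof. exact: bruhat_trans. Qed.

Lemma tle_anti x y : tle x y -> tle y x -> x = y.
Proof. by move=> h1 h2; apply/val_inj/bruhat_anti/andP. Qed.

Lemma tpermL_inv u i j : ((tperm i j \oS u)^-1)%g = (u^-1)%g \oS tperm i j.
Proof. by rewrite pcompV tpermV. Qed.

Lemma bruhat_liftL_le u v i j : j = i.+1 :> nat ->
  ((v^-1)%g j < (v^-1)%g i)%N -> bruhat u v -> bruhat (tperm i j \oS u) v.
Proof.
move=> e h /bruhatV; move/(bruhat_lift_le e h)/bruhatV.
by rewrite -tpermL_inv !invgK.
Qed.

Lemma bruhat_liftL_ge u v i j : j = i.+1 :> nat ->
  ((u^-1)%g i < (u^-1)%g j)%N -> bruhat u v -> bruhat u (tperm i j \oS v).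
Proof.
move=> e h /bruhatV; move/(bruhat_lift_ge e h)/bruhatV.
by rewrite -tpermL_inv !invgK.
Qed.

Lemma tcjE x i j : j = i.+1 :> nat ->
  val (x \tw i) = tperm (rev_ord j) (rev_ord i) \oS val x \oS tperm i j.
Proof. by move=> e; rewrite /= /twconj (srE e) tpermV theta_tperm tpermC. Qed.

Lemma rev_succ i j : j = i.+1 :> nat -> rev_ord i = (rev_ord j).+1 :> nat.
Proof. by move=> e /=; have := ltn_ord j; lia. Qed.

Lemma lift_le x y k : (k.+1 < m)%N -> dn y k -> tle x y -> tle (x \tw k) y.
Proof.
move=> hk hd xy; have [i [j [ei ej _]]] := sr_ex hk.
rewrite /tle -ei (tcjE _ ej); rewrite /dn -ei -ej in hd.
rewrite pcompA; apply: (bruhat_liftL_le (rev_succ ej)).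
  by rewrite valV_lt.
by apply: (bruhat_lift_le ej); rewrite ?val_lt.
Qed.

(** Unless the letter fixes [x], right multiplication does not change the effect on length of left
    multiplication by the mirrored transposition. Hence twisted conjugation changes the length by
    two. *)
Lemma valVs x i j : j = i.+1 :> nat -> F x i <> j ->
  (((val x \oS tperm i j)^-1)%g (rev_ord i) < ((val x \oS tperm i j)^-1)%g (rev_ord j))%N
   = (F x i < F x j)%N.
Proof.
move=> e ne; rewrite pcompV tpermV !permM !tidVE !(tperm_sw _ e) !F_ord.
have n1 : fo x i <> fo x j :> nat.
  by move/val_inj/(can_inj (foK x)) => e'; rewrite e' in e; lia.
have n2 : fo x j <> j :> nat by move=> /val_inj h; have /eqP := fo_neq x j.
have n3 : fo x j <> i :> nat.
  by move=> /val_inj h; apply: ne; rewrite F_ord -h foK.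
have n4 : fo x i <> i :> nat by move=> /val_inj h; have /eqP := fo_neq x i.
rewrite F_ord in ne; rewrite /sw -!e.
by do !case: eqP => //; lia.
Qed.

Lemma lift_ge x y k : (k.+1 < m)%N -> dn y k -> ~~ dn x k -> tle x y ->
  tle x (y \tw k).
Proof.
move=> hk hd; have [i [j [ei ej _]]] := sr_ex hk.
have nij : F x i <> F x j.
  by rewrite !F_ord => /val_inj/(can_inj (foK x)) e; rewrite e in ej; lia.
rewrite /dn -ei -ej in hd; rewrite /tle -ei (tcjE _ ej) /dn -ej -leqNgt leq_eqVlt eq_sym.
case/orP => [/eqP //|hx xy].
rewrite pcompA.
apply: (bruhat_liftL_ge (rev_succ ej)); first by rewrite valV_lt.
by apply: (bruhat_lift_ge ej); rewrite ?val_lt.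
Qed.

Lemma ell_up x k : (k.+1 < m)%N -> up x k -> ell (val (x \tw k)) = (ell (val x)).+2.
Proof.
move=> hk; have [i [j [ei ej _]]] := sr_ex hk.
rewrite /up -ei -ej (tcjE _ ej) => /andP[h /eqP ne].
rewrite pcompA -ellV tpermL_inv (ell_simple (rev_succ ej)); last first.
  by rewrite ltnNge leq_eqVlt valVs // ltnNge (ltnW h) orbF eq_sym val_eqE
    (inj_eq perm_inj) -val_eqE /=; have := ltn_ord j; lia.
by rewrite ellV (ell_simple ej) // val_lt.
Qed.

End TwistedIdentityType.

Notation "x \tw k" := (tcj x k) (at level 40, left associativity).

Lemma swP k j :
  [\/ j = k /\ sw k j = k.+1, j = k.+1 /\ sw k j = k
    | [/\ j <> k, j <> k.+1 & sw k j = j]].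
Proof.
rewrite /sw; case: eqP => [->|h1]; first by constructor 1.
by case: eqP => [->|h2]; [constructor 2 | constructor 3].
Qed.

Lemma swP' k j : (j = k /\ sw k j = k.+1) \/ (j = k.+1 /\ sw k j = k) \/
  (j <> k /\ j <> k.+1 /\ sw k j = j).
Proof. by case: (swP k j) => [[]|[]|[]]; lia. Qed.

(* Evaluates the innermost occurrences of [sw] first, pruning with [lia]. *)
Ltac sw_split := repeat match goal with
  | |- context [sw ?k ?j] => lazymatch j with context [sw] => fail | _ =>
      let e := fresh "e" in
      destruct (swP' k j) as [[? e]|[[? e]|[? [? e]]]]; try (exfalso; lia);
      rewrite ?e; clear e end
  end.

Lemma swK k : involutive (sw k).
Proof. by move=> j; sw_split; lia. Qed.

Lemma sw_lt m k j : k.+1 < m -> j < m -> sw k j < m.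
Proof. by move=> *; sw_split; lia. Qed.

Definition far (k l : nat) := (k.+1 < l) || (l.+1 < k).
Definition adj (k l : nat) := (l == k.+1) || (k == l.+1).

Lemma sw_far k l j : far k l -> sw k (sw l j) = sw l (sw k j).
Proof. by rewrite /far => *; sw_split; lia. Qed.

Lemma sw_braid k l j : adj k l -> sw k (sw l (sw k j)) = sw l (sw k (sw l j)).
Proof. by rewrite /adj => *; sw_split; lia. Qed.

(** * Orbits of one and of two letters *)

Section Letters.

Variable n : nat.
Notation m := (2 * n)%N.
Implicit Types (x y z : tid n) (k l g d r s : nat).

Lemma F_iff x k l : k < m -> l < m -> (F x k = l <-> F x l = k).
Proof. by move=> hk hl; split=> <-; rewrite F_K. Qed.

Lemma F_inj x k l : k < m -> l < m -> F x k = F x l -> k = l.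
Proof. by move=> hk hl e; rewrite -(F_K x hk) e F_K. Qed.

Lemma tcjK x k : k.+1 < m -> x \tw k \tw k = x.
Proof.
move=> hk; apply: F_ext => j hj.
by rewrite !F_tcj // !swK.
Qed.

Lemma tcj_far x k l :
  k.+1 < m -> l.+1 < m -> far k l -> x \tw k \tw l = x \tw l \tw k.
Proof.
move=> hk hl h; apply: F_ext => j hj; rewrite !F_tcj //.
by rewrite !(sw_far _ h).
Qed.

Lemma tcj_braid x k l : k.+1 < m -> l.+1 < m -> adj k l ->
  x \tw k \tw l \tw k = x \tw l \tw k \tw l.
Proof.
move=> hk hl h; apply: F_ext => j hj; rewrite !F_tcj //.
by rewrite !(sw_braid _ h).
Qed.

(* The arcs among two, three or four given points, in a form that leaves only *)
(* linear arithmetic.                                                         *)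
Lemma F_pair x a b : a < m -> b < m -> a <> b ->
  F x a <> a /\ F x b <> b /\ F x a <> F x b /\ ((F x a = b /\ F x b = a) \/ (F x a <> b /\ F x b <> a)).
Proof.
move=> ha hb ne; do !split; try exact: F_neq; first by move/F_inj; auto.
by have := F_iff x ha hb; have [|] := eqVneq (F x a) b; have [|] := eqVneq (F x b) a; lia.
Qed.

Lemma fx_tcj x k : k.+1 < m -> fx x k -> x \tw k = x.
Proof.
rewrite /fx => hk /eqP h; apply: F_ext => j hj; rewrite F_tcj //.
have h1 : F x k.+1 = k by rewrite -h F_K //; lia.
have [->|n1] := eqVneq j k; first by rewrite h; sw_split; lia.
have [->|n2] := eqVneq j k.+1; first by rewrite h1; sw_split; lia.
have : F x j <> k by move=> e; have := F_iff x hj (ltnW hk); lia.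
have : F x j <> k.+1 by move=> e; have := F_iff x hj hk; lia.
by move=> *; sw_split; lia.
Qed.

Lemma dn_up x k : k.+1 < m -> dn x k -> up (x \tw k) k.
Proof.
rewrite /dn /up => hk h; rewrite !F_tcj //.
by have := @F_pair x k k.+1 (ltnW hk) hk; move=> *; sw_split; lia.
Qed.

Lemma up_dn x k : k.+1 < m -> up x k -> dn (x \tw k) k.
Proof.
rewrite /dn /up => hk h; rewrite !F_tcj //.
by have := @F_pair x k k.+1 (ltnW hk) hk; move=> *; sw_split; lia.
Qed.

Lemma states x k : k.+1 < m ->
  (dn x k /\ ~~ up x k /\ ~~ fx x k) \/ (~~ dn x k /\ up x k /\ ~~ fx x k) \/
  (~~ dn x k /\ ~~ up x k /\ fx x k).
Proof.
move=> hk; rewrite /dn /up /fx; have := @F_pair x k k.+1 (ltnW hk) hk; lia.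
Qed.

Ltac intro_no_sw := repeat match goal with
  | |- ?P -> _ => lazymatch P with context [sw] => fail | _ => intro end
  end.

Ltac F_split x a b :=
  let h := fresh in
  (have h := @F_pair x a b ltac:(lia) ltac:(lia) ltac:(lia));
  destruct h as [? [? [? [[? ?]|[? ?]]]]]; try (exfalso; lia).

Ltac adj_tac x k :=
  rewrite /dn /up /fx ?F_tcj //; intro_no_sw;
  F_split x k k.+1; F_split x k k.+2; F_split x k.+1 k.+2; sw_split; move=> *; lia.

(** Here [x] is the bottom of a hexagonal orbit of the two letters. *)
Lemma adj_up_up x g d : g.+1 < m -> d.+1 < m -> adj g d -> up x g -> up x d ->
  up (x \tw g) d /\ up (x \tw g \tw d) g.
Proof.
move=> hg hd /orP[/eqP e|/eqP e]; subst.
- by adj_tac x g.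
- by adj_tac x d.
Qed.

(** Here the orbit of the two letters is a chain of three elements, whose bottom is fixed by [d] and
    whose top is fixed by [g]. *)
Lemma adj_fx_up x g d : g.+1 < m -> d.+1 < m -> adj g d -> fx x d -> up x g ->
  up (x \tw g) d /\ fx (x \tw g \tw d) g.
Proof.
move=> hg hd /orP[/eqP e|/eqP e]; subst.
- by adj_tac x g.
- by adj_tac x d.
Qed.

Lemma adj_fx_dn x g d : g.+1 < m -> d.+1 < m -> adj g d -> fx x d -> dn x g ->
  dn (x \tw g) d /\ fx (x \tw g \tw d) g.
Proof.
move=> hg hd /orP[/eqP e|/eqP e]; subst.
- by adj_tac x g.
- by adj_tac x d.
Qed.

Lemma adj_fx_fx x g d : g.+1 < m -> d.+1 < m -> adj g d -> fx x d -> ~~ fx x g.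
Proof.
move=> hg hd /orP[/eqP e|/eqP e]; subst.
- by adj_tac x g.
- by adj_tac x d.
Qed.

(** The three cases: [x] has height one in a hexagonal orbit, height two in a hexagonal orbit, or is
    the middle of a chain of three elements. *)
Lemma adj_dn_up x g d : g.+1 < m -> d.+1 < m -> adj g d -> dn x g -> up x d ->
  [\/ up (x \tw g) d,
      [/\ dn (x \tw g) d, up (x \tw g \tw d) g, up (x \tw g \tw d) d
        & dn (x \tw d) g]
    | fx (x \tw g) d /\ fx (x \tw d) g].
Proof.
move=> hg hd ha hx hy; have := states (x \tw g) hd.
case=> [[h _]|[[_ [h _]]|[_ [_ h]]]]; [constructor 2|constructor 1|constructor 3] => //.
  have h2 := dn_up hd h.
  have h1 : up (x \tw g \tw d) g.
    move: ha hx hy h {h2} => /orP[/eqP e|/eqP e]; subst.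
    - by adj_tac x g.
    - by adj_tac x d.
  split=> //; rewrite -(tcjK x hg) -(tcjK (x \tw g) hd).
  set b := x \tw g \tw d in h1 h2 *.
  rewrite -(tcj_braid b hg hd ha); apply: up_dn => //.
  by have [] := adj_up_up hg hd ha h1 h2.
split=> //; move: ha hx hy h => /orP[/eqP e|/eqP e]; subst.
- by adj_tac x g.
- by adj_tac x d.
Qed.

Lemma adj_fx_fx_dn x d r s : d.+1 < m -> r.+1 < m -> s.+1 < m -> r != s ->
  adj d r -> adj d s -> fx x r -> fx x s -> dn x d.
Proof.
move=> hd hr hs ne ar as_.
have [[er es]|[er ed]] : (d = r.+1 /\ s = r.+2) \/ (d = s.+1 /\ r = s.+2).
- by move: ar as_ ne; rewrite /adj; lia.
- by subst d s; rewrite /fx /dn => *; F_split x r r.+1; F_split x r.+2 r.+3; lia.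
- by subst d r; rewrite /fx /dn => *; F_split x s s.+1; F_split x s.+2 s.+3; lia.
Qed.

Lemma adj_fx_cross x d g k : d.+1 < m -> g.+1 < m -> k.+1 < m -> g != k ->
  adj d g -> adj d k -> fx x d -> dn x k -> fx (x \tw g \tw k) d -> False.
Proof.
move=> hd hg hk ne ag ak.
have [[er es]|[er ed]] : (d = g.+1 /\ k = g.+2) \/ (d = k.+1 /\ g = k.+2).
- by move: ag ak ne; rewrite /adj; lia.
- subst d k; rewrite /fx /dn => h1 h2; rewrite !F_tcj //.
  by F_split x g.+1 g.+2; F_split x g g.+3; sw_split; lia.
- subst d g; rewrite /fx /dn => h1 h2; rewrite !F_tcj //.
  by F_split x k.+1 k.+2; F_split x k k.+3; sw_split; lia.
Qed.

(** If two letters at distance two act equally and not trivially, the four points they move are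
    joined among themselves, crosswise or nested. An ascent at [d] leaves the nested arcs, the inner
    one joining [r] and [r.+1]. *)
Lemma adj_common x r d s : r.+1 < m -> d.+1 < m -> s.+1 < m -> d != s ->
  adj r d -> adj r s -> up x d -> x \tw d = x \tw s -> fx x r.
Proof.
move=> hr hd hs ne ad ss hu e.
have e' k : sw d (F x (sw d k)) = sw s (F x (sw s k)) by rewrite -!F_tcj ?e.
move: hu; rewrite /up /fx.
have [[er es]|[er ed]] : (r = d.+1 /\ s = d.+2) \/ (r = s.+1 /\ d = s.+2).
- by move: ad ss ne; rewrite /adj; lia.
- subst r s; intro_no_sw.
  have := e' d; sw_split; move=> ?; try (by exfalso; lia);
  have := e' d.+2; sw_split; move=> ?; try (by exfalso; lia);
  F_split x d d.+1; F_split x d d.+2; F_split x d d.+3;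
  F_split x d.+1 d.+2; F_split x d.+1 d.+3; F_split x d.+2 d.+3; lia.
- subst r d; intro_no_sw.
  have := e' s; sw_split; move=> ?; try (by exfalso; lia);
  have := e' s.+2; sw_split; move=> ?; try (by exfalso; lia);
  F_split x s s.+1; F_split x s s.+2; F_split x s s.+3;
  F_split x s.+1 s.+2; F_split x s.+1 s.+3; F_split x s.+2 s.+3; lia.
Qed.

Lemma far_dn x g d : g.+1 < m -> d.+1 < m -> far g d -> up x d ->
  dn x g -> dn (x \tw d) g.
Proof.
rewrite /far /up /dn => hg hd *; rewrite !F_tcj //.
by F_split x g d; F_split x g.+1 d.+1; sw_split; lia.
Qed.

Lemma far_up x g d : g.+1 < m -> d.+1 < m -> far g d -> dn x d ->
  up x g -> up (x \tw d) g.
Proof.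
rewrite /far /up /dn => hg hd *; rewrite !F_tcj //.
by F_split x g d.+1; F_split x g.+1 d; sw_split; lia.
Qed.

Lemma far_fx x g d : g.+1 < m -> d.+1 < m -> far g d ->
  fx x g -> fx (x \tw d) g.
Proof.
by rewrite /far /fx => hg hd *; rewrite !F_tcj //; sw_split; lia.
Qed.

Lemma far_sym g d : far g d = far d g.
Proof. by rewrite /far orbC. Qed.

Lemma adj_sym g d : adj g d = adj d g.
Proof. by rewrite /adj orbC. Qed.

Lemma far_or_adj g d : g != d -> far g d || adj g d.
Proof. by rewrite /far /adj; lia. Qed.

(* Two distant descents may be exchanged by x; then both act in the same way. *)
Lemma far_dn_dn x g d : g.+1 < m -> d.+1 < m -> far g d -> dn x d ->
  dn x g -> dn (x \tw d) g \/ x \tw g = x \tw d.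
Proof.
rewrite /far /dn => hg hd hf h1 h2; rewrite !F_tcj //.
have e1 : sw d g = g by rewrite /sw; do !case: eqP; lia.
have e2 : sw d g.+1 = g.+1 by rewrite /sw; do !case: eqP; lia.
rewrite e1 e2.
have [e3|ne3] := eqVneq (F x g) d; last by left; sw_split; lia.
have [e4|ne4] := eqVneq (F x g.+1) d.+1; last by left; sw_split; lia.
have e5 : F x d = g by rewrite -e3 F_K //; lia.
have e6 : F x d.+1 = g.+1 by rewrite -e4 F_K //; lia.
right; apply: F_ext => j hj; rewrite !F_tcj //.
have [->|n1] := eqVneq j g; first by rewrite e1; do !(sw_split; rewrite ?e3 ?e4); lia.
have [->|n2] := eqVneq j g.+1; first by rewrite e2; do !(sw_split; rewrite ?e3 ?e4); lia.
have [->|n3] := eqVneq j d; first by do !(sw_split; rewrite ?e5 ?e6); lia.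
have [->|n4] := eqVneq j d.+1; first by do !(sw_split; rewrite ?e5 ?e6); lia.
have -> : sw g j = j by rewrite /sw; do !case: eqP; lia.
have -> : sw d j = j by rewrite /sw; do !case: eqP; lia.
have h a : a < m -> j <> F x a -> F x j <> a by move=> ha hja e; rewrite -e F_K in hja.
have := h g; have := h g.+1; have := h d; have := h d.+1.
by rewrite e3 e4 e5 e6 => *; sw_split; lia.
Qed.

Lemma far_up_up x g d : g.+1 < m -> d.+1 < m -> far g d -> up x d ->
  up x g -> up (x \tw d) g \/ x \tw g = x \tw d.
Proof.
move=> hg hd hf hud hug; have [[h _]|[[_ [h _]]|[_ [_ h]]]] := states (x \tw d) hg.
- have [h'|h'] := far_dn_dn hg hd hf (up_dn hd hud) h.
    rewrite tcjK // in h'; have := states x hg; rewrite h' hug; lia.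
  by right; rewrite -[in LHS](tcjK x hd) -h' tcjK.
- by left.
- by have := far_fx hg hd hf h; rewrite tcjK // => h'; have := states x hg; rewrite h' hug; lia.
Qed.

End Letters.

(** * Rank, covers and coatoms *)

Section TwistedOrder.

Variable n : nat.
Notation m := (2 * n)%N.
Implicit Types (x y z : tid n) (k l g d r s : nat).

Definition rk x := (ell (val x))./2.

Lemma rk_up x k : k.+1 < m -> up x k -> rk (x \tw k) = (rk x).+1.
Proof. by move=> hk h; rewrite /rk ell_up. Qed.

Lemma rk_dn x k : k.+1 < m -> dn x k -> rk x = (rk (x \tw k)).+1.
Proof. by move=> hk h; rewrite -(rk_up hk (dn_up hk h)) tcjK. Qed.

Lemma tle_up x k : k.+1 < m -> up x k -> tle x (x \tw k).
Proof.
move=> hk h; rewrite -{1}(tcjK x hk).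
by apply: lift_le (tle_refl _) => //; apply: up_dn.
Qed.

Lemma tle_dn x k : k.+1 < m -> dn x k -> tle (x \tw k) x.
Proof. by move=> hk h; apply: lift_le (tle_refl _). Qed.

Lemma te_proof : (1%g : 'S_m) \in twisted_identities m.
Proof.
apply/imsetP; exists 1%g => //; apply/permP => i.
by rewrite permM thetaE invg1 !perm1 rev_ordK.
Qed.

Definition te : tid n := exist (fun u => u \in twisted_identities m) _ te_proof.

Lemma F_te k : k < m -> F te k = m.-1 - k.
Proof.
move=> hk; rewrite -[k in LHS]/(val (Ordinal hk)) F_ord /fo /= perm1 /=; lia.
Qed.

(** Without descents the involution is strictly decreasing, hence it is the reversal. *)
Lemma no_dn x : (forall k, k.+1 < m -> ~~ dn x k) -> x = te.
Proof.
move=> h; have dec k : k.+1 < m -> F x k.+1 < F x k.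
  by move=> hk; have := h k hk; have := @F_pair n x k k.+1; rewrite /dn; lia.
have ub k : k < m -> F x k <= m.-1 - k.
  elim: k => [|k IHk] hk; first by have := F_lt x hk; lia.
  by have := IHk (ltnW hk); have := dec k hk; lia.
have lb k : k < m -> k <= F x (m.-1 - k).
  elim: k => [|k IHk] hk //.
  have := IHk (ltnW hk); have := dec (m.-1 - k.+1).
  have -> : (m.-1 - k.+1).+1 = m.-1 - k by lia.
  lia.
apply: F_ext => k hk; rewrite F_te //; have := ub k hk; have := lb (m.-1 - k).
have -> : m.-1 - (m.-1 - k) = k by lia.
lia.
Qed.

Lemma ex_dn x : x != te -> exists2 k, k.+1 < m & dn x k.
Proof.
move=> ne; have [/existsP[i /andP[h1 h2]]|] :=
  boolP [exists i : 'I_m, (i.+1 < m) && dn x i]; first by exists i.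
rewrite negb_exists => /forallP h; case/eqP: ne; apply: no_dn => k hk.
by have := h (Ordinal (ltnW hk)); rewrite negb_and hk.
Qed.

Lemma ell_te : ell (val te) = 0%N.
Proof.
apply/eqP; rewrite cards_eq0; apply/eqP/setP => p; rewrite !inE /= !perm1; lia.
Qed.

Lemma ell_even x : ~~ odd (ell (val x)).
Proof.
have [N] := ubnP (ell (val x)); elim: N x => // N IHN x ltN.
have [->|/ex_dn[k hk hd]] := eqVneq x te; first by rewrite ell_te.
have := ell_up hk (dn_up hk hd); rewrite tcjK // => e.
by have := IHN (x \tw k); rewrite e oddS oddS negbK; apply; lia.
Qed.

Lemma rk_lt x y : tle x y -> x <> y -> rk x < rk y.
Proof.
move=> h ne; have := bruhat_ell h.
have -> : val x != val y by apply: contra_notN ne => /eqP/val_inj.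
move=> /(_ isT); rewrite /rk; have := ell_even x; have := ell_even y; lia.
Qed.

Lemma rk_le x y : tle x y -> rk x <= rk y.
Proof. by have [->//|/eqP ne h] := eqVneq x y; apply/ltnW/rk_lt. Qed.

Lemma rk_eq x y : tle x y -> rk y <= rk x -> x = y.
Proof.
by move=> h le; apply/eqP/contraT => /eqP ne; have := rk_lt h ne; lia.
Qed.

Lemma rk_te : rk te = 0%N.
Proof. by rewrite /rk ell_te. Qed.

Lemma te_tle x : tle te x.
Proof.
have [N] := ubnP (rk x); elim: N x => // N IHN x ltN.
have [->|/ex_dn[k hk hd]] := eqVneq x te; first exact: tle_refl.
apply: tle_trans (tle_dn hk hd); apply: IHN; have := rk_dn hk hd; lia.
Qed.

Lemma rk0 x : rk x = 0%N -> x = te.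
Proof. by move=> h; apply/esym/rk_eq; rewrite ?h ?te_tle. Qed.

Lemma up_ndn x k : k.+1 < m -> up x k -> ~~ dn x k.
Proof. by move=> hk h; have := states x hk; rewrite h; lia. Qed.

Lemma fx_ndn x k : k.+1 < m -> fx x k -> ~~ dn x k.
Proof. by move=> hk h; have := states x hk; rewrite h; lia. Qed.

Lemma lift_both x y k : k.+1 < m -> dn x k -> dn y k -> tle x y ->
  tle (x \tw k) (y \tw k).
Proof.
move=> hk hx hy h; apply: lift_ge => //; first exact/up_ndn/dn_up.
exact: tle_trans (tle_dn hk hx) h.
Qed.

Lemma lift_one x y k : k.+1 < m -> dn y k -> tle x y ->
  exists2 x', x' = x \/ x' = x \tw k & tle x' (y \tw k).
Proof.
move=> hk hy h; have [hx|hx] := boolP (dn x k).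
  by exists (x \tw k); [right|apply: lift_both].
by exists x; [left|apply: lift_ge].
Qed.

(** The lifting property for a letter that acts trivially on [z]. Descend from [z] along some [r]:
    if [r] is distant from [k], then [k] also fixes [z \tw r]; if it is adjacent, the orbit of [z]
    is a chain of three elements with bottom [z \tw r \tw k], which is fixed by [r]. *)
Lemma lift_fx x z k : k.+1 < m -> fx z k -> tle x z -> tle (x \tw k) z.
Proof.
have [N] := ubnP (rk z); elim: N z x k => // N IHN z x k ltN hk hz h.
have [ez|/ex_dn[r hr hd]] := eqVneq z te.
  have -> : x = z by rewrite ez in h *; apply: tle_anti h (te_tle _).
  by rewrite fx_tcj //; apply: tle_refl.
have lt_zr := rk_dn hr hd; have le_zr := tle_dn hr hd.
have nkr : k != r by apply: contraTneq hz => ->; have := states z hr; rewrite hd; lia.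
have [x1 ex1 le1] := lift_one hr hd h.
case/orP: (far_or_adj nkr) => [fkr|akr].
  have h1 : tle (x1 \tw k) (z \tw r) by apply: IHN; rewrite ?far_fx //; lia.
  have h2 := tle_trans h1 le_zr.
  case: ex1 h2 => -> // h2.
  have -> : x \tw k = x \tw r \tw k \tw r by rewrite -(tcj_far x hk hr fkr) tcjK.
  exact: lift_le.
have [hd2 hf2] := adj_fx_dn hr hk (etrans (adj_sym r k) akr) hz hd.
have le2 := tle_dn hk hd2; have lt2 := rk_dn hk hd2.
have [x2 ex2 h2] := lift_one hk hd2 le1.
have h3 : tle (x2 \tw r) (z \tw r \tw k) by apply: IHN => //; lia.
have h4 := lift_le hk hd2 (tle_trans h3 le2).
have h5 := lift_le hk hd2 (tle_trans h2 le2).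
case: ex1 ex2 => -> [] ex2; rewrite ex2 in h2 h3 h4 h5.
- exact: tle_trans h5 le_zr.
- exact: tle_trans h2 (tle_trans le2 le_zr).
- by rewrite tcjK // in h4; apply: tle_trans h4 le_zr.
- have -> : x \tw k = x \tw r \tw k \tw r \tw k \tw r.
    by rewrite -(tcj_braid (x \tw r) hr hk) ?tcjK // adj_sym.
  by apply: lift_le (tle_trans h4 le_zr).
Qed.

(** Covering expressed through the rank; [tw_coverE] identifies it, by means of [graded], with the
    cover relation of the poset. *)
Definition cov x y := tle x y && (rk y == (rk x).+1).

(** Induction through a descent [k] of [y]. If [k] also descends at [x], take a coatom of [y \tw k]
    above [x \tw k]: either [k] carries it up to the required coatom, or [y \tw k] itself is above
    [x]; [lift_fx] covers the case where [k] fixes it. *)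
Lemma graded x y : tle x y -> x <> y ->
  exists z, tle x z /\ cov z y.
Proof.
have [N] := ubnP (rk y); elim: N x y => // N IHN x y ltN h ne.
have [ey|/ex_dn[k hk hd]] := eqVneq y te.
  by case: ne; rewrite ey in h *; apply: tle_anti h (te_tle _).
have e := rk_dn hk hd; have le_yk := tle_dn hk hd.
have cy : cov (y \tw k) y by rewrite /cov le_yk -e /=.
have [hx|hx] := boolP (dn x k); last by exists (y \tw k); split=> //; apply: lift_ge.
have [z [h1 /andP[h2 /eqP h3]]] : exists z, tle (x \tw k) z /\ cov z (y \tw k).
  apply: IHN; [lia | exact: lift_both |].
  by move=> e2; apply: ne; rewrite -(tcjK x hk) e2 tcjK.
have [[hz _]|[[_ [hz _]]|[_ [_ hz]]]] := states z hk.
- exists (y \tw k); split=> //; apply: tle_trans h2.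
  by rewrite -(tcjK x hk); apply: lift_le.
- exists (z \tw k); split.
    rewrite -(tcjK x hk); apply: (lift_le hk (up_dn hk hz)).
    exact: tle_trans h1 (tle_up hk hz).
  rewrite /cov (rk_up hk hz) -h3 -e eqxx andbT.
  exact: lift_le (tle_trans h2 le_yk).
- exists (y \tw k); split=> //; apply: tle_trans h2.
  by rewrite -(tcjK x hk); apply: lift_fx.
Qed.

End TwistedOrder.

(** * Elements determined by their coatoms *)

Section Coatoms.

Variable n : nat.
Notation m := (2 * n)%N.
Implicit Types (x y z u v a b c : tid n) (k l g d r s : nat).

Lemma cov_le x y : cov x y -> tle x y. Proof. by case/andP. Qed.
Lemma cov_rk x y : cov x y -> rk y = (rk x).+1. Proof. by case/andP => _ /eqP. Qed.

Lemma covP x y : tle x y -> rk y = (rk x).+1 -> cov x y.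
Proof. by move=> h e; rewrite /cov h e eqxx. Qed.

Lemma cov_dn x k : k.+1 < m -> dn x k -> cov (x \tw k) x.
Proof. by move=> hk h; apply: covP; [apply: tle_dn | apply: rk_dn]. Qed.

Lemma cov_up x k : k.+1 < m -> up x k -> cov x (x \tw k).
Proof. by move=> hk h; apply: covP; [apply: tle_up | apply: rk_up]. Qed.

(** By lifting, a [z] without descent at [k] lies below [v \tw k], which has the same rank. Applied
    to several coatoms of [v], this bounds the descents of [v]. *)
Lemma cov_lift z v k : k.+1 < m -> cov z v -> dn v k -> z = v \tw k \/ dn z k.
Proof.
move=> hk /andP[h /eqP e] hd; have [|hz] := boolP (dn z k); first by right.
by left; apply: rk_eq; [apply: lift_ge | have := rk_dn hk hd; lia].
Qed.

Lemma up_dnF x k : k.+1 < m -> up x k -> dn x k -> False.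
Proof. by move=> hk h1 h2; have := states x hk; rewrite h1 h2; lia. Qed.

Lemma up_fxF x k : k.+1 < m -> up x k -> fx x k -> False.
Proof. by move=> hk h1 h2; have := states x hk; rewrite h1 h2; lia. Qed.

Lemma dn_fxF x k : k.+1 < m -> dn x k -> fx x k -> False.
Proof. by move=> hk h1 h2; have := states x hk; rewrite h1 h2; lia. Qed.

Lemma tcj_eq x y k : k.+1 < m -> x \tw k = y -> x = y \tw k.
Proof. by move=> hk <-; rewrite tcjK. Qed.

Lemma dn_neq x k l : k.+1 < m -> dn x k -> up x l -> k != l.
Proof.
by move=> hk h1 h2; apply/eqP => e; rewrite -e in h2; apply: up_dnF h1.
Qed.

Lemma adj_farF k l : adj k l -> far k l -> False.
Proof. by rewrite /adj /far; lia. Qed.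

Lemma adj_adj_far d k l : adj d k -> adj d l -> k != l -> far k l.
Proof. by rewrite /adj /far; lia. Qed.

Lemma adj_triangleF d k l : adj k l -> adj d k -> adj d l -> False.
Proof. by rewrite /adj; lia. Qed.

Lemma far_neq k l : far k l -> k != l.
Proof. by rewrite /far; lia. Qed.

(** In rank at least 3, descend from [y] along letters [d], [g], [k]. Whatever their relative
    positions, either a second coatom of [y] appears or the arcs contradict the descent at [k]. *)
Lemma single_coatom y a : (forall z, cov z y -> z = a) -> rk y <= 2.
Proof.
move=> single; rewrite leqNgt; apply/negP => rk3.
have /ex_dn[d hd dy] : y != te n by apply: contraTneq rk3 => ->; rewrite rk_te.
have ea : y \tw d = a by apply/single/cov_dn.
have ey : y = a \tw d by rewrite -ea tcjK.
have ua : up a d by rewrite -ea; apply: dn_up.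
have ra := rk_up hd ua; rewrite -ey in ra.
have le_a : tle a y by rewrite ey; apply: tle_up.
(* A descent of [a] distant from [d] would persist in [y], and a hexagonal orbit of [g] and [d]
   would give a descent of [y] at [g] or a second coatom. So the orbit is a chain of three
   elements. *)
have key g : g.+1 < m -> dn a g -> adj d g /\ fx (a \tw g) d.
  move=> hg ag; have ngd := dn_neq hg ag ua.
  have nyg : dn y g -> False.
    move=> dyg; have e : y \tw g = a by apply/single/cov_dn.
    by apply: (up_dnF hg _ ag); rewrite -e; apply: dn_up.
  case/orP: (far_or_adj ngd) => h.
    by case: nyg; rewrite ey; apply: far_dn.
  rewrite adj_sym; split=> //.
  have [h1|[_ _ _ h1]|[]//] := adj_dn_up hg hd h ag ua; last by case: nyg; rewrite ey.
  have e : a \tw g \tw d = a.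
    apply/single/covP.
      by apply: (lift_le hd dy); apply: tle_trans le_a; apply: tle_dn.
    by rewrite (rk_up hd h1) ra (rk_dn hg ag).
  by case: (up_dnF hd ua); rewrite -e; apply: up_dn.
have /ex_dn[g hg ag] : a != te n by apply: contraTneq rk3 => e; rewrite ra e rk_te.
have [adg] := key g hg ag; set c := a \tw g => fc.
have ec : a = c \tw g by rewrite /c tcjK.
have uc : up c g := dn_up hg ag.
have rc : rk a = (rk c).+1 by apply: rk_dn.
have /ex_dn[k hk ck] : c != te n by apply: contraTneq rk3 => e; rewrite ra rc e rk_te.
have nkg := dn_neq hk ck uc.
have nkd : k != d by apply: contraTneq ck => ->; apply: fx_ndn.
have nak : dn a k -> adj d k /\ fx (c \tw g \tw k) d.
  by move=> h; rewrite -ec; apply: key.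
case/orP: (far_or_adj nkd) => hkd.
  have fkd : fx (c \tw k) d by apply: far_fx => //; rewrite far_sym.
  have ndk : ~ dn a k.
    by case/nak => h _; apply: adj_farF h _; rewrite far_sym.
  case/orP: (far_or_adj nkg) => hkg; first by case: ndk; rewrite ec; apply: far_dn.
  have [h1|[_ _ _ h1]|[h1 _]] := adj_dn_up hk hg hkg ck uc.
  - have [h2 _] := adj_fx_up hg hd (etrans (adj_sym _ _) adg) fkd h1.
    have e : c \tw k \tw g \tw d = a.
      apply/single/covP.
        apply: (lift_le hd dy); apply: tle_trans le_a.
        apply: (lift_le hg ag); apply: tle_trans (tle_dn hk ck) _.
        by rewrite ec; apply: tle_up.
      by rewrite (rk_up hd h2) (rk_up hg h1) -(rk_dn hk ck) -rc.
    by case: (up_dnF hd ua); rewrite -e; apply: up_dn.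
  - by case: ndk; rewrite ec.
  - by have := adj_fx_fx hd hg adg h1; rewrite fkd.
have dak : dn a k.
  by rewrite ec; apply: far_dn => //; apply: (@adj_adj_far d); rewrite // adj_sym.
have [_ h] := nak dak; rewrite adj_sym in hkd.
by apply: (adj_fx_cross hd hg hk _ adg hkd fc ck h); rewrite eq_sym.
Qed.

(** Walk down from [b] by [d], [r], [s]. The hypothesis on coatoms, applied to [y], [b' \tw d] and
    [b'' \tw r \tw d], forces descents at [r], [s] and [s]; the last one contradicts the hexagon of
    [r] and [s] over [b'']. *)
Lemma low_coatom_aux b r s d :
    r.+1 < m -> s.+1 < m -> d.+1 < m -> adj r s -> adj d r -> far d s ->
    up b r -> up b s -> dn b d ->
    (forall y, cov y b -> dn y r \/ dn y s) -> False.
Proof.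
move=> hr hs hd ars adr fds ubr ubs dbd low.
have fsd : far s d by rewrite far_sym.
have ard : adj r d by rewrite adj_sym.
have asr : adj s r by rewrite adj_sym.
have nds := far_neq fds.
have := low _ (cov_dn hd dbd); set y := b \tw d => lowy.
have uys : up y s by apply: far_up.
have dyr : dn y r by case: lowy => // /(up_dnF hs uys).
have eb : b = y \tw d by rewrite /y tcjK.
have [h|[_ ub'd ub'r _]|[h _]] := adj_dn_up hd hr adr dbd ubr.
- exact: up_dnF h dyr.
- move: ub'd ub'r; rewrite -/y; set b' := y \tw r => ub'd ub'r.
  have ey : y = b' \tw r by rewrite /b' tcjK.
  have rb : rk b = (rk b').+2 by rewrite (rk_dn hd dbd) -/y (rk_dn hr dyr).
  have le_b'y : tle b' y by apply: tle_dn.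
  have le_yb : tle y b by apply: tle_dn.
  have cy2 : cov (b' \tw d) b.
    apply: covP; last by rewrite (rk_up hd ub'd).
    exact: lift_le (tle_trans le_b'y le_yb).
  have [uy2r _] := adj_up_up hd hr adr ub'd ub'r.
  have dy2s : dn (b' \tw d) s by case: (low _ cy2) => // /(up_dnF hr uy2r).
  have [|e] := far_dn_dn hs hd fsd (up_dn hd ub'd) dy2s; last first.
    rewrite tcjK // in e; have e' := tcj_eq hs e.
    exact: up_fxF ub'r (adj_common hr hd hs nds ard ars ub'd e').
  rewrite tcjK // => db's; set b'' := b' \tw s.
  have ub''s : up b'' s := dn_up hs db's.
  have eb' : b' = b'' \tw s by rewrite /b'' tcjK.
  have ub''r : up b'' r.
    have [[h _]|[[_ [//]]|[_ [_ h]]]] := states b'' hr.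
      have [h'|[_ _ _ h']|[h' _]] := adj_dn_up hs hr asr db's ub'r.
      - by case: (up_dnF hr h').
      - by case: (up_dnF hs uys); rewrite ey.
      - by case: (dn_fxF hr h).
    have [_ h'] := adj_fx_up hs hr asr h ub''s.
    by case: (up_fxF hs uys); rewrite ey eb'.
  have ub''d : up b'' d.
    have [[h _]|[[_ [//]]|[_ [_ h]]]] := states b'' hd.
      by case: (up_dnF hd ub'd); rewrite eb'; apply: far_dn.
    by case: (up_fxF hd ub'd); rewrite eb'; apply: far_fx.
  have [uy3d uy3r] := adj_up_up hr hd ard ub''r ub''d.
  have cy3 : cov (b'' \tw r \tw d) b.
    apply: covP; last first.
      by rewrite (rk_up hd uy3d) (rk_up hr ub''r) rb (rk_dn hs db's).
    apply: (lift_le hd dbd); apply: tle_trans le_yb; apply: (lift_le hr dyr).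
    exact: tle_trans (tle_dn hs db's) le_b'y.
  have dy3s : dn (b'' \tw r \tw d) s by case: (low _ cy3) => // /(up_dnF hr uy3r).
  have [|e] := far_dn_dn hs hd fsd (up_dn hd uy3d) dy3s; last first.
    rewrite tcjK // in e; have e' := tcj_eq hs e.
    apply: (@dn_fxF (b'' \tw r) r) => //; first exact: up_dn.
    exact: adj_common ard ars uy3d e'.
  rewrite tcjK // => h; have [h' _] := adj_up_up hr hs ars ub''r ub''s.
  exact: up_dnF h' h.
- exact: dn_fxF dyr h.
Qed.

(** The coatom [y] is the bottom of its own orbit under [r] and [s], which is then compared with the
    hexagon over [b]. *)
Lemma low_coatom b r s : r.+1 < m -> s.+1 < m -> adj r s ->
  up b r -> up b s -> b != te n ->
  exists y, [/\ cov y b, ~~ dn y r & ~~ dn y s].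
Proof.
move=> hr hs ars ubr ubs /ex_dn[d hd dbd].
have [/existsP[y /and3P[h1 h2 h3]]|none] :=
  boolP [exists y, [&& cov y b, ~~ dn y r & ~~ dn y s]]; first by exists y.
have low y : cov y b -> dn y r \/ dn y s.
  move=> cy; move: none; rewrite negb_exists => /forallP/(_ y).
  by rewrite cy /= -negb_or negbK => /orP.
exfalso; have ndr := dn_neq hd dbd ubr; have nds := dn_neq hd dbd ubs.
case/orP: (far_or_adj ndr) => hdr; case/orP: (far_or_adj nds) => hds.
- case: (low _ (cov_dn hd dbd)); apply: up_dnF => //; apply: far_up => //;
    by rewrite far_sym.
- apply: (@low_coatom_aux b s r d) => //; first by rewrite adj_sym.
  by move=> y /low; tauto.
- exact: (@low_coatom_aux b r s d).
- by case: (adj_triangleF ars hdr hds).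
Qed.

Definition same_coatoms u v := forall z, cov z u <-> cov z v.

Lemma same_coatoms_sym u v : same_coatoms u v -> same_coatoms v u.
Proof. by move=> h z; have := h z; tauto. Qed.

Section Twins.

Variables u v : tid n.
Hypothesis same : same_coatoms u v.
Hypothesis neq_uv : u <> v.
Hypothesis rk3 : 2 < rk u.

Lemma twin_rk : rk u = rk v.
Proof.
have /ex_dn[d hd du] : u != te n by apply: contraTneq rk3 => ->; rewrite rk_te.
have cu := cov_dn hd du; have /same cv := cu.
by rewrite (cov_rk cu) (cov_rk cv).
Qed.

Lemma twin_dn k : k.+1 < m -> dn u k -> dn v k -> False.
Proof.
move=> hk du dv; have /same cv := cov_dn hk du.
have [e|h] := cov_lift hk cv dv; last exact: up_dnF (dn_up hk du) h.
by apply: neq_uv; rewrite -(tcjK u hk) e tcjK.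
Qed.

End Twins.

(** The twins turn out to be the two elements of height two in the hexagon of [r] and [s] over some
    [b]. With [y] from [low_coatom], the orbit of [y] contains a coatom of one twin that is not a
    coatom of the other. *)
Lemma twins_hexagon u v s r : same_coatoms u v -> u <> v -> 2 < rk u ->
  s.+1 < m -> r.+1 < m -> dn u s -> dn v r -> dn (u \tw s) r -> dn (v \tw r) s ->
  False.
Proof.
move=> same neq rk3 hs hr dus dvr dusr dvrs.
have same' := same_coatoms_sym same.
have to_u z : cov z v -> cov z u by move/same.
have to_v z : cov z u -> cov z v by move/same.
have rkE := twin_rk same rk3; have rk3' : 2 < rk v by rewrite -rkE.
have ndur : ~ dn u r by move=> h; apply: (twin_dn same neq hr).
have ndvs : ~ dn v s by move=> h; apply: (twin_dn same neq hs).
have nsr : r != s by apply: (dn_neq hr dusr); apply: dn_up.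
have ars : adj r s.
  case/orP: (far_or_adj nsr) => // frs; case: ndur.
  by rewrite -(tcjK u hs); apply: far_dn => //; apply: dn_up.
have asr : adj s r by rewrite adj_sym.
have cus := cov_dn hs dus; have cvr := cov_dn hr dvr.
have uvs : up v s.
  have [[/ndvs//]|[[_ [//]]|[_ [_ h]]]] := states v hs.
  case: neq; apply: rk_eq; last by rewrite rkE.
  by rewrite -(tcjK u hs); apply: lift_fx => //; apply: cov_le; apply/same.
have [h|[_ ubr ubs _]|[h _]] := adj_dn_up hr hs ars dvr uvs.
- exact: up_dnF h dvrs.
- set b := v \tw r \tw s in ubr ubs.
  have ebs : v \tw r = b \tw s by rewrite /b tcjK.
  have ev : v = b \tw s \tw r by rewrite -ebs tcjK.
  have rb : rk v = (rk b).+2 by rewrite (rk_dn hr dvr) (rk_dn hs dvrs).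
  have [ubrs _] := adj_up_up hr hs ars ubr ubs.
  have cbr : cov (b \tw r) v.
    apply: covP; last by rewrite (rk_up hr ubr).
    apply: (lift_le hr dvr); apply: tle_trans (tle_dn hr dvr).
    exact: tle_dn.
  have ebr : u \tw s = b \tw r.
    by have [|/(up_dnF hs ubrs)] := cov_lift hs (to_u _ cbr) dus.
  have eu : u = b \tw r \tw s by rewrite -ebr tcjK.
  have nb : b != te n by apply: contraTneq rk3' => e; rewrite rb e rk_te.
  have [y [cy nyr nys]] := low_coatom hr hs ars ubr ubs nb.
  have le_y := cov_le cy; have ry := cov_rk cy.
  have le_ysr : tle (y \tw s \tw r) v.
    apply: (lift_le hr dvr); apply: tle_trans (tle_dn hr dvr).
    by rewrite ebs; apply: (lift_le hs (up_dn hs ubs)); apply: tle_trans (tle_up hs ubs).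
  have le_yrs : tle (y \tw r \tw s) u.
    apply: (lift_le hs dus); apply: tle_trans (tle_dn hs dus).
    by rewrite ebr; apply: (lift_le hr (up_dn hr ubr)); apply: tle_trans (tle_up hr ubr).
  have nes : y \tw s = b -> up y s -> False.
    by move=> e h; apply: (up_dnF hs ubs); rewrite -e; apply: up_dn.
  have ner : y \tw r = b -> up y r -> False.
    by move=> e h; apply: (up_dnF hr ubr); rewrite -e; apply: up_dn.
  have [[h _]|[[_ [uyr _]]|[_ [_ fyr]]]] := states y hr; first by rewrite h in nyr.
    have [[h _]|[[_ [uys _]]|[_ [_ fys]]]] := states y hs; first by rewrite h in nys.
      have [h1 h2] := adj_up_up hs hr asr uys uyr.
      have cw : cov (y \tw s \tw r) v.
        by apply: covP; rewrite // (rk_up hr h1) (rk_up hs uys) rb ry.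
      have [e|/(up_dnF hs h2)//] := cov_lift hs (to_u _ cw) dus.
      rewrite ebr in e; apply: (nes _ uys).
      by rewrite -(tcjK (y \tw s) hr) e tcjK.
    have [h1 h2] := adj_fx_up hr hs ars fys uyr.
    have cw : cov (y \tw r \tw s) u.
      by apply: covP; rewrite // (rk_up hs h1) (rk_up hr uyr) rkE rb ry.
    have [e|/(dn_fxF hr)/(_ h2)//] := cov_lift hr (to_v _ cw) dvr.
    rewrite ebs in e; apply: (ner _ uyr).
    by rewrite -(tcjK (y \tw r) hs) e tcjK.
  have [[h _]|[[_ [uys _]]|[_ [_ fys]]]] := states y hs; first by rewrite h in nys.
    have [h1 h2] := adj_fx_up hs hr asr fyr uys.
    have cw : cov (y \tw s \tw r) v.
      by apply: covP; rewrite // (rk_up hr h1) (rk_up hs uys) rb ry.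
    have [e|/(dn_fxF hs)/(_ h2)//] := cov_lift hs (to_u _ cw) dus.
    rewrite ebr in e; apply: (nes _ uys).
    by rewrite -(tcjK (y \tw s) hr) e tcjK.
  by have := adj_fx_fx hs hr asr fyr; rewrite fys.
- exact: dn_fxF dvrs h.
Qed.

(** Unless [twins_hexagon] applies, distinct twins are [z \tw s] and [z \tw r] for a common coatom
    [z]. A coatom [y] of [z] that descends neither at [s] nor at [r] then yields [y \tw s] or
    [y \tw r] as a coatom of one twin only, or [s] and [r] both fix [y], which is impossible. *)
Lemma same_coatoms_eq u v : same_coatoms u v -> 2 < rk u -> u = v.
Proof.
move=> same rk3; apply/eqP/contraT => /eqP neq; exfalso.
have same' := same_coatoms_sym same; have neq' : v <> u by auto.
have to_u z : cov z v -> cov z u by move/same.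
have to_v z : cov z u -> cov z v by move/same.
have rkE := twin_rk same rk3; have rk3' : 2 < rk v by rewrite -rkE.
have nodn := twin_dn same neq.
have /ex_dn[s hs dus] : u != te n by apply: contraTneq rk3 => ->; rewrite rk_te.
have /ex_dn[r hr dvr] : v != te n by apply: contraTneq rk3' => ->; rewrite rk_te.
have hex k l (hk : k.+1 < m) (hl : l.+1 < m) := @twins_hexagon u v k l same neq rk3 hk hl.
have cus := cov_dn hs dus; have cvr := cov_dn hr dvr.
have [ez|dusr] := cov_lift hr (to_v _ cus) dvr; last first.
  have [e|] := cov_lift hs (to_u _ cvr) dus; last exact: (hex s r hs hr).
  by rewrite -e in dusr; apply: up_dnF (dn_up hr dvr) dusr.
set z := u \tw s in ez cus.
have uzs : up z s := dn_up hs dus.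
have uzr : up z r by rewrite ez; apply: dn_up.
have eu : u = z \tw s by rewrite /z tcjK.
have ev : v = z \tw r by rewrite ez tcjK.
have rz : rk u = (rk z).+1 := cov_rk cus.
have nsr : s != r by apply: contra_notN neq => /eqP e; rewrite eu ev e.
have nrs : r != s by rewrite eq_sym.
have nz : z != te n by apply: contraTneq rk3 => e; rewrite rz e rk_te.
(* Coatoms of u and v that come from coatoms of z. *)
have lows y : cov y z -> up y s -> dn (y \tw s) r.
  move=> cy uys; have cw : cov (y \tw s) u.
    apply: covP; last by rewrite (rk_up hs uys) rz (cov_rk cy).
    apply: (lift_le hs dus); apply: tle_trans (cov_le cy) (cov_le cus).
  have [e|//] := cov_lift hr (to_v _ cw) dvr.
  by rewrite -ez in e; case: (up_dnF hs uzs); rewrite -e; apply: up_dn.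
have lowr y : cov y z -> up y r -> dn (y \tw r) s.
  move=> cy uyr; have cw : cov (y \tw r) v.
    apply: covP; last by rewrite (rk_up hr uyr) -rkE rz (cov_rk cy).
    apply: (lift_le hr dvr); apply: tle_trans (cov_le cy) _.
    by rewrite ez; apply: cov_le.
  have [e|//] := cov_lift hs (to_u _ cw) dus.
  by rewrite -/z in e; case: (up_dnF hr uzr); rewrite -e; apply: up_dn.
case/orP: (far_or_adj nsr) => hsr; last first.
  have hrs : adj r s by rewrite adj_sym.
  have [y [cy nyr nys]] := low_coatom hr hs hrs uzr uzs nz.
  have [[h _]|[[_ [uyr _]]|[_ [_ fyr]]]] := states y hr; first by rewrite h in nyr.
    have [[h _]|[[_ [uys _]]|[_ [_ fys]]]] := states y hs; first by rewrite h in nys.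
      have [h _] := adj_up_up hs hr hsr uys uyr.
      exact: up_dnF h (lows _ cy uys).
    have [h _] := adj_fx_up hr hs hrs fys uyr.
    exact: up_dnF h (lowr _ cy uyr).
  have [[h _]|[[_ [uys _]]|[_ [_ fys]]]] := states y hs; first by rewrite h in nys.
    have [h _] := adj_fx_up hs hr hsr fyr uys.
    exact: up_dnF h (lows _ cy uys).
  by have := adj_fx_fx hs hr hsr fyr; rewrite fys.
have frs : far r s by rewrite far_sym.
have [d hd dzd] := ex_dn nz.
have nds := dn_neq hd dzd uzs; have ndr := dn_neq hd dzd uzr.
(* A descent of u or v inherited from z leads to the hexagonal case. *)
have ndud : dn u d -> False.
  move=> dud; have [e|h] := cov_lift hr (to_v _ (cov_dn hd dud)) dvr.
    by rewrite -ez in e; case: (up_dnF hd _ dzd); rewrite -e; apply: dn_up.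
  by apply: (hex d r hd hr); rewrite // -ez.
have ndvd : dn v d -> False.
  move=> dvd; have [e|h] := cov_lift hs (to_u _ (cov_dn hd dvd)) dus.
    by rewrite -/z in e; case: (up_dnF hd _ dzd); rewrite -e; apply: dn_up.
  by apply: (hex s d hs hd).
have [fds|ads] := orP (far_or_adj nds).
  by case: ndud; rewrite eu; apply: far_dn.
have [fdr|adr] := orP (far_or_adj ndr).
  by case: ndvd; rewrite ev; apply: far_dn.
have dsd : adj d s by []; have cy := cov_dn hd dzd; set y := z \tw d in cy.
have uyd : up y d := dn_up hd dzd.
have sy : up y s \/ fx y s.
  have [h|[_ _ _ h]|[h _]] := adj_dn_up hd hs ads dzd uzs; [by left| |by right].
  by case: ndud; rewrite eu.
have ry : up y r \/ fx y r.
  have [h|[_ _ _ h]|[h _]] := adj_dn_up hd hr adr dzd uzr; [by left| |by right].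
  by case: ndvd; rewrite ev.
case: sy => sy; case: ry => ry.
- have := lows _ cy sy => h; have [h'|e] := far_up_up hr hs frs sy ry.
    exact: up_dnF h' h.
  exact: up_fxF uyd (adj_common hd hr hs nrs adr ads ry e).
- by apply: (dn_fxF hr (lows _ cy sy)); apply: far_fx.
- by apply: (dn_fxF hs (lowr _ cy ry)); apply: far_fx.
- by apply: (up_dnF hd uyd); apply: (adj_fx_fx_dn hd hr hs).
Qed.

End Coatoms.

(* [lia] restricted to the hypotheses that are equations or inequalities      *)
(* between natural numbers.                                                   *)
Ltac rk_lia := intros; repeat match goal with H : ?T |- _ =>
  lazymatch type of T with Prop => lazymatch T with
    | @eq nat _ _ => fail
    | is_true (leq _ _) => fail
    | _ => clear H
  end end end; lia.

(** * Special partial matchings *)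

Section Matchings.

Variable n : nat.
Notation m := (2 * n)%N.
Implicit Types (x y z u v w a b c q : tid n) (k l g d r s t : nat).

Lemma graded_up x y : tle x y -> x <> y -> exists z, cov x z /\ tle z y.
Proof.
have [N] := ubnP (rk y); elim: N y => // N IHN y ltN h ne.
have [z [h1 h2]] := graded h ne.
have [e|/eqP ne'] := eqVneq x z; first by exists y; rewrite e; split=> //; apply: tle_refl.
have [|z' [h3 h4]] := IHN z _ h1 ne'; first by rewrite (cov_rk h2) in ltN; rk_lia.
by exists z'; split=> //; apply: tle_trans h4 (cov_le h2).
Qed.

(** Special partial matchings of the interval below [w], on [tid]; strictness is recorded as an
    inequality of ranks. *)
Record spm w (M : tid n -> tid n) : Prop := Spm {
  spm_le : forall x, tle x w -> tle (M x) w;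
  spmK : forall x, tle x w -> M (M x) = x;
  spm_top : cov (M w) w;
  spm_cov : forall x, tle x w -> [\/ cov (M x) x, M x = x | cov x (M x)];
  spm_mono : forall x y, tle y w -> cov x y -> M x <> y ->
    tle (M x) (M y) /\ rk (M x) < rk (M y) }.

(** Climb a saturated chain from [z] to [x]: with [z1] the next element, [M z] is [z1] or lies below
    [M z1]. *)
Lemma spm_closed w M x z : spm w M -> tle x w -> cov (M x) x -> tle z x ->
  tle (M z) x.
Proof.
move=> S hx cx; have [N] := ubnP (rk x - rk z); elim: N z => // N IHN z ltN hz.
have [->|/eqP ne] := eqVneq z x; first exact: cov_le.
have [z1 [c1 h1]] := graded_up hz ne.
have [->//|/eqP ne1] := eqVneq (M z) z1.
have [h2 _] := spm_mono S (tle_trans h1 hx) c1 ne1; apply: tle_trans h2 _.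
by apply: IHN => //; have := cov_rk c1; have := rk_lt hz ne; rk_lia.
Qed.

Lemma spm_sub w M x : spm w M -> tle x w -> cov (M x) x -> spm x M.
Proof.
move=> S hx cx; have tr z : tle z x -> tle z w by move=> h; apply: tle_trans hx.
split=> //.
- by move=> z; apply: spm_closed hx cx.
- by move=> z /tr; apply: (spmK S).
- by move=> z /tr; apply: (spm_cov S).
- by move=> z y /tr; apply: (spm_mono S).
Qed.

Section OneMatching.

Variables (w : tid n) (M : tid n -> tid n).
Hypothesis S : spm w M.

(** Monotonicity along the cover of [q] by [M x] puts [M q] strictly below [x], and the ranks leave
    no other possibility. *)
Lemma spm_coatom x q : tle x w -> cov x (M x) -> cov q (M x) -> q <> x ->
  cov (M q) q /\ cov (M q) x.
Proof.
move=> hx cx cq ne; have hMx := spm_le S hx.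
have hq := tle_trans (cov_le cq) hMx.
have neM : M q <> M x by move/(congr1 M); rewrite !(spmK S).
have [h1 h2] := spm_mono S hMx cq neM; rewrite (spmK S hx) in h1 h2.
have e1 := cov_rk cx; have e2 := cov_rk cq.
have cMq : cov (M q) q.
  by case: (spm_cov S hq) => // [e|/cov_rk e]; [rewrite e in h2|]; rk_lia.
by split=> //; apply: covP => //; have := cov_rk cMq; rk_lia.
Qed.

Lemma spm_up_next a c : tle c w -> cov a c -> cov a (M a) -> M a <> c ->
  cov c (M c) /\ cov (M a) (M c).
Proof.
move=> hc ca cMa ne; have [le lt] := spm_mono S hc ca ne.
have r1 := cov_rk ca; have r2 := cov_rk cMa.
have cc : cov c (M c).
  by case: (spm_cov S hc) => // [/cov_rk h|e]; [|rewrite e in lt]; rk_lia.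
by split=> //; apply: covP => //; have := cov_rk cc; rk_lia.
Qed.

Lemma tcj_coatom v q k : k.+1 < m -> dn v k -> cov q v -> dn q k ->
  cov (q \tw k) (v \tw k).
Proof.
move=> hk dv cq dq; apply: covP; first by apply: lift_both (cov_le cq).
by have := rk_dn hk dv; have := rk_dn hk dq; have := cov_rk cq; rk_lia.
Qed.

Section OneLetter.

Variables (r : nat).
Hypothesis hr : r.+1 < m.

(** With [keeps_fx], the two obstacles to commutation of [M] with [r] when [M] moves up: a descent
    at [r] gets lost, or a letter that acts trivially becomes an ascent. *)
Definition keeps_dn x := dn x r -> cov x (M x) -> dn (M x) r.
Definition keeps_fx x := fx x r -> cov x (M x) -> ~ up (M x) r.

(** The element [t = M c \tw r] is a coatom of [M c] other than [c], so [M t] is a coatom of [c]. If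
    it is not [c \tw r], it descends at [r], and by the hypothesis on smaller elements so does [t],
    which is absurd. *)
Lemma spm_square c : tle c w -> dn c r -> cov c (M c) -> dn (M c) r ->
  (forall x, tle x w -> rk x < rk c -> keeps_dn x) ->
  M (c \tw r) = M c \tw r /\ cov (c \tw r) (M c \tw r).
Proof.
move=> hc dc cc dMc IH; have hMc := spm_le S hc; set t := M c \tw r.
have ct : cov t (M c) := cov_dn hr dMc.
have ut : up t r := dn_up hr dMc.
have ht := tle_trans (cov_le ct) hMc.
have ntc : t <> c by move=> e; rewrite e in ut; apply: up_dnF ut dc.
have [c1 c2] := spm_coatom hc cc ct ntc.
have hMt := spm_le S ht.
have [e|dMt] := cov_lift hr c2 dc; first by rewrite -e (spmK S).
have rkt : rk (M t) < rk c by rewrite (cov_rk c2).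
have := IH _ hMt rkt; rewrite /keeps_dn (spmK S ht) => /(_ dMt c1).
by move/(up_dnF hr ut).
Qed.

(** If [M x] had an ascent at [r], then [M x] would be the only coatom of [M x \tw r], and
    [single_coatom] leaves only [x = te]. *)
Lemma keeps_fx_step x : tle x w -> (fx (te n) r -> keeps_fx (te n)) ->
  (forall z, tle z w -> rk z < rk x -> keeps_dn z /\ keeps_fx z) -> keeps_fx x.
Proof.
move=> hx E IH fr cx uMx; set c1 := M x in cx uMx; set c2 := c1 \tw r.
have dc2 : dn c2 r := up_dn hr uMx.
have rc2 : rk c2 = (rk x).+2 by rewrite (rk_up hr uMx) (cov_rk cx).
suff single z : cov z c2 -> z = c1.
  have := single_coatom single; rewrite rc2 => r0.
  have x0 : x = te n by apply: rk0; rk_lia.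
  by move: fr cx uMx (E); rewrite /c1 x0 => fr cx uMx h; apply: h uMx.
move=> cz; have [->|dz] := cov_lift hr cz dc2; first by rewrite tcjK.
have := tcj_coatom hr dc2 cz dz; rewrite tcjK //; set q := z \tw r => cq.
have uq : up q r := dn_up hr dz.
have nqx : q <> x by move=> e; rewrite e in uq; apply: up_fxF uq fr.
have [h1 h2] := spm_coatom hx cx cq nqx.
have hq : tle q w by apply: tle_trans (cov_le cq) (spm_le S hx).
have [IH1 IH2] := IH _ (spm_le S hq) (eq_leq (esym (cov_rk h2))).
rewrite /keeps_dn /keeps_fx (spmK S hq) in IH1 IH2.
have [[h _]|[[_ [h _]]|[_ [_ h]]]] := states (M q) hr.
- by case: (up_dnF hr uq); apply: IH1.
- have le := lift_fx hr fr (cov_le h2).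
  have e : M q \tw r = x by apply: rk_eq le _; rewrite (rk_up hr h) (cov_rk h2).
  by case: (@dn_fxF n x r) => //; rewrite -e; apply: up_dn.
- by case: (IH2 h h1 uq).
Qed.

(** Suppose [y = M x] does not descend at [r], and put [z = x \tw r]. If [M z] is not above [z],
    then [x] is the only coatom of [y]. Otherwise [M z \tw r], which descends at [r], has the same
    coatoms as [y]. Either way [y] has rank at most 2, so [x] is the atom [te \tw r], treated by
    hypothesis. *)
Lemma keeps_dn_step x : tle x w ->
  (tle (te n \tw r) w -> up (te n) r -> keeps_dn (te n \tw r)) ->
  (forall z, tle z w -> rk z < rk x -> keeps_dn z /\ keeps_fx z) -> keeps_dn x.
Proof.
move=> hx E IH dx cx; set y := M x in cx *; set z := x \tw r.
have uz : up z r := dn_up hr dx.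
have cz : cov z x := cov_dn hr dx.
have ex : x = z \tw r by rewrite /z tcjK.
have hz := tle_trans (cov_le cz) hx.
have rz := cov_rk cz; have ry := cov_rk cx.
have hy : tle y w := spm_le S hx.
have My : M y = x by apply: (spmK S hx).
have IHd c : tle c w -> rk c < rk x -> keeps_dn c by move=> h1 /(IH _ h1)[].
have small : rk y <= 2 -> dn y r.
  move=> le2; have z0 : z = te n by apply: rk0; rk_lia.
  by have := E; rewrite -z0 -ex => /(_ hx uz); apply.
apply/idPn => ndy.
have low q : cov q y -> q <> x -> M q <> z ->
    [/\ dn q r, M (M q \tw r) = q \tw r, cov (M q \tw r) (q \tw r)
      & cov (M q \tw r) z].
  move=> cq nqx nqz; have [h1 h2] := spm_coatom hx cx cq nqx.
  have hq := tle_trans (cov_le cq) hy.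
  have hc := spm_le S hq; have eM := spmK S hq.
  have [//|dc] := cov_lift hr h2 dx.
  have rc : rk (M q) < rk x by rewrite (cov_rk h2).
  have dq : dn q r by have := IHd _ hc rc; rewrite /keeps_dn eM; apply.
  have sq := spm_square hc dc; rewrite eM in sq.
  have [e1 e2] := sq h1 dq (fun c' h' lt => IHd c' h' (ltn_trans lt rc)).
  by split=> //; apply: tcj_coatom.
have nMzx : M z <> x by move/(congr1 M); rewrite (spmK S hz) -/y => e; rewrite -e in ry; rk_lia.
have [le_Mz lt_Mz] := spm_mono S hx cz nMzx; rewrite -/y in le_Mz lt_Mz.
have lowz q : cov q y -> q <> x -> M q <> z -> tle (q \tw r) (M z) /\ rk (q \tw r) < rk (M z).
  move=> cq nqx nqz; have [h1 h2 h3 h4] := low _ cq nqx nqz.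
  rewrite -h2; apply: (spm_mono S hz h4); rewrite h2 => e.
  by apply: nqx; rewrite -(tcjK q hr) e -ex.
have notup : ~ cov z (M z) -> False.
  move=> nup; suff /single_coatom/small : forall q, cov q y -> q = x by rewrite (negPf ndy).
  move=> q cq; apply/eqP/contraT => /eqP nqx; exfalso.
  have nqz : M q <> z.
    have [h1 h2] := spm_coatom hx cx cq nqx.
    by move=> e; apply: nup; rewrite -e (spmK S) //; apply: tle_trans (cov_le cq) hy.
  have [_ h2 h3 h4] := low _ cq nqx nqz; have [_ h5] := lowz _ cq nqx nqz.
  move: (cov_rk h3) (cov_rk h4).
  case: (spm_cov S hz) => [/cov_rk h6|e|/nup//]; [|rewrite e in h5];
    by [rk_lia | rk_lia].
have cu1 : cov z (M z)
  by case: (spm_cov S hz) => // h; case: notup => /cov_rk;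
    [have := cov_rk h; rk_lia | rewrite h; rk_lia].
set u1 := M z in le_Mz lt_Mz lowz cu1 *; have ru1 := cov_rk cu1.
have cu1y : cov u1 y by apply: covP => //; rk_lia.
have nu1x : u1 <> x by [].
have uu1 : up u1 r.
  have [[h _]|[[_ [//]]|[_ [_ h]]]] := states u1 hr; case: nu1x.
    have e : z = u1 \tw r.
      apply: rk_eq; first by apply: lift_ge (cov_le cu1) => //; apply: up_ndn.
      by have := rk_dn hr h; rk_lia.
    by rewrite ex e tcjK.
  apply/esym/rk_eq; last by rk_lia.
  by rewrite ex; apply: lift_fx (cov_le cu1).
set u := u1 \tw r; have du : dn u r := up_dn hr uu1.
have ru : rk u = rk y by rewrite (rk_up hr uu1); rk_lia.
have le_u1u : tle u1 u := tle_up hr uu1.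
have cxu : cov x u.
  apply: covP; last by rk_lia.
  by rewrite ex; apply: (lift_le hr du); apply: tle_trans (cov_le cu1) _.
have cu1u : cov u1 u by apply: cov_up.
have [le2|gt2] := leqP (rk y) 2; first by move: ndy; rewrite small.
suff /same_coatoms_eq e : same_coatoms u y.
  by move: ndy; rewrite -e ?du // ru.
move=> q; split=> cq; last first.
  have [->//|/eqP nqx] := eqVneq q x.
  have [e|/eqP nqz] := eqVneq (M q) z.
    by rewrite /u1 -e (spmK S) // in cu1u; apply: tle_trans (cov_le cq) hy.
  have [h1 h2 h3 h4] := low _ cq nqx nqz; have [h5 h6] := lowz _ cq nqx nqz.
  apply: covP; last by rewrite ru; apply: cov_rk.
  rewrite -(tcjK q hr); apply: (lift_le hr du); exact: tle_trans le_u1u.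
have [->//|/eqP nqx] := eqVneq q x.
have [->|dq] := cov_lift hr cq du; first by rewrite tcjK.
have := tcj_coatom hr du cq dq; rewrite tcjK //; set q' := q \tw r => cq'.
have uq' : up q' r := dn_up hr dq.
have eq' : q = q' \tw r by rewrite /q' tcjK.
have nq'z : q' <> z by move=> e; apply: nqx; rewrite eq' e -ex.
have [h1 h2] := spm_coatom hz cu1 cq' nq'z.
have hu1 : tle u1 w := spm_le S hz.
have hq' := tle_trans (cov_le cq') hu1.
set c' := M q' in h1 h2; have hc' : tle c' w := spm_le S hq'.
have Mc' : M c' = q' := spmK S hq'.
have rc' := cov_rk h2; have rq' := cov_rk h1.
have [IH1 IH2] : keeps_dn c' /\ keeps_fx c' by apply: IH => //; rk_lia.
rewrite /keeps_dn /keeps_fx Mc' in IH1 IH2.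
have [[h _]|[[_ [uc' _]]|[_ [_ h]]]] := states c' hr.
- by case: (up_dnF hr uq'); apply: IH1.
- have dc'' := up_dn hr uc'; have rc'' := rk_up hr uc'; set c'' := c' \tw r in dc'' rc''.
  have c''x : cov c'' x.
    apply: covP; last by rk_lia.
    by apply: (lift_le hr dx); apply: tle_trans (cov_le h2) (cov_le cz).
  have hc'' := tle_trans (cov_le c''x) hx.
  have [le lt] : tle q' (M c'') /\ rk q' < rk (M c'').
    rewrite -{1 2}Mc'; apply: (spm_mono S hc'' (cov_up hr uc')).
    by rewrite Mc' => e; rewrite e in uq'; apply: up_dnF uq' dc''.
  have cc'' : cov c'' (M c'').
    by case: (spm_cov S hc'') => // [/cov_rk|e]; [|rewrite e in lt]; rk_lia.
  have rMc'' := cov_rk cc''.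
  have dMc'' : dn (M c'') r by apply: (IHd c'') => //; rk_lia.
  have e : M c'' = q.
    rewrite eq' -(tcjK (M c'') hr); congr (_ \tw r); apply/esym/rk_eq.
      by apply: lift_ge => //; apply: up_ndn.
    by have := rk_dn hr dMc''; rk_lia.
  have [le' lt'] := spm_mono S hx c''x (fun h => nqx (etrans (esym e) h)).
  rewrite -/y e in le' lt'; apply: covP => //.
  by have := cov_rk cq; rk_lia.
- by case: (IH2 h h1 uq').
Qed.

Hypothesis good_dn : tle (te n \tw r) w -> up (te n) r -> keeps_dn (te n \tw r).
Hypothesis good_fx : fx (te n) r -> keeps_fx (te n).

Lemma keeps x : tle x w -> keeps_dn x /\ keeps_fx x.
Proof.
have [N] := ubnP (rk x); elim: N x => // N IHN x ltN hx.
have IH z : tle z w -> rk z < rk x -> keeps_dn z /\ keeps_fx z.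
  by move=> hz lt; apply: IHN => //; rk_lia.
by split; [apply: keeps_dn_step | apply: keeps_fx_step].
Qed.

Hypothesis dw : dn w r.

Lemma spm_comm_dn x : tle x w -> dn x r ->
  M x = x \tw r \/ M (x \tw r) = M x \tw r.
Proof.
have K1 z h : keeps_dn z := proj1 (keeps h).
have K2 z h : keeps_fx z := proj2 (keeps h).
have sq z : tle z w -> dn z r -> cov z (M z) -> M (z \tw r) = M z \tw r.
  move=> hz dz cz.
  by have [] := spm_square hz dz cz (K1 z hz dz cz) (fun y hy _ => K1 y hy).
move=> hx dx; case: (spm_cov S hx) => [cx|ex|cx]; last by right; apply: sq.
  have [->|dMx] := cov_lift hr cx dx; [by left|right].
  have hMx := spm_le S hx.
  have := sq _ hMx dMx; rewrite (spmK S hx) => /(_ cx) e.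
  by rewrite -e (spmK S) //; apply: lift_le.
(* The remaining case is [M x = x], where [M z = z] has to be shown. The alternative is that
   [c = M z] is below [z], and each possible action of [r] on [c] is excluded. *)
right; rewrite ex; have cz := cov_dn hr dx; have uz := dn_up hr dx.
set z := x \tw r in cz uz *; have hz := tle_trans (cov_le cz) hx.
have nMzx : M z <> x.
  by move/(congr1 M); rewrite (spmK S hz) ex => e; have := cov_rk cz; rewrite e; rk_lia.
have [_ lt] := spm_mono S hx cz nMzx; rewrite ex in lt.
case: (spm_cov S hz) => // [cc|/cov_rk]; last by have := cov_rk cz; rk_lia.
have hc := spm_le S hz; set c := M z in cc hc nMzx lt *; have Mc : M c = z := spmK S hz.
have := K1 _ hc; have := K2 _ hc; rewrite /keeps_dn /keeps_fx Mc => k2 k1.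
exfalso; have [[h _]|[[_ [uc _]]|[_ [_ h]]]] := states c hr.
- by apply: (up_dnF hr uz); apply: k1.
- have ccr := cov_up hr uc; have dcr := up_dn hr uc.
  have hcr : tle (c \tw r) w by apply: lift_le.
  have [le1 lt1] : tle z (M (c \tw r)) /\ rk z < rk (M (c \tw r)).
    rewrite -{1 2}Mc; apply: (spm_mono S hcr ccr); rewrite Mc => e.
    by rewrite -e in dcr; apply: up_dnF uz dcr.
  have r1 := cov_rk ccr; have r2 := cov_rk cc.
  have cM : cov (c \tw r) (M (c \tw r)).
    by case: (spm_cov S hcr) => // [/cov_rk|e]; [|rewrite e in lt1]; rk_lia.
  have dM := K1 _ hcr dcr cM.
  have e : z = M (c \tw r) \tw r.
    apply: rk_eq; first by apply: lift_ge => //; apply: up_ndn.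
    by have := rk_dn hr dM; have := cov_rk cM; rk_lia.
  have e2 : M (c \tw r) = x by rewrite -(tcjK (M _) hr) -e /z tcjK.
  have := congr1 M e2; rewrite (spmK S hcr) ex => e3.
  by have := cov_rk cz; rewrite -e3; rk_lia.
- by case: (k2 h cc uz).
Qed.

(** Ascents reduce to descents by passing to [x \tw r]; if [r] fixes [x], then [keeps] forces it to
    fix [M x]. *)
Lemma spm_comm x : tle x w -> M x = x \tw r \/ M (x \tw r) = M x \tw r.
Proof.
move=> hx; have hMx := spm_le S hx.
have [[dx _]|[[_ [ux _]]|[_ [_ fr]]]] := states x hr; first exact: spm_comm_dn.
  have [||e|] := @spm_comm_dn (x \tw r); [exact: lift_le | exact: up_dn | |].
    rewrite tcjK // in e; left; rewrite -[in LHS]e (spmK S) //.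
    exact: lift_le.
  by rewrite tcjK // => ->; right; rewrite tcjK.
right; rewrite (fx_tcj hr fr); symmetry; apply: fx_tcj => //.
case: (spm_cov S hx) => [cx|->//|cx].
  have [k1 k2] := keeps hMx; rewrite /keeps_dn /keeps_fx (spmK S hx) in k1 k2.
  have [[h _]|[[_ [h _]]|[_ [_ //]]]] := states (M x) hr.
    by case: (dn_fxF hr (k1 h cx)).
  have le := lift_fx hr fr (cov_le cx).
  have e : M x \tw r = x by apply: rk_eq le _; rewrite (rk_up hr h) (cov_rk cx).
  by case: (@dn_fxF n x r) => //; rewrite -e; apply: up_dn.
have [_ k2] := keeps hx.
have [[h _]|[[_ [h _]]|[_ [_ //]]]] := states (M x) hr; last by case: (k2 fr cx).
have e : x = M x \tw r.
  apply: rk_eq; first by apply: lift_ge (cov_le cx) => //; apply: fx_ndn.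
  by have := rk_dn hr h; have := cov_rk cx; rk_lia.
have := congr1 (fun z => z \tw r) e; rewrite tcjK // (fx_tcj hr fr) => e2.
by have := cov_rk cx; rewrite -e2; rk_lia.
Qed.

End OneLetter.

End OneMatching.

End Matchings.

(** * Matchings determined in ranks 0 and 1 *)

Section Atoms.

Variable n : nat.
Notation m := (2 * n)%N.
Notation te := (te n).
Implicit Types (x y z u v w a b c q : tid n) (k l g d r s t : nat).

Lemma te_up k : k.+1 < m -> k != n.-1 -> up te k.
Proof. by move=> hk ne; rewrite /up !F_te ?(ltnW hk) //; lia. Qed.

Lemma te_fx : 0 < n -> fx te n.-1.
Proof. by move=> hn; rewrite /fx F_te; lia. Qed.

Notation mir k := (m.-2 - k).

Lemma mir_lt k : k.+1 < m -> (mir k).+1 < m.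
Proof. by lia. Qed.

Lemma te_mir k : k.+1 < m -> te \tw k = te \tw mir k.
Proof.
move=> hk; apply: F_ext => j hj; rewrite !F_tcj ?mir_lt // !F_te ?sw_lt ?mir_lt //.
by sw_split; lia.
Qed.

Lemma te_inj k l : k.+1 < m -> l.+1 < m -> k != n.-1 -> te \tw k = te \tw l ->
  l = k \/ l = mir k.
Proof.
move=> hk hl ne /(congr1 (fun x => F x k)); rewrite !F_tcj // !F_te ?sw_lt ?(ltnW hk) //.
by sw_split; lia.
Qed.

Lemma rk_te_tcj k : k.+1 < m -> k != n.-1 -> rk (te \tw k) = 1.
Proof. by move=> hk ne; rewrite rk_up ?te_up // rk_te. Qed.

Lemma cov_te_tcj k : k.+1 < m -> k != n.-1 -> cov te (te \tw k).
Proof. by move=> hk ne; apply: cov_up; rewrite ?te_up. Qed.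

Lemma rk1_tcj x : rk x = 1 -> exists k, [/\ k.+1 < m, k < n.-1 & x = te \tw k].
Proof.
move=> r1; have /ex_dn[k hk dk] : x != te by apply: contra_eqN r1 => /eqP->; rewrite rk_te.
have e : x \tw k = te by apply: rk0; have := rk_dn hk dk; lia.
have ex := tcj_eq hk e.
have ne : k != n.-1.
  apply/negP => /eqP ek; have hn : 0 < n by lia.
  by have := te_fx hn; rewrite -ek => /(fx_tcj hk) e2; rewrite ex e2 rk_te in r1.
have [lt|ge] := ltnP k n.-1; first by exists k.
exists (mir k); rewrite -te_mir //; split=> //; lia.
Qed.

Lemma te_dn k l : k.+1 < m -> l.+1 < m -> k != n.-1 -> dn (te \tw k) l ->
  l = k \/ l = mir k.
Proof.
move=> hk hl ne d; apply: te_inj => //; apply: tcj_eq => //; apply: rk0.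
by have := rk_dn hl d; rewrite rk_te_tcj //; lia.
Qed.

Lemma rk_up_dn x k : k.+1 < m -> rk (x \tw k) = (rk x).+1 -> dn (x \tw k) k.
Proof.
move=> hk e; have [[h _]|[[_ [h _]]|[_ [_ h]]]] := states x hk.
- by have := rk_dn hk h; lia.
- exact: up_dn.
- by rewrite fx_tcj // in e; lia.
Qed.

Section Unique.

Variables (w : tid n) (M : tid n -> tid n).
Hypothesis S : spm w M.

(* An element of rank at least 3 is determined by its coatoms, and the        *)
(* coatoms of M x, where x is below M x, are x and images of elements below   *)
(* x.                                                                         *)
Lemma spm_unique t : t.+1 < m ->
  (forall x, tle x w -> rk x <= 1 -> M x = x \tw t) ->
  forall x, tle x w -> M x = x \tw t.
Proof.
move=> ht base x; have [N] := ubnP (rk x); elim: N x => // N IHN x ltN hx.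
have [le1|gt1] := leqP (rk x) 1; first exact: base.
have IH z : tle z w -> rk z < rk x -> M z = z \tw t.
  by move=> hz lt; apply: IHN => //; rk_lia.
have up_case : cov x (M x) -> forall q, cov q (M x) -> q <> x ->
    exists c, [/\ cov c x, c \tw t = q & up c t].
  move=> cx q cq ne; have [h1 h2] := spm_coatom S hx cx cq ne.
  have hq := tle_trans (cov_le cq) (spm_le S hx).
  have e : M q \tw t = q.
    by rewrite -IH ?(spmK S) //; [apply: spm_le S _ hq|rewrite (cov_rk h2)].
  exists (M q); split=> //.
  rewrite -[M q](tcjK _ ht) e; apply: dn_up => //.
  by rewrite -e; apply: rk_up_dn; rewrite // e (cov_rk h1).
have [[d _]|[[_ [uxt _]]|[_ [_ f]]]] := states x ht.
- have hz : tle (x \tw t) w by apply: tle_trans (tle_dn ht d) hx.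
  have e : M (x \tw t) = x by rewrite IH ?tcjK //; rewrite (rk_dn ht d).
  by rewrite -{1}e (spmK S).
- set v := x \tw t; have dv : dn v t := up_dn ht uxt.
  have rv : rk v = (rk x).+1 := rk_up ht uxt.
  have cxv : cov x v := cov_up ht uxt.
  have vq q : cov q v -> q <> x -> [/\ cov (q \tw t) x, M (q \tw t) = q & rk q = rk x].
    move=> cq ne; have [e|dq] := cov_lift ht cq dv.
      by rewrite /v tcjK in e.
    have := tcj_coatom ht dv cq dq; rewrite /v tcjK // => c1.
    split=> //; last by have := cov_rk cq; rk_lia.
    have hc := tle_trans (cov_le c1) hx.
    by rewrite IH ?tcjK // (cov_rk c1).
  case: (spm_cov S hx) => [cx|ex|cx].
  + have e : M x \tw t = x.
      rewrite -IH ?(spmK S) //; first exact: spm_le.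
      by rewrite [in X in _ < X](cov_rk cx).
    by rewrite /v -[in RHS]e tcjK.
  + suff /single_coatom : forall q, cov q v -> q = x by rk_lia.
    move=> q cq; apply/eqP/contraT => /eqP ne; have [c1 e1 r1] := vq q cq ne.
    have [|_] := spm_mono S hx c1; first by rewrite e1.
    by rewrite e1 ex r1 ltnn.
  + apply: same_coatoms_eq; last by rewrite (cov_rk cx).
    move=> q; split=> cq.
      have [->//|/eqP ne] := eqVneq q x; have [c [h1 h2 h3]] := up_case cx q cq ne.
      apply: covP; last by rewrite rv -h2 (rk_up ht h3) (cov_rk h1).
      rewrite -h2; apply: (lift_le ht dv); exact: tle_trans (cov_le h1) (cov_le cxv).
    have [->//|/eqP ne] := eqVneq q x; have [c1 e1 r1] := vq q cq ne.
    have [|le _] := spm_mono S hx c1; first by rewrite e1.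
    by rewrite e1 in le; apply: covP; rewrite // (cov_rk cx) r1.
- rewrite (fx_tcj ht f); case: (spm_cov S hx) => [cx|//|cx].
    have e : M x \tw t = x.
      rewrite -IH ?(spmK S) //; first exact: spm_le.
      by rewrite [in X in _ < X](cov_rk cx).
    by rewrite -[in RHS](fx_tcj ht f) -[in RHS]e tcjK.
  suff /single_coatom : forall q, cov q (M x) -> q = x by rewrite (cov_rk cx); rk_lia.
  move=> q cq; apply/eqP/contraT => /eqP ne; have [c [h1 h2 h3]] := up_case cx q cq ne.
  case: ne; apply: rk_eq; last by rewrite -h2 (rk_up ht h3) (cov_rk h1).
  by rewrite -h2; apply: lift_fx (cov_le h1).
Qed.

Lemma spm_n_gt0 : 0 < n.
Proof.
rewrite lt0n; apply/negP => /eqP n0.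
have e x : x = te by apply: no_dn => k hk; exfalso; move: hk; clear -n0; lia.
by have := cov_rk (spm_top S); rewrite (e w) (e (M te)) rk_te.
Qed.

(** Each atom is fixed by [M] or moved as by the middle letter. The two differ only at the atom
    [te \tw n.-2]; if [M] fixed it, [M] would be the identity by [single_coatom], against
    [M w <> w]. *)
Lemma spm_fix_te : M te = te -> forall x, tle x w -> M x = x \tw n.-1.
Proof.
move=> e0; have hn := spm_n_gt0; have hl : n.-1.+1 < m by rk_lia.
have atoms x : tle x w -> rk x = 1 -> M x = x \/ M x = x \tw n.-1.
  move=> hx r1; case: (spm_cov S hx) => [cx|->|cx]; [|by left|right].
    have e : M x = te by apply: rk0; have := cov_rk cx; rk_lia.
    by have := spmK S hx; rewrite e e0 => e2; rewrite -e2 rk_te in r1.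
  have single q : cov q (M x) -> q = x.
    move=> cq; apply/eqP/contraT => /eqP ne; have [h1 h2] := spm_coatom S hx cx cq ne.
    have e : M q = te by apply: rk0; have := cov_rk h2; rk_lia.
    have hq := tle_trans (cov_le cq) (spm_le S hx).
    by have := cov_rk h1; rewrite e -(spmK S hq) e e0 rk_te.
  have ru := cov_rk cx; set u := M x in cx single ru *.
  have /ex_dn[d hd du] : u != te by apply: contra_eqN ru => /eqP->; rewrite rk_te.
  have ex : u \tw d = x by apply/single/cov_dn.
  have [ed|ned] := eqVneq d n.-1; first by rewrite -ex -ed tcjK.
  have e1 : te \tw d = x.
    apply/single/covP; last by rewrite rk_te_tcj // ru r1.
    by apply: (lift_le hd du); apply: te_tle.
  case: (@up_dnF n x d) => //; first by rewrite -ex; apply: dn_up.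
  by rewrite -e1; apply: up_dn; rewrite ?te_up.
have fxlow k : k.+1 < m -> k < n.-2 -> te \tw k \tw n.-1 = te \tw k.
  move=> hk lt; apply: fx_tcj => //; apply: far_fx => //; last exact: te_fx.
  by rewrite /far; rk_lia.
apply: spm_unique => // x hx; rewrite leq_eqVlt ltnS leqn0.
case/orP => /eqP r1; last by rewrite (rk0 r1) e0 fx_tcj ?te_fx.
have [ex|//] := atoms x hx r1.
have [->//|ne] := eqVneq (x \tw n.-1) x.
exfalso; have [k [hk lt exk]] := rk1_tcj r1.
have ek : k = n.-2.
  have [lt'|] := ltnP k n.-2; last by rk_lia.
  by move: ne; rewrite exk fxlow // eqxx.
have id1 y : tle y w -> rk y <= 1 -> M y = y.
  move=> hy; rewrite leq_eqVlt ltnS leqn0 => /orP[] /eqP r; last by rewrite (rk0 r).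
  have [l [hl' ltl ey]] := rk1_tcj r.
  have [//|ey2] := atoms y hy r.
  have [lt'|ge] := ltnP l n.-2; first by rewrite ey2 ey fxlow.
  have el : l = k by rk_lia.
  have exy : x = y by rewrite exk ey el.
  by rewrite -exy.
suff idM y : tle y w -> M y = y.
  by have := cov_rk (spm_top S); rewrite idM ?tle_refl //; rk_lia.
have [N] := ubnP (rk y); elim: N y => // N IHN y ltN hy.
have [le1|gt1] := leqP (rk y) 1; first exact: id1.
case: (spm_cov S hy) => [cy|//|cy].
  have : M (M y) = M y by apply: IHN; [have := cov_rk cy; rk_lia|apply: spm_le S _ hy].
  by rewrite (spmK S).
suff /single_coatom : forall q, cov q (M y) -> q = y by rewrite (cov_rk cy); rk_lia.
move=> q cq; apply/eqP/contraT => /eqP nq; have [h1 h2] := spm_coatom S hy cy cq nq.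
have hq := tle_trans (cov_le cq) (spm_le S hy).
have : M (M q) = M q by apply: IHN; [have := cov_rk h2; rk_lia|apply: spm_le S _ hq].
by rewrite (spmK S) // => e; have := cov_rk h1; rewrite -e; rk_lia.
Qed.

End Unique.

End Atoms.

(** * Matchings with different choices at adjacent atoms *)

Section RankCriterion.

Variable m : nat.
Implicit Types (u z x : 'S_m) (i j k l : 'I_m).

Lemma card_rank_set u a b :
  #|rank_set u a b| + #|[set k : 'I_m | k < b]| =
  #|[set k : 'I_m | k < a]| + #|[set k : 'I_m | (a <= k) && (u k < b)]|.
Proof.
have -> : #|[set k : 'I_m | k < b]| = #|[set k : 'I_m | u k < b]|.
  rewrite -(card_imset [set k : 'I_m | u k < b] (@perm_inj _ u)).
  apply: eq_card => k; rewrite -[k](permKV u) mem_imset; last exact: perm_inj.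
  by rewrite !inE.
rewrite -(cardsID [set k : 'I_m | k < a] [set k : 'I_m | u k < b]).
rewrite addnA -(cardsID [set k : 'I_m | u k < b] [set k : 'I_m | k < a]).
congr (_ + _); last by apply: eq_card => k; rewrite !inE -leqNgt.
rewrite addnC; congr (_ + _); first by apply: eq_card => k; rewrite !inE andbC.
by apply: eq_card => k; rewrite !inE -leqNgt andbC.
Qed.

(* A sufficient condition for z to lie below x, when z never moves a point    *)
(* down by more than one.                                                     *)
Lemma bruhat_excedances z x :
  (forall l, l <= (z l).+1) ->
  (forall k, k < z k -> exists k' : 'I_m, (k' <= k) && (z k <= x k')) ->
  (forall k l, k < l -> k < z k -> l < z l -> z k <= l) ->
  bruhat z x.
Proof.
move=> h1 h2 h3; apply: rank_bruhat => a b.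
have [le_ab|lt_ba] := leqP a b; last first.
  rewrite -(leq_add2r #|[set k : 'I_m | k < b]|) !card_rank_set leq_add2l.
  have -> : [set k : 'I_m | (a <= k) && (z k < b)] = set0.
    apply/setP => k; rewrite !inE; have := h1 k; lia.
  by rewrite cards0.
have [->|[k]] := set_0Vmem (rank_set z a b); first by rewrite cards0.
rewrite inE => /andP[ka bk].
have [k' /andP[k'k zx]] := h2 k (leq_trans ka (leq_trans le_ab bk)).
apply: (@leq_trans #|[set k']|); last first.
  by apply/subset_leq_card/subsetP => l; rewrite !inE => /eqP->; lia.
rewrite cards1 -(cards1 k); apply/subset_leq_card/subsetP => l.
rewrite !inE => /andP[la bl]; have [lt|lt|/val_inj->] := ltngtP k l => //.
- by have := h3 k l lt; lia.
- by have := h3 l k lt; lia.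
Qed.

End RankCriterion.

Section Mixed.

Variables (n p : nat).
Notation m := (2 * n)%N.
Notation te := (te n).
Implicit Types (x y z u v w : tid n) (k l g d r s : nat).

Hypothesis hp : p.+3 < n.
Notation t := p.+1.
Notation q := p.+2.
Notation p' := (m.-2 - p).
Notation t' := (m.-2 - p.+1).
Notation q' := (m.-2 - p.+2).

(** The element of rank 3 above which the two different choices of [M] become incompatible. *)
Definition Zel : tid n := te \tw t \tw p \tw q'.

Lemma F_Zel k : k < m -> F Zel k =
  if k == p then q' else if k == q' then p else
  if (p < k <= p.+3) || (q' < k <= q'.+3) then m - k else m.-1 - k.
Proof.
move=> hk; have h1 : t.+1 < m by lia.
have h2 : p.+1 < m by lia.
have h3 : q'.+1 < m by lia.
rewrite !F_tcj // F_te ?sw_lt //.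
by sw_split; do !case: ifP; lia.
Qed.

(** As a permutation, [Zel] sends [p] to [p.+3] and [q'] to [q'.+3] and moves the three points after
    each down by one. So [bruhat_excedances] asks only for two large values of [x], found at [k] and
    at [F x k]. *)
Lemma Zel_tle x k : k <= p -> F x k <= q' -> tle Zel x.
Proof.
move=> hk hF; have hkm : k < m by lia.
have valE y (l : 'I_m) : val y l = m.-1 - F y l :> nat.
  by rewrite F_ord /fo; move: (val y l) => o /=; have := ltn_ord o; lia.
apply: bruhat_excedances => [l|l|j l].
- by rewrite valE F_Zel //; have := ltn_ord l; do !case: ifP; lia.
- rewrite valE F_Zel //; have := ltn_ord l => hl.
  case: ifP => [/eqP el|_ lt].
    by exists (Ordinal hkm); rewrite valE /=; lia.
  have el : l = q' :> nat by move: lt; do !case: ifP; lia.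
  exists (Ordinal (F_lt x hkm)); rewrite valE /= F_K // el.
  by do !case: ifP; lia.
- rewrite !valE !F_Zel //; have := ltn_ord l; have := ltn_ord j.
  by do !case: ifP; lia.
Qed.

Lemma dec_gap x l h a b : (forall k, l <= k < h -> ~~ dn x k) -> h < m ->
  l <= a -> a <= b -> b <= h -> F x b + (b - a) <= F x a.
Proof.
move=> dec hm la; elim: b => [|b IHb] ab bh; first by move: ab; rewrite leqn0 => /eqP->; lia.
have [->|ne] := eqVneq a b.+1; first by lia.
have := IHb; have := dec b; have := @F_pair n x b b.+1; rewrite /dn; lia.
Qed.

(* The involution with descents exactly at p and q' that is not above Zel.     *)
Definition Fh k := if k <= p then m.-1 - k else if k <= q' then p.+1 + q' - k
  else if k == q'.+1 then q'.+2 else if k == q'.+2 then q'.+1 else m.-1 - k.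

(** Not being above [Zel] sends the points up to [p] beyond [q'], by [Zel_tle]. This excludes a
    descent at [p], so the involution decreases up to [q'] and after [q'], which squeezes it into
    [Fh]. *)
Lemma two_descents v : v <> te -> ~ tle Zel v ->
  (forall d, d.+1 < m -> dn v d -> d = p \/ d = q') ->
  forall k, k < m -> F v k = Fh k.
Proof.
move=> nv nZ D.
have star k : k <= p -> q' < F v k.
  by move=> hk; rewrite ltnNge; apply/negP => h; apply: nZ; apply: Zel_tle hk h.
have ndn k : k.+1 < m -> k <> p -> k <> q' -> ~~ dn v k.
  by move=> h n1 n2; apply/negP => /(D k h)[].
have K k : k < m -> F v (F v k) = k by apply: F_K.
have L k : k < m -> F v k < m by apply: F_lt.
have decC a b : q'.+1 <= a -> a <= b -> b < m -> F v b + (b - a) <= F v a.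
  move=> h1 h2 h3; apply: (@dec_gap v q'.+1 m.-1); try (by move: h1 h2 h3; clear -hp; lia).
  by move=> k hk; apply: ndn; move: hk; clear -hp; lia.
have np : ~~ dn v p.
  rewrite /dn; apply/negP => lt.
  have h1 := star p (leqnn p); have := @decC (F v p) (F v p.+1).
  rewrite !K ?L; try (by clear -hp; lia).
  by move: h1 lt; clear -hp; lia.
have decA a b : a <= b -> b <= q' -> F v b + (b - a) <= F v a.
  move=> h1 h2; apply: (@dec_gap v 0 q'); try (by move: h1 h2; clear -hp; lia).
  move=> k hk; have [->//|/eqP ne] := eqVneq k p.
  by apply: ndn => //; move: hk; clear -hp; lia.
have dq' : F v q' < F v q'.+1.
  have /ex_dn[d hd dv] : v != te by apply/eqP.
  case: (D d hd dv) => ed; rewrite ed in dv; last exact: dv.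
  by rewrite dv in np.
have ltq : q'.+1 < m by clear -hp; lia.
have Fa : F v (F v q'.+1) = q'.+1 by apply: K.
have La := L _ ltq; have Nq : F v q'.+1 <> q'.+1 := F_neq ltq.
have Fb : F v (F v q') = q' by apply: K; clear -hp; lia.
have Fpp : F v (F v p) = p by apply: K; clear -hp; lia.
have Lp : F v p < m by apply: L; clear -hp; lia.
set a := F v q'.+1 in dq' Fa La Nq.
have a_gt : q'.+1 < a.
  have := @decA (F v q') a; rewrite Fa Fb; move: dq' Nq; clear -hp; lia.
have Fp_gt : a < F v p.
  have := @decC (F v p) a; rewrite Fa Fpp; have := star p (leqnn p).
  move: a_gt La Lp; have [e|ne] := eqVneq (F v p) a; last by move: ne; clear -hp; lia.
  by move: Fa; rewrite -e Fpp; clear -hp; lia.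
have F0 := L 0; have dA0 := @decA 0 p.
(* [F v p] exceeds [a] and is at most [m.-1 - p], which equals [q'.+3]. *)
have ea : a = q'.+2 by move: F0 dA0 Fp_gt a_gt; clear -hp; lia.
have lowF k : k <= p -> F v k = m.-1 - k.
  move=> hk; have := @decA 0 k; have := @decA k p.
  by move: hk F0 Fp_gt; rewrite ea; clear -hp; lia.
have highF k : q'.+2 < k < m -> F v k = m.-1 - k.
  move=> hk; have e : F v (m.-1 - k) = k.
    by rewrite lowF; move: hk; clear -hp; lia.
  by rewrite -[in LHS]e K //; move: hk; clear -hp; lia.
have midF k : p < k <= q' -> F v k = p.+1 + q' - k.
  move=> hk.
  have h1 : F v p.+1 <= q'.
    have hpm : p.+1 < m by clear -hp; lia.
    have e := K _ hpm; have l := L _ hpm; rewrite leqNgt; apply/negP => gt.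
    have [e2|n2] := eqVneq (F v p.+1) q'.+1; first by rewrite e2 -/a ea in e; move: e; clear -hp; lia.
    have [e3|n3] := eqVneq (F v p.+1) q'.+2; first by rewrite e3 -ea Fa in e; move: e; clear -hp; lia.
    have := highF (F v p.+1); rewrite e; move: gt l n2 n3; clear -hp; lia.
  have h2 : p < F v q'.
    by rewrite ltnNge; apply/negP => /star; rewrite Fb ltnn.
  have := @decA p.+1 k; have := @decA k q'.
  by move: hk h1 h2; clear -hp; lia.
move=> k hk; rewrite /Fh; case: ifP => [/lowF//|/negbT h1].
case: ifP => [h2|/negbT h2]; first by apply: midF; move: h1 h2; clear; lia.
case: eqP => [->|h3]; first by rewrite -/a ea.
case: eqP => [->|h4]; first by rewrite -ea Fa.
by apply: highF; move: h1 h2 h3 h4 hk; clear; lia.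
Qed.

(** The chain along which the value of [M] at the atom [te \tw q] is carried to an element fixed by
    [q']. *)
Fixpoint Xel j : tid n := if j is j'.+1 then Xel j' \tw (q + j') else te.

Lemma F_Xel j k : j <= q' - q -> k < m -> F (Xel j) k =
  if k == q + j then q'.+1 else if k == q'.+1 then q + j else
  if q <= k < q + j then
    if q < m.-2 - k <= q + j then (m.-2 - k).-1 else m.-2 - k
  else if q < m.-1 - k <= q + j then (m.-1 - k).-1 else m.-1 - k.
Proof.
elim: j k => [|j IHj] k hj hk.
  by rewrite F_te // addn0 /=; do !case: ifP => ?; lia.
have hl : (q + j).+1 < m by move: hj; clear -hp; lia.
rewrite /= F_tcj //; have hs := sw_lt hl hk; rewrite (IHj _ (ltnW hj) hs).
clear IHj hs hl; move: hj hk => hj hk.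
by case: (swP' (q + j) k) => [[? ->]|[[? ->]|[? [? ->]]]] /=;
  do !case: ifP => ?; try (by exfalso; lia); sw_split; lia.
Qed.

Lemma Xel_fx : fx (Xel (q' - q)) q'.
Proof.
have hk : q' < m by lia.
by rewrite /fx F_Xel // ifT; lia.
Qed.

Lemma Xel_up_last j : j <= q' - q -> up (Xel j) t'.
Proof.
move=> hj; have hk : t' < m by lia.
have hk2 : t'.+1 < m by lia.
have e1 : F (Xel j) t' = q + j by rewrite F_Xel // ifF ?ifT; lia.
have e2 : F (Xel j) t'.+1 = p.+1 by rewrite F_Xel // !ifF; lia.
by rewrite /up e1 e2; lia.
Qed.

Lemma Xel_up j : j < q' - q -> up (Xel j) (q + j).
Proof.
move=> hj; have hk : (q + j).+1 < m by lia.
have e1 : F (Xel j) (q + j) = q'.+1 by rewrite F_Xel ?ifT //; lia.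
rewrite /up e1 F_Xel ?(ltnW hj) //.
by do !case: ifP => ?; lia.
Qed.

Lemma Fh_Xel v : (forall k, k < m -> F v k = Fh k) ->
  v = Xel (q' - q) \tw t' \tw q'.
Proof.
move=> h; apply: F_ext => k hk; rewrite h // !F_tcj; try lia.
have hq' : q'.+1 < m by lia.
have ht' : t'.+1 < m by lia.
rewrite (F_Xel (leqnn _) (sw_lt ht' (sw_lt hq' hk))) /Fh.
case: (swP' q' k) => [[? ->]|[[? ->]|[? [? ->]]]].
- case: (swP' t' q'.+1) => [[? ->]|[[? ->]|[? [? ->]]]]; try (by exfalso; lia);
  do !case: ifP => ?; try (by exfalso; lia); sw_split; lia.
- case: (swP' t' q') => [[? ->]|[[? ->]|[? [? ->]]]]; try (by exfalso; lia);
  do !case: ifP => ?; try (by exfalso; lia); sw_split; lia.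
- case: (swP' t' k) => [[? ->]|[[? ->]|[? [? ->]]]]; try (by exfalso; lia);
  do !case: ifP => ?; try (by exfalso; lia); sw_split; lia.
Qed.

(* The second descent survives any other ascent. *)
Lemma Fh_dn v s : (forall k, k < m -> F v k = Fh k) -> s.+1 < m ->
  s <> p -> s <> q' -> up v s -> dn (v \tw s) q'.
Proof.
move=> h hs n1 n2; have h1 : F v q'.+1 = q'.+2.
  by rewrite h /Fh; [do !case: ifP => ?; lia|lia].
rewrite /up /dn !F_tcj // => us.
have nt : s <> q'.+1.
  move=> e; move: us; rewrite e h1; lia.
have -> : sw s q'.+1 = q'.+1 by sw_split; lia.
have [e|ne] := eqVneq s q'.-1.
  have -> : sw s q' = s by sw_split; lia.
  have -> : F v s = p.+2 by rewrite h /Fh; [do !case: ifP => ?; lia|lia].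
  by rewrite h1; sw_split; lia.
have -> : sw s q' = q' by sw_split; lia.
have -> : F v q' = p.+1 by rewrite h /Fh; [do !case: ifP => ?; lia|lia].
by rewrite h1; sw_split; lia.
Qed.

End Mixed.

Section RankTwo.

Variable n : nat.
Notation m := (2 * n)%N.
Notation te := (te n).
Notation mir k := (m.-2 - k).
Implicit Types (x y z u v : tid n) (a b d k : nat).

(** Both [te \tw a] and [te \tw b] are coatoms, so by [cov_lift] a descent leads to one of them or
    is a descent of both. *)
Lemma dn_te2 a b d : a.+1 < m -> b.+1 < m -> d.+1 < m ->
  a != n.-1 -> b != n.-1 -> te \tw a <> te \tw b -> far a (mir b) ->
  up (te \tw a) b -> te \tw a \tw b <> te \tw a \tw mir b ->
  dn (te \tw a \tw b) d -> d = b \/ d = mir a.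
Proof.
move=> ha hb hd na nb nab fab ub neq du; set u := te \tw a \tw b in neq du.
have dub : dn u b := up_dn hb ub.
have rab : rk u = (rk (te \tw a)).+1 := rk_up hb ub.
have ca : cov (te \tw a) u := cov_up hb ub.
have cb : cov (te \tw b) u.
  apply: covP; last by rewrite rab !rk_te_tcj.
  by apply: (lift_le hb dub); apply: te_tle.
have hb' : (mir b).+1 < m by lia.
have eqa : te \tw b \tw a = te \tw a \tw mir b.
  by rewrite (te_mir hb) tcj_far // far_sym.
have [ea|da] := cov_lift hd ca du.
  have [eb|db] := cov_lift hd cb du; first by case: nab; rewrite ea -eb.
  have [->|ed] := te_dn hb hd nb db; first by left.
  by case: neq; rewrite -/u -ed ea tcjK.
have [ed|->] := te_dn ha hd na da; last by right.
have [eb|db] := cov_lift hd cb du.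
  by case: neq; rewrite -/u -eqa -ed eb tcjK.
by case: nab; have [e|e] := te_dn hb hd nb db; rewrite -ed e // -te_mir.
Qed.

Lemma cov_te2 a b : a.+1 < m -> b.+1 < m -> a != n.-1 -> b != n.-1 ->
  up (te \tw a) b -> cov (te \tw b) (te \tw a \tw b).
Proof.
move=> ha hb na nb ub; apply: covP; last by rewrite (rk_up hb ub) !rk_te_tcj.
by apply: (lift_le hb (up_dn hb ub)); apply: te_tle.
Qed.

End RankTwo.

Ltac clia H := clear -H; lia.

(** * A matching with different choices at [p] and [q] *)

Section Mixed.

Variables (n p : nat).
Notation m := (2 * n)%N.
Notation te := (te n).
Implicit Types (x y z u v : tid n) (k l g d r s : nat).

Hypothesis hp : p.+3 < n.
Notation t := p.+1.
Notation q := p.+2.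
Notation p' := (m.-2 - p).
Notation t' := (m.-2 - p.+1).
Notation q' := (m.-2 - p.+2).

Variables (w : tid n) (M : tid n -> tid n).
Hypothesis S : spm w M.
Hypothesis Me : M te = te \tw t.
Hypothesis le_p : tle (te \tw p) w.
Hypothesis le_q : tle (te \tw q) w.
Hypothesis Mp : M (te \tw p) = te \tw p \tw t.
Hypothesis Mq : M (te \tw q) = te \tw q \tw t'.
Hypothesis np : te \tw p \tw t <> te \tw p \tw t'.
Hypothesis nq : te \tw q \tw t' <> te \tw q \tw t.

Let okp : p.+1 < m. Proof. (clia hp). Qed.
Let okt : t.+1 < m. Proof. (clia hp). Qed.
Let okq : q.+1 < m. Proof. (clia hp). Qed.
Let okp' : p'.+1 < m. Proof. (clia hp). Qed.
Let okt' : t'.+1 < m. Proof. (clia hp). Qed.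
Let okq' : q'.+1 < m. Proof. (clia hp). Qed.
Let mp : p != n.-1. Proof. (clia hp). Qed.
Let mt : t != n.-1. Proof. (clia hp). Qed.
Let mq : q != n.-1. Proof. (clia hp). Qed.
Let mp' : p' != n.-1. Proof. (clia hp). Qed.
Let mt' : t' != n.-1. Proof. (clia hp). Qed.
Let mq' : q' != n.-1. Proof. (clia hp). Qed.

Let ept : te \tw p \tw t = te \tw t \tw p'.
Proof.
rewrite (te_mir okp) tcj_far ?(te_mir okt) //; rewrite /far; (clia hp).
Qed.

Let etp : te \tw t \tw p = te \tw p \tw t'.
Proof. by rewrite (te_mir okt) tcj_far // /far; (clia hp). Qed.

Let etq : te \tw q \tw t' = te \tw t \tw q.
Proof. by rewrite tcj_far -?te_mir // /far; (clia hp). Qed.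

Let eqt : te \tw q \tw t = te \tw t \tw q'.
Proof. by rewrite (te_mir okq) tcj_far // /far; (clia hp). Qed.

Let epq : te \tw p \tw q = te \tw q \tw p.
Proof. by rewrite tcj_far // /far; (clia hp). Qed.

Let te_neq a b : a.+1 < m -> b.+1 < m -> a != n.-1 -> b <> a ->
  b <> m.-2 - a -> te \tw a <> te \tw b.
Proof. by move=> ha hb na n1 n2 e; case: (te_inj ha hb na e). Qed.

Let upf a b : a.+1 < m -> b.+1 < m -> a != n.-1 -> b != n.-1 ->
  b <> a -> b <> m.-2 - a -> up (te \tw a) b.
Proof.
move=> ha hb na nb n1 n2.
have ua := te_up ha na; have ub := te_up hb nb.
have nab : b != a by apply/eqP.
case/orP: (far_or_adj nab) => h.
  have [//|e] := far_up_up hb ha h ua ub.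
  by case: (te_neq ha hb na n1 n2).
by rewrite adj_sym in h; case: (adj_up_up ha hb h ua ub).
Qed.

Notation pt := (te \tw p \tw t).
Notation tp := (te \tw t \tw p).
Notation tq := (te \tw t \tw q).
Notation qt := (te \tw t \tw q').
Notation pq := (te \tw p \tw q).

Let dn_pt d : d.+1 < m -> dn pt d -> d = t \/ d = p'.
Proof.
move=> hd; apply: dn_te2 => //; [|rewrite /far; (clia hp)|]; [apply: te_neq|apply: upf]; (clia hp).
Qed.

Let dn_tp d : d.+1 < m -> dn tp d -> d = p \/ d = t'.
Proof.
move=> hd; apply: dn_te2 => //; [|rewrite /far; (clia hp)| |]; [apply: te_neq; (clia hp)|apply: upf; (clia hp)|].
by rewrite etp -ept => e; apply: np.
Qed.

Let dn_tq d : d.+1 < m -> dn tq d -> d = q \/ d = t'.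
Proof.
move=> hd; apply: dn_te2 => //; [|rewrite /far; (clia hp)| |]; [apply: te_neq; (clia hp)|apply: upf; (clia hp)|].
by rewrite -etq -eqt.
Qed.

Let dn_qt d : d.+1 < m -> dn qt d -> d = t \/ d = q'.
Proof.
move=> hd; rewrite -eqt => h; have := @dn_te2 n q t d okq okt hd mq mt.
move=> /(_ _ _ _ _ h) h'; apply: h'; [apply: te_neq; (clia hp)| rewrite /far; (clia hp)|apply: upf; (clia hp)|].
by move=> e; apply: nq.
Qed.

Let dn_pq d : d.+1 < m -> dn pq d -> [\/ d = p, d = p', d = q | d = q'].
Proof.
move=> hd h; have up' : up (te \tw p) q by apply: upf; (clia hp).
have [e1|h1] := cov_lift hd (cov_up okq up') h.
  have [e2|h2] := cov_lift hd (cov_te2 okp okq mp mq up') h.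
    by case: (@te_neq p q) => //; [(clia hp)|(clia hp)|rewrite e1 e2].
  by have [->|->] := te_dn okq hd mq h2; [constructor 3|constructor 4].
by have [->|->] := te_dn okp hd mp h1; [constructor 1|constructor 2].
Qed.

Let cov_p_tp : cov (te \tw p) tp.
Proof. by apply: cov_te2 => //; apply: upf; (clia hp). Qed.
Let cov_q_qt : cov (te \tw q) qt.
Proof. by rewrite (te_mir okq); apply: cov_te2 => //; apply: upf; (clia hp). Qed.
Let cov_p_pq : cov (te \tw p) pq.
Proof. by apply: cov_up => //; apply: upf; (clia hp). Qed.
Let cov_q_pq : cov (te \tw q) pq.
Proof. by apply: cov_te2 => //; apply: upf; (clia hp). Qed.
Let dn_pq_p : dn pq p.
Proof. by rewrite epq; apply: up_dn => //; apply: upf; (clia hp). Qed.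
Let dn_pq_q : dn pq q.
Proof. by apply: up_dn => //; apply: upf; (clia hp). Qed.
Let dn_tp_p : dn tp p.
Proof. by apply: up_dn => //; apply: upf; (clia hp). Qed.

Let neq_tp_pt : tp <> pt.
Proof. by move=> e; have := dn_tp_p; rewrite e => /(dn_pt okp); (clia hp). Qed.
Let neq_tp_qt : tp <> qt.
Proof. by move=> e; have := dn_tp_p; rewrite e => /(dn_qt okp); (clia hp). Qed.
Let neq_pq_tp : pq <> tp.
Proof. by move=> e; have := dn_pq_q; rewrite e => /(dn_tp okq); (clia hp). Qed.
Let neq_pq_qt : pq <> qt.
Proof. by move=> e; have := dn_pq_p; rewrite e => /(dn_qt okp); (clia hp). Qed.
Let neq_pq_pt : pq <> pt.
Proof. by move=> e; have := dn_pq_p; rewrite e => /(dn_pt okp); (clia hp). Qed.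
Let neq_pq_tq : pq <> tq.
Proof. by move=> e; have := dn_pq_p; rewrite e => /(dn_tq okp); (clia hp). Qed.
Let neq_tq_qt : tq <> qt.
Proof. by rewrite -etq -eqt. Qed.

(* The images under M of the three coatoms tp, qt, pq of Z, together with Z   *)
(* itself, would be coatoms of M Z; but an element has at most one coatom     *)
(* lacking a given descent of it.                                             *)
Lemma Zel_not_tle : ~ tle (Zel n p) w.
Proof.
move=> hZ; set Z := Zel n p in hZ.
have far_q'p : far q' p by rewrite /far; (clia hp).
have uZ : up tp q'.
  have u1 : up (te \tw t) q' by apply: upf; (clia hp).
  have u2 : up (te \tw t) p by apply: upf; (clia hp).
  by have [//|e] := far_up_up okq' okp far_q'p u2 u1; case: neq_tp_qt.
have dZq' : dn Z q' := up_dn okq' uZ.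
have dZp : dn Z p by apply: far_dn => //; rewrite far_sym.
have cZtp : cov tp Z := cov_up okq' uZ.
have cZqt : cov qt Z.
  have <- : Z \tw p = qt by rewrite /Z /Zel tcj_far ?tcjK // far_sym.
  exact: cov_dn.
have cZpq : cov pq Z.
  apply: covP; last by rewrite (cov_rk cZtp) (cov_rk cov_p_tp) (cov_rk cov_p_pq).
  have -> : pq = te \tw p \tw q' by rewrite epq (te_mir okq) tcj_far.
  by apply: (lift_le okq' dZq'); apply: (lift_le okp dZp); apply: te_tle.
have ltp := tle_trans (cov_le cZtp) hZ.
have lqt := tle_trans (cov_le cZqt) hZ.
have lpq := tle_trans (cov_le cZpq) hZ.
have cMp : cov (te \tw p) (M (te \tw p)) by rewrite Mp; apply: cov_up => //; apply: upf; (clia hp).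
have cMq : cov (te \tw q) (M (te \tw q)) by rewrite Mq; apply: cov_up => //; apply: upf; (clia hp).
have [y1 y2] : cov tp (M tp) /\ cov pt (M tp).
  by rewrite -Mp; apply: (spm_up_next S ltp cov_p_tp cMp); rewrite Mp; auto.
have [x1 x2] : cov qt (M qt) /\ cov tq (M qt).
  by rewrite -etq -Mq; apply: (spm_up_next S lqt cov_q_qt cMq); rewrite Mq etq.
have [z1 z2] : cov pq (M pq) /\ cov pt (M pq).
  by rewrite -Mp; apply: (spm_up_next S lpq cov_p_pq cMp); rewrite Mp; auto.
have [_ z3] : cov pq (M pq) /\ cov tq (M pq).
  by rewrite -etq -Mq; apply: (spm_up_next S lpq cov_q_pq cMq); rewrite Mq etq; auto.
have dn_Mtp d : d.+1 < m -> dn (M tp) d -> [\/ d = p, d = t', d = t | d = p'].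
  move=> hd h; have [e1|h1] := cov_lift hd y1 h.
    have [e2|h2] := cov_lift hd y2 h; first by case: neq_tp_pt; rewrite e1 -e2.
    by have [->|->] := dn_pt hd h2; [constructor 3|constructor 4].
  by have [->|->] := dn_tp hd h1; [constructor 1|constructor 2].
have dn_Mqt d : d.+1 < m -> dn (M qt) d -> [\/ d = q, d = t', d = t | d = q'].
  move=> hd h; have [e1|h1] := cov_lift hd x1 h.
    have [e2|h2] := cov_lift hd x2 h; first by case: neq_tq_qt; rewrite e1 -e2.
    by have [->|->] := dn_tq hd h2; [constructor 1|constructor 2].
  by have [->|->] := dn_qt hd h1; [constructor 3|constructor 4].
have dn_Mpq d : d.+1 < m -> dn (M pq) d -> d = p' \/ d = q.
  move=> hd h; have [e1|h1] := cov_lift hd z1 h.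
    have [e2|h2] := cov_lift hd z2 h; first by case: neq_pq_pt; rewrite e1 -e2.
    have [e3|h3] := cov_lift hd z3 h; first by case: neq_pq_tq; rewrite e1 -e3.
    by have := dn_pt hd h2; have := dn_tq hd h3; (clia hp).
  have [e2|h2] := cov_lift hd z2 h; last first.
    by case: (dn_pq hd h1) (dn_pt hd h2); (clia hp).
  have [e3|h3] := cov_lift hd z3 h; last first.
    by case: (dn_pq hd h1) (dn_tq hd h3); (clia hp).
  have e : pt = tq by rewrite e2 -e3.
  have := congr1 M e; rewrite -etq -{1}Mp -{1}Mq !(spmK S) // => e'.
  by case: (@te_neq p q) => //; (clia hp).
have dn_Z d : d.+1 < m -> dn Z d -> d = p \/ d = q'.
  move=> hd h; have [e1|h1] := cov_lift hd cZtp h.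
    have [e2|h2] := cov_lift hd cZqt h; first by case: neq_tp_qt; rewrite e1 -e2.
    have [e3|h3] := cov_lift hd cZpq h; first by case: neq_pq_tp; rewrite e1 -e3.
    by case: (dn_pq hd h3) (dn_qt hd h2); (clia hp).
  have [e3|h3] := cov_lift hd cZpq h.
    have [e2|h2] := cov_lift hd cZqt h; first by case: neq_pq_qt; rewrite e2 -e3.
    by have := dn_tp hd h1; have := dn_qt hd h2; (clia hp).
  by case: (dn_pq hd h3) (dn_tp hd h1); (clia hp).
have nZtp : M tp <> Z.
  by move=> e; have := dZq'; rewrite -e => /(dn_Mtp _ okq')[]; (clia hp).
have nZqt : M qt <> Z.
  by move=> e; have := dZp; rewrite -e => /(dn_Mqt _ okp)[]; (clia hp).
have nZpq : M pq <> Z.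
  by move=> e; have := dZp; rewrite -e => /(dn_Mpq _ okp); (clia hp).
have [v1 v2] := spm_up_next S hZ cZtp y1 nZtp.
have [_ v3] := spm_up_next S hZ cZqt x1 nZqt.
have [_ v4] := spm_up_next S hZ cZpq z1 nZpq.
have ntp_qt : M tp <> M qt by move/(congr1 M); rewrite !(spmK S).
have ntp_pq : M tp <> M pq by move/(congr1 M); rewrite !(spmK S) //; auto.
have nqt_pq : M qt <> M pq by move/(congr1 M); rewrite !(spmK S) //; auto.
have /ex_dn[d hd dV] : M Z != te.
  by apply: contra_eqN (cov_rk v1) => /eqP->; rewrite rk_te.
have [e1|/(dn_Z _ hd) h1] := cov_lift hd v1 dV.
  have [e2|/(dn_Mtp _ hd) h2] := cov_lift hd v2 dV; first by case: nZtp; rewrite e1.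
  have [e3|/(dn_Mqt _ hd) h3] := cov_lift hd v3 dV; first by case: nZqt; rewrite e1.
  have [e4|/(dn_Mpq _ hd) h4] := cov_lift hd v4 dV; first by case: nZpq; rewrite e1.
  by move: h4; case: h2 h3 => -> [] e; move: e; (clia hp).
have [e4|/(dn_Mpq _ hd) h4] := cov_lift hd v4 dV; last by move: h1 h4; (clia hp).
have [e2|/(dn_Mtp _ hd) h2] := cov_lift hd v2 dV; first by case: ntp_pq; rewrite e2.
have [e3|/(dn_Mqt _ hd) h3] := cov_lift hd v3 dV; first by case: nqt_pq; rewrite e3.
by move: h1; case: h2 h3 => -> [] e; move: e; (clia hp).
Qed.

(** By [keeps] only [te] and the atom [te \tw r] need inspection. The letters [p] and [q'] are
    exceptional because [M (te \tw p)] descends at most at [t] and [p'], and [M (te \tw q)] at most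
    at [q] and [t']. *)
Lemma mixed_keeps r : r.+1 < m -> r <> p -> r <> q' ->
  forall x, tle x w -> keeps_dn M r x /\ keeps_fx M r x.
Proof.
move=> hr n1 n2; apply: keeps => //.
- move=> hle ur; have nr : r != n.-1.
    by apply: contraTneq ur => er; have := te_fx (leq_ltn_trans (leq0n _) hp);
      rewrite -er => h; apply/negP => u; apply: up_fxF h.
  have [e|ne] := eqVneq (te \tw r) (te \tw t).
    move=> _; rewrite e -Me (spmK S) ?te_tle // Me => /cov_rk.
    by rewrite rk_te rk_te_tcj.
  move/eqP: ne => ne _ _.
  have [->|/eqP nrq] := eqVneq r q; first by rewrite Mq etq; apply: up_dn; rewrite ?upf; (clia hp).
  have [e|/eqP nrp'] := eqVneq r p'.
    by rewrite {1}e -(te_mir okp) Mp ept e; apply: up_dn; rewrite ?upf; (clia hp).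
  have nrt : r <> t by move=> e; apply: ne; rewrite e.
  have nrt' : r <> t' by move=> e; apply: ne; rewrite e -te_mir.
  have frt : far r t by rewrite /far; move: n1 nrt nrq; (clia hp).
  have frt' : far r t' by rewrite /far; move: n2 nrt' nrp'; (clia hp).
  have cMe : cov te (M te) by rewrite Me; apply: cov_te_tcj.
  have nMe : M te <> te \tw r by rewrite Me; auto.
  have [c1 c2] := spm_up_next S hle (cov_te_tcj hr nr) cMe nMe.
  rewrite Me in c2; set u := M (te \tw r) in c1 c2 *.
  have /ex_dn[d hd du] : u != te.
    by apply: contra_eqN (cov_rk c1) => /eqP->; rewrite rk_te.
  have dr : dn (te \tw r) r by apply: up_dn; rewrite ?te_up.
  have [e1|d1] := cov_lift hd c1 du.
    have ud : up (te \tw r) d by rewrite e1; apply: dn_up.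
    have eu : u = te \tw r \tw d by rewrite e1 tcjK.
    have [e2|d2] := cov_lift hd c2 du; first by case: ne; rewrite e1 e2.
    by rewrite eu; apply: far_dn => //; case: (te_dn okt hd mt d2) => ->.
  have [e2|d2] := cov_lift hd c2 du.
    case: (te_dn hr hd nr d1) => ed; first by rewrite -ed.
    have -> : u = te \tw r \tw t.
      have hm : (m.-2 - r).+1 < m by rewrite -ed.
      rewrite -(tcjK u hd) -e2 (te_mir hr) ed tcj_far //.
      by rewrite far_sym -ed; move: frt'; rewrite /far ed; move: hr; (clia hp).
    apply: far_dn => //; apply: upf => //; first by auto.
    by move: nrt' hr; (clia hp).
  by case: (te_dn okt hd mt d2) (te_dn hr hd nr d1) => -> []; move: nrt nrt' hr; (clia hp).
- move=> fr; have er : r = n.-1.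
    apply/eqP; apply: contraTT fr => nr; apply/negP => h.
    by apply: up_fxF h; rewrite // te_up.
  rewrite /keeps_fx Me => _ _ h; apply: (@up_fxF n (te \tw t) r) => //.
  by apply: far_fx => //; rewrite /far er; (clia hp).
Qed.

Notation last := (q' - q).

(** The letters of the chain after [q] are distant from [t'] and not exceptional, so the descent at
    [r] survives in [M (x \tw r)], which must then be [x \tw t' \tw r]. *)
Lemma mixed_chain j : j < last -> tle (Xel n p j.+1) w ->
  M (Xel n p j.+1) = Xel n p j.+1 \tw t'.
Proof.
elim: j => [|j IHj] hj hle; first by rewrite /= addn0.
set x := Xel n p j.+1 in IHj; set r := q + j.+1.
have hr : r.+1 < m by move: hj; rewrite /r; (clia hp).
have e2 : Xel n p j.+2 = x \tw r by [].
have uxr : up x r := Xel_up hp hj.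
have lex := tle_trans (tle_up hr uxr) hle.
have Mx := IHj (ltnW hj) lex.
have uxt : up x t' by apply: Xel_up_last => //; apply: ltnW.
have uxrt : up (x \tw r) t' by rewrite -e2; apply: Xel_up_last.
have neq : x \tw t' <> x \tw r.
  by move=> e; apply: (up_dnF okt' uxrt); rewrite -e; apply: up_dn.
have frt : far r t' by rewrite /far /r; move: hj; (clia hp).
have cx : cov x (M x) by rewrite Mx; apply: cov_up.
have nMx : M x <> x \tw r by rewrite Mx.
have [c1 c2] := spm_up_next S hle (cov_up hr uxr) cx nMx.
rewrite Mx in c2; have [k _] : keeps_dn M r (x \tw r) /\ keeps_fx M r (x \tw r).
  by apply: mixed_keeps => //; move: hj; rewrite /r; (clia hp).
have dM := k (up_dn hr uxr) c1.
have [e|d] := cov_lift hr c2 dM.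
  by rewrite e2 -(tcjK (M _) hr) -e tcj_far // far_sym.
have [u|e] := far_up_up hr okt' frt uxt uxr; first by case: (up_dnF hr u d).
by case: neq.
Qed.

(* Otherwise v = M w has no descents besides p and q', which makes it explicit: *)
(* v = x t' q' with x fixed by q' and M x = x t'. The orbit of w under M and    *)
(* q' then reaches x along a path on which q' cannot act trivially.             *)
Lemma mixed_letter :
  exists s, [/\ s.+1 < m, dn w s, w \tw s <> M w, s <> p & s <> q'].
Proof.
have [/existsP[[s hs0] /= /and4P[hs ds /eqP ns /andP[/eqP n1 /eqP n2]]]|none] :=
  boolP [exists s : 'I_m, [&& s.+1 < m, dn w s, w \tw s != M w & (val s != p) && (val s != q')]].
  by exists s.
have all s : s.+1 < m -> dn w s -> s <> p -> s <> q' -> w \tw s = M w.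
  move=> hs ds n1 n2; apply/eqP/contraT => ne; move: none.
  rewrite negb_exists => /forallP/(_ (Ordinal (ltnW hs))) /=.
  by rewrite hs ds ne /=; move/eqP: n1 => ->; move/eqP: n2 => ->.
exfalso; set v := M w in all.
have cv : cov v w := spm_top S.
have lev := cov_le cv; have Mv : M v = w by apply: (spmK S (tle_refl w)).
have nw : w <> te.
  move=> e; have := rk_le le_p; rewrite e rk_te_tcj // rk_te; (clia hp).
have Dv d : d.+1 < m -> dn v d -> d = p \/ d = q'.
  move=> hd dv; have [->|/eqP n1] := eqVneq d p; first by left.
  have [->|/eqP n2] := eqVneq d q'; first by right.
  have [k _] := mixed_keeps hd n1 n2 lev; have := k dv; rewrite Mv => /(_ cv) dw.
  have e := all d hd dw n1 n2.
  by case: (up_dnF hd _ dv); rewrite -e; apply: dn_up.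
have rw : 1 < rk w.
  have := rk_le (spm_le S le_p); rewrite Mp rk_up ?rk_te_tcj //.
  by apply: upf; (clia hp).
have nv : v <> te by move=> e; have := cov_rk cv; rewrite e rk_te; move: rw; (clia hp).
have nZ z : tle z w -> ~ tle (Zel n p) z.
  by move=> hz h; apply: Zel_not_tle; apply: tle_trans hz.
have Fv := two_descents hp nv (nZ v lev) Dv.
(* Otherwise [two_descents] describes [w] and [v] by the same involution. *)
have [s [hs ds ns1 ns2]] : exists s, [/\ s.+1 < m, dn w s, s <> p & s <> q'].
  have [/existsP[[s hs0] /= /and4P[hs ds /eqP n1 /eqP n2]]|none'] :=
    boolP [exists s : 'I_m, [&& s.+1 < m, dn w s, val s != p & val s != q']].
    by exists s.
  have Dw d : d.+1 < m -> dn w d -> d = p \/ d = q'.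
    move=> hd dw; have [->|n1] := eqVneq d p; first by left.
    have [->|n2] := eqVneq d q'; first by right.
    move: none'; rewrite negb_exists => /forallP/(_ (Ordinal (ltnW hd))) /=.
    by rewrite hd dw n1 n2.
  have Fw := two_descents hp nw (nZ w (tle_refl w)) Dw.
  have e : v = w by apply: F_ext => k hk; rewrite Fv // Fw.
  by have := cov_rk cv; rewrite e; clear; lia.
have esv := all s hs ds ns1 ns2.
have usv : up v s by rewrite -esv; apply: dn_up.
have dwq : dn w q' by rewrite -(tcjK w hs) esv; apply: Fh_dn usv.
have ev := Fh_Xel hp Fv; set x := Xel n p last in ev.
have fx : fx x q' := Xel_fx hp.
have uxt : up x t' := Xel_up_last hp (leqnn _).
have adj_tq : adj t' q' by rewrite /adj; (clia hp).
have [uyq _] := adj_fx_up okt' okq' adj_tq fx uxt.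
set y := x \tw t' in ev uyq.
have cyv : cov y v by rewrite ev; apply: cov_up.
have cxy : cov x y := cov_up okt' uxt.
have dvq : dn v q' by rewrite ev; apply: up_dn.
have eyv : v \tw q' = y by rewrite ev tcjK.
have ley := tle_trans (cov_le cyv) lev.
have lex := tle_trans (cov_le cxy) ley.
have Mx : M x = y.
  have e : last = last.-1.+1 by (clia hp).
  by move: lex; rewrite /y /x e => lex; apply: mixed_chain lex; (clia hp).
have My : M y = x by rewrite -Mx (spmK S lex).
set b := w \tw q'; have cbw : cov b w := cov_dn okq' dwq.
have leb := cov_le cbw.
have rv := cov_rk cv; have rb := cov_rk cbw.
have rvy := cov_rk cyv; have ryx := cov_rk cxy.
have nMb : M b <> w.
  move/(congr1 M); rewrite (spmK S leb) -/v => e.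
  by have := rk_dn okq' dvq; rewrite -e /b tcjK //; move: rv rb; rewrite -e -/b; clear; lia.
have [le1 lt1] := spm_mono S (tle_refl w) cbw nMb; rewrite -/v in le1 lt1.
(* The element [a] lies between [x] and [v] and differs from [y = v \tw q'], so it descends at [q'].
   But its coatom [x] is fixed by [q'], against [cov_lift]. *)
set a := M b in nMb le1 lt1; have lea := tle_trans le1 lev.
have cyb : cov y b.
  by rewrite -eyv; apply: tcj_coatom.
have nMy : M y <> b by rewrite My => e; move: rv rb rvy ryx; rewrite e; clear; lia.
have [le2 lt2] := spm_mono S leb cyb nMy; rewrite My -/a in le2 lt2.
have ra : rk a = rk y by move: lt1 lt2 rv rb rvy ryx; clear; lia.
have cxa : cov x a by apply: covP => //; rewrite ra.
have cav : cov a v by apply: covP => //; rewrite ra.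
have nay : a <> y.
  move=> e; have := congr1 M e; rewrite My /a (spmK S leb) => e2.
  by move: rv rb rvy ryx; rewrite e2; clear; lia.
have [e|da] := cov_lift okq' cav dvq; first by case: nay; rewrite e eyv.
have [e|dx] := cov_lift okq' cxa da; last exact: dn_fxF dx fx.
by apply: (up_fxF okq' _ fx); rewrite e; apply: dn_up.
Qed.

End Mixed.

(** * The diagram automorphism *)

Section Theta.

Variable m : nat.
Implicit Types (u v : 'S_m) (i j : 'I_m).

Lemma bruhat_theta u v : bruhat u v -> bruhat (theta u) (theta v).
Proof.
case/connectP=> l; elim: l u => [|x l IHl] u /=.
  by move=> _ ->; apply: bruhat_refl.
case/andP=> /bruhat_stepP[i [j [lt_ij lt_u ex]]] pth lst.
apply: connect_trans (IHl _ pth lst); apply/connect1/bruhat_stepP.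
exists (rev_ord j), (rev_ord i); split.
- by move=> /=; have := ltn_ord i; have := ltn_ord j; lia.
- rewrite !thetaE !rev_ordK; move: (u i) (u j) lt_u => a b /=.
  by have := ltn_ord a; have := ltn_ord b; lia.
- by rewrite ex thetaM theta_tperm tpermC.
Qed.

Lemma ell_theta u : ell (theta u) = ell u.
Proof.
rewrite /ell -!/(inversions _).
pose g (p : 'I_m * 'I_m) := (rev_ord p.2, rev_ord p.1).
have g_inj : injective g.
  move=> [a b] [c d] e; congr pair; apply: rev_ord_inj.
    exact: (congr1 snd e).
  exact: (congr1 fst e).
rewrite -(card_imset (inversions u) g_inj); apply: eq_card => -[a b].
have key (c d : 'I_m) : (rev_ord c < rev_ord d) = (d < c).
  by move=> /=; have := ltn_ord c; have := ltn_ord d; lia.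
rewrite !inE !thetaE; apply/idP/imsetP => [/andP[h1 h2]|[[c d]]].
  exists (rev_ord b, rev_ord a); last by rewrite /g !rev_ordK.
  by rewrite inE !key h1 -key.
by rewrite inE => /andP[h1 h2] [-> ->]; rewrite !rev_ordK !key h1 h2.
Qed.

Lemma theta_in u :
  u \in twisted_identities m -> theta u \in twisted_identities m.
Proof.
case/imsetP=> v _ ->; apply/imsetP; exists (theta v) => //.
by rewrite thetaM !thetaV.
Qed.

End Theta.

Section Mirror.

Variable n : nat.
Notation m := (2 * n)%N.
Notation te := (te n).
Notation mir k := (m.-2 - k).
Implicit Types (x y z w : tid n) (k r s : nat).

(** Conjugation by the longest element. It exchanges the letters [k] and [mir k] and fixes the
    atoms, so it exchanges the two possible choices at an atom. *)
Definition tau x : tid n :=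
  exist (fun u => u \in twisted_identities m) _ (theta_in (valP x)).

Lemma tauK : involutive tau.
Proof. by move=> x; apply: val_inj; rewrite /= thetaK. Qed.

Lemma F_tau x k : k < m -> F (tau x) k = m.-1 - F x (m.-1 - k).
Proof.
move=> hk; rewrite -[k in LHS]/(val (Ordinal hk)) F_ord /fo thetaE rev_ordK.
have -> : m.-1 - k = rev_ord (Ordinal hk) by move=> /=; lia.
rewrite F_ord /fo; move: (val x _) => a /=; have := ltn_ord a; lia.
Qed.

Lemma tau_tcj x k : k.+1 < m -> tau (x \tw k) = tau x \tw mir k.
Proof.
move=> hk; have hk' : (mir k).+1 < m by lia.
apply: F_ext => j hj; rewrite F_tcj // !F_tau ?sw_lt // F_tcj //.
have -> : sw k (m.-1 - j) = m.-1 - sw (mir k) j by sw_split; lia.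
have : F x (m.-1 - sw (mir k) j) < m by apply: F_lt; have := sw_lt hk' hj; lia.
by move: (F x _) => a ha; sw_split; lia.
Qed.

Lemma tau_te : tau te = te.
Proof. by apply: F_ext => k hk; rewrite F_tau // !F_te //; lia. Qed.

Lemma tle_tau x y : tle x y -> tle (tau x) (tau y).
Proof. exact: bruhat_theta. Qed.

Lemma rk_tau x : rk (tau x) = rk x.
Proof. by rewrite /rk /= ell_theta. Qed.

Lemma cov_tau x y : cov x y -> cov (tau x) (tau y).
Proof. by case/andP=> h e; rewrite /cov tle_tau // !rk_tau. Qed.

Lemma dn_tau x k : k.+1 < m -> dn (tau x) (mir k) = dn x k.
Proof.
move=> hk; rewrite /dn !F_tau; try lia.
have -> : m.-1 - mir k = k.+1 by lia.
have -> : m.-1 - (mir k).+1 = k by lia.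
by have := F_lt x hk; have := F_lt x (ltnW hk); lia.
Qed.

Lemma fx_tau x k : k.+1 < m -> fx (tau x) (mir k) = fx x k.
Proof.
move=> hk; rewrite /fx !F_tau; try lia.
have -> : m.-1 - mir k = k.+1 by lia.
have := F_lt x hk; have := F_lt x (ltnW hk).
have := F_iff x hk (ltnW hk); move=> h1 h2 h3.
apply/eqP/eqP => e; last by have /h1 : F x k = k.+1 by []; lia.
by apply/h1; lia.
Qed.

Lemma up_tau x k : k.+1 < m -> up (tau x) (mir k) = up x k.
Proof.
move=> hk; have hk' : (mir k).+1 < m by lia.
have := states x hk; have := states (tau x) hk'; rewrite dn_tau // fx_tau //; lia.
Qed.

Lemma spm_tau w M : spm w M -> spm (tau w) (fun x => tau (M (tau x))).
Proof.
move=> S; have le x : tle x (tau w) -> tle (tau x) w.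
  by move/tle_tau; rewrite tauK.
split=> [x /le h|x /le h||x /le h|x y /le h cxy ne].
- exact/tle_tau/(spm_le S).
- by rewrite tauK (spmK S) // tauK.
- by rewrite tauK; apply/cov_tau/(spm_top S).
- case: (spm_cov S h) => [/cov_tau|e|/cov_tau].
  + by rewrite tauK; constructor 1.
  + by constructor 2; rewrite e tauK.
  + by rewrite tauK; constructor 3.
- have ne' : M (tau x) <> tau y by move=> e; apply: ne; rewrite e tauK.
  have [h1 h2] := spm_mono S h (cov_tau cxy) ne'.
  by split; [apply: tle_tau | rewrite !rk_tau].
Qed.

Lemma keeps_tau w M r : r.+1 < m ->
  (forall x, tle x (tau w) -> keeps_dn (fun x => tau (M (tau x))) r x /\
     keeps_fx (fun x => tau (M (tau x))) r x) ->
  forall x, tle x w -> keeps_dn M (mir r) x /\ keeps_fx M (mir r) x.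
Proof.
move=> hr h x hx; have [h1 h2] := h _ (tle_tau hx).
have hm : (mir r).+1 < m by lia.
have er : r = mir (mir r) by lia.
rewrite /keeps_dn /keeps_fx tauK in h1 h2.
rewrite {1 2}er dn_tau // dn_tau // in h1; rewrite {1 2}er fx_tau // up_tau // in h2.
by split=> [a /cov_tau b|a /cov_tau b]; [apply: h1|apply: h2].
Qed.

End Mirror.

(** * Twisted conjugation or a commuting descent *)

Section Classification.

Variables (n : nat) (w : tid n) (M : tid n -> tid n).
Notation m := (2 * n)%N.
Notation te := (te n).
Notation mir k := (m.-2 - k).
Implicit Types (x y z : tid n) (k r s : nat).

Hypothesis S : spm w M.

(** [M (te \tw a)] has rank 2 and covers both [te \tw a] and [te \tw i], whose descents are
    known. *)
Lemma spm_atom i a : i < n.-1 -> a < n.-1 -> a != i -> M te = te \tw i ->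
  tle (te \tw a) w ->
  M (te \tw a) = te \tw a \tw i \/ M (te \tw a) = te \tw a \tw mir i.
Proof.
move=> hi ha nai Me hle.
have oki : i.+1 < m by lia.
have oka : a.+1 < m by lia.
have okmi : (mir i).+1 < m by lia.
have okma : (mir a).+1 < m by lia.
have ni : i != n.-1 by lia.
have na : a != n.-1 by lia.
have cMe : cov te (M te) by rewrite Me; apply: cov_te_tcj.
have neq : te \tw i <> te \tw a.
  by case/(te_inj oki oka ni) => e; move: nai e hi ha; clear; lia.
have nMe : M te <> te \tw a by rewrite Me.
have [c1 c2] := spm_up_next S hle (cov_te_tcj oka na) cMe nMe.
rewrite Me in c2; set u := M (te \tw a) in c1 c2 *.
have f1 : far (mir i) a by rewrite /far; move: hi ha; clear; lia.
have f2 : far (mir a) i by rewrite /far; move: hi ha; clear; lia.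
have /ex_dn[d hd du] : u != te.
  by apply: contra_eqN (cov_rk c1) => /eqP->; rewrite rk_te.
have [e1|d1] := cov_lift hd c1 du.
  have eu : u = te \tw a \tw d by rewrite e1 tcjK.
  have [e2|d2] := cov_lift hd c2 du; first by case: neq; rewrite e1 e2.
  by rewrite eu; case: (te_dn oki hd ni d2) => ->; [left|right].
have [e2|d2] := cov_lift hd c2 du.
  have eu : u = te \tw i \tw d by rewrite e2 tcjK.
  rewrite eu; case: (te_dn oka hd na d1) => ->.
    by right; rewrite (te_mir oki) tcj_far.
  by left; rewrite -tcj_far // -te_mir.
case: (te_dn oki hd ni d2) (te_dn oka hd na d1) => -> [] e;
  by exfalso; move: nai e hi ha; clear; lia.
Qed.

(** At atoms not adjacent to [te \tw i] the two choices give the same element, so only the adjacent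
    ones have to be tested. *)
Lemma spm_of_atoms i t : i < n.-1 -> M te = te \tw i -> t = i \/ t = mir i ->
  (forall a, a < n.-1 -> adj i a -> tle (te \tw a) w ->
     M (te \tw a) = te \tw a \tw t) ->
  forall x, tle x w -> M x = x \tw t.
Proof.
move=> hi Me et conf.
have oki : i.+1 < m by lia.
have okmi : (mir i).+1 < m by lia.
have okt : t.+1 < m by case: et => ->.
have eti : te \tw i = te \tw t by case: et => -> //; rewrite -te_mir.
apply: spm_unique => // x hx; rewrite leq_eqVlt ltnS leqn0.
case/orP => /eqP r1; last by rewrite (rk0 r1) Me.
have [a [oka ha ex]] := rk1_tcj r1; rewrite ex in hx *.
have [eai|nai] := eqVneq a i.
  rewrite eai -{1}Me (spmK S) ?te_tle //.
  by rewrite eti tcjK.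
case/orP: (far_or_adj nai) => [fai|aai]; last by apply: conf; rewrite // adj_sym.
have e : te \tw a \tw i = te \tw a \tw mir i.
  have fma : far a (mir i) by rewrite /far; move: hi ha; clear; lia.
  by rewrite tcj_far // [RHS]tcj_far // -te_mir.
by have [->|->] := spm_atom hi ha nai Me hx; case: et => ->.
Qed.

(** If the adjacent atoms agree on [i] or on [mir i], then [M] is that twisted conjugation.
    Otherwise each candidate is refuted at one neighbour of [i]; the two neighbours differ, and
    [mixed_letter] applies in one of two orientations. *)
Lemma spm_classification :
  (exists2 t, t.+1 < m & forall x, tle x w -> M x = x \tw t) \/
  (exists s, [/\ s.+1 < m, dn w s, w \tw s <> M w
     & forall x, tle x w -> keeps_dn M s x /\ keeps_fx M s x]).
Proof.
have hn := spm_n_gt0 S.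
case: (spm_cov S (te_tle w)) => [/cov_rk|e0|c0]; first by rewrite rk_te.
  left; exists n.-1; first by lia.
  exact: (spm_fix_te S e0).
have r1 : rk (M te) = 1 by rewrite (cov_rk c0) rk_te.
have [i [oki hi Me]] := rk1_tcj r1.
pose conf t := [forall a : 'I_m, [&& a < n.-1, adj i a & bruhat (val (te \tw a)) (val w)]
   ==> (M (te \tw a) == te \tw a \tw t)].
have confP t : t = i \/ t = mir i -> conf t -> forall x, tle x w -> M x = x \tw t.
  move=> et /forallP ct; apply: spm_of_atoms hi Me et _ => a ha aia hle.
  have lam : a < m by move: ha; clear; lia.
  by have := ct (Ordinal lam); rewrite /= ha aia; move/implyP => /(_ hle)/eqP.
have [ci|nci] := boolP (conf i); first by left; exists i => //; apply: confP; auto.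
have [cm|ncm] := boolP (conf (mir i)).
  by left; exists (mir i); [move: hi; clear; lia|apply: confP; auto].
right.
have confN t : ~~ conf t -> exists a, [/\ a < n.-1, adj i a, tle (te \tw a) w
    & M (te \tw a) <> te \tw a \tw t].
  case/forallPn=> a; rewrite negb_imply => /andP[/and3P[h1 h2 h3] /eqP h4].
  by exists a.
have [a [ha aia lea na]] := confN _ nci.
have [b [hb aib leb nb]] := confN _ ncm.
have nai : a != i by move: aia; rewrite /adj; clear; lia.
have nbi : b != i by move: aib; rewrite /adj; clear; lia.
have Ma : M (te \tw a) = te \tw a \tw mir i by case: (spm_atom hi ha nai Me lea).
have Mb : M (te \tw b) = te \tw b \tw i by case: (spm_atom hi hb nbi Me leb).
have nab : a <> b by move=> e; apply: na; rewrite e.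
have [[ea eb]|[ea eb]] : (i = b.+1 /\ a = b.+2) \/ (i = a.+1 /\ b = a.+2).
- by move: aia aib nab; rewrite /adj; clear; lia.
- have hp : b.+3 < n by move: ha; rewrite eb; clear; lia.
  rewrite ea eb in Me Ma Mb lea na nb.
  have nb' : te \tw b \tw b.+1 <> te \tw b \tw mir b.+1 by rewrite -Mb.
  have na' : te \tw b.+2 \tw mir b.+1 <> te \tw b.+2 \tw b.+1 by rewrite -Ma.
  have [s [h1 h2 h3 h4 h5]] := mixed_letter hp S Me leb lea Mb Ma nb' na'.
  by exists s; split=> //; exact: (mixed_keeps hp S Me Mb Ma h1 h4 h5).
(* The opposite orientation, brought to the previous one by [tau]. *)
- have hp : a.+3 < n by move: hb; rewrite eb; clear; lia.
  rewrite ea eb in Me Ma Mb leb na nb.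
  have oka : a.+1 < m by lia.
  have okb : a.+3 < m by lia.
  have okt : a.+2 < m by lia.
  have okt' : (mir a.+1).+1 < m by lia.
  have okma : (mir a).+1 < m by lia.
  have okmb : (mir a.+2).+1 < m by lia.
  have tau_at k : k.+1 < m -> tau (te \tw k) = te \tw k.
    by move=> hk; rewrite tau_tcj // tau_te -te_mir.
  have mt : mir (mir a.+1) = a.+1 by lia.
  set M' := fun x => tau (M (tau x)).
  have S' := spm_tau S.
  have Me' : M' te = te \tw a.+1 by rewrite /M' tau_te Me tau_at.
  have lea' : tle (te \tw a) (tau w) by rewrite -(tau_at a) //; apply: tle_tau.
  have leb' : tle (te \tw a.+2) (tau w) by rewrite -(tau_at a.+2) //; apply: tle_tau.
  have Ma' : M' (te \tw a) = te \tw a \tw a.+1.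
    by rewrite /M' tau_at // Ma tau_tcj // tau_at // mt.
  have Mb' : M' (te \tw a.+2) = te \tw a.+2 \tw mir a.+1.
    by rewrite /M' tau_at // Mb tau_tcj // tau_at.
  have na' : te \tw a \tw a.+1 <> te \tw a \tw mir a.+1 by rewrite -Ma; auto.
  have nb' : te \tw a.+2 \tw mir a.+1 <> te \tw a.+2 \tw a.+1 by rewrite -Mb; auto.
  have [s [h1 h2 h3 h4 h5]] := mixed_letter hp S' Me' lea' leb' Ma' Mb' na' nb'.
  have k := mixed_keeps hp S' Me' Ma' Mb' h1 h4 h5.
  have hms : (mir s).+1 < m by move: h1; clear; lia.
  have ms : mir (mir s) = s by move: h1; clear; lia.
  exists (mir s); split=> //; last exact: keeps_tau h1 k.
    by rewrite -dn_tau // ms.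
  move=> e; apply: h3; rewrite tauK -e tau_tcj //.
  by rewrite ms.
Qed.

End Classification.

(** * The recursion *)

Section Recursion.

Variable n : nat.
Notation m := (2 * n)%N.
Notation te := (te n).
Implicit Types (x y z u v w : tid n) (k r s : nat) (M N g h : tid n -> tid n).

Lemma spm_tcj w s : s.+1 < m -> dn w s -> spm w (fun x => x \tw s).
Proof.
move=> hs dw; split=> [x hx|x hx||x hx|x y hy cxy ne].
- exact: lift_le.
- exact: tcjK.
- exact: cov_dn.
- have [[d _]|[[_ [d _]]|[_ [_ d]]]] := states x hs.
  + by constructor 1; apply: cov_dn.
  + by constructor 3; apply: cov_up.
  + by constructor 2; apply: fx_tcj.
have hxy := cov_le cxy; have rxy := cov_rk cxy.
have [[d _]|[[_ [d _]]|[_ [_ d]]]] := states y hs.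
- have [e|dx] := cov_lift hs cxy d; first by case: ne; rewrite e tcjK.
  split; first exact: lift_both.
  by have := rk_dn hs d; have := rk_dn hs dx; rk_lia.
- have dY := up_dn hs d; have hY := tle_trans hxy (tle_up hs d).
  have le := lift_le hs dY hY; split=> //; apply: rk_lt => // /(congr1 (fun z => z \tw s)).
  by rewrite !tcjK // => e; move: rxy; rewrite e; rk_lia.
- rewrite [y \tw s]fx_tcj //; have le := lift_fx hs d hxy.
  by split=> //; apply: rk_lt.
Qed.

(** The recursion as an operator, so that the defining recursion and the theorem are the same
    equation for two kinds of [g]. *)
Definition step (f : tid n -> {poly int}) g x : {poly int} :=
  if cov (g x) x then f (g x)
  else if cov x (g x) then ('X * f (g x) + ('X - 1) * f x)%R
  else ('X * f x)%R.

Lemma cov_asym x y : cov x y -> cov y x -> False.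
Proof. by move/cov_rk => e1 /cov_rk e2; rk_lia. Qed.

Lemma cov_irr x : cov x x = false.
Proof. by apply/negP => /cov_rk; lia. Qed.

Section Commute.

Variables (w : tid n) (M N : tid n -> tid n).
Hypotheses (SM : spm w M) (SN : spm w N).

(** [N] is monotone along the cover of [u] by [M u], so [N u] lies strictly below
    [N (M u) = M (N u)]. *)
Lemma comm_cov u : tle u w -> M (N u) = N (M u) -> M u <> N u ->
  cov u (M u) -> cov (N u) (M (N u)).
Proof.
move=> hu e ne c.
have hM := spm_le SM hu; have hN := spm_le SN hu.
have nNu : N u <> M u by auto.
have [le lt] := spm_mono SN hM c nNu.
rewrite e; case: (spm_cov SM hN); rewrite e //.
- by move/cov_rk=> r; rk_lia.
- by move=> r; move: lt; rewrite r ltnn.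
Qed.

Lemma comm_cov_dn u : tle u w -> M (N u) = N (M u) -> M u <> N u ->
  cov (M u) u -> cov (M (N u)) (N u).
Proof.
move=> hu e ne c; have hM := spm_le SM hu; have hN := spm_le SN hu.
have eM : M (N (M u)) = N u by rewrite -e (spmK SM).
rewrite e -[X in cov _ X]eM; apply: comm_cov => //; rewrite ?eM (spmK SM) //.
by move=> e'; apply: ne; rewrite -eM -e' .
Qed.

End Commute.

Section CommuteStates.

Variables (w : tid n) (M N : tid n -> tid n).
Hypotheses (SM : spm w M) (SN : spm w N).

Lemma comm_states u : tle u w -> M (N u) = N (M u) -> M u <> N u ->
  (cov (M (N u)) (N u) = cov (M u) u) * (cov (N u) (M (N u)) = cov u (M u)).
Proof.
move=> hu e ne; have hN := spm_le SN hu; have hM := spm_le SM hu.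
have eN : M (N (N u)) = N (M (N u)) by rewrite e !(spmK SN).
have neN : M (N u) <> N (N u).
  by rewrite (spmK SN) // => e'; apply: ne; rewrite -{1}e' (spmK SM hN).
have d1 := comm_cov SM SN hu e ne; have d2 := comm_cov_dn SM SN hu e ne.
have b1 := comm_cov SM SN hN eN neN; have b2 := comm_cov_dn SM SN hN eN neN.
by rewrite !(spmK SN) // in b1 b2; split; apply/idP/idP.
Qed.

End CommuteStates.

(** If [M u = N u], both sides are the same expression. Otherwise [N] preserves the direction in
    which [M] moves, and conversely, so the order of the two expansions is immaterial. *)
Lemma step_comm w M N f u : spm w M -> spm w N -> tle u w ->
  M u = N u \/ M (N u) = N (M u) ->
  step (step f M) N u = step (step f N) M u.
Proof.
move=> SM SN hu comm; have hM := spm_le SM hu; have hN := spm_le SN hu.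
have [eMN|/eqP ne] := eqVneq (M u) (N u).
  by rewrite /step eMN (spmK SN) // -eMN (spmK SM).
have e : M (N u) = N (M u) by case: comm.
have [m1 m2] := comm_states SM SN hu e ne.
have [||n1 n2] := comm_states SN SM hu; [by [] | by auto|].
rewrite /step m1 m2 n1 n2 e.
by do !case: ifP => _ //; ring.
Qed.

(** * Passage between permutations and [tid] *)

Lemma tw_coverE x y : tw_cover (val x) (val y) = cov x y.
Proof.
have neP (a b : tid n) : (val a < val b)%O = (tle a b && (a != b)).
  by rewrite Order.POrderTheory.lt_neqAle le_bruhatE andbC.
have vP (a : tid n) : val a \in twisted_identities m := valP a.
rewrite /tw_cover /covered_in neP !vP /=; apply/idP/idP.
  case/andP => /andP[hxy /eqP ne] /existsPn gap.
  have [z [h1 h2]] := graded hxy ne.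
  have [->//|nz] := eqVneq x z.
  have := gap (val z); rewrite vP /= !neP h1 nz (cov_le h2) /=.
  by have [e|//] := eqVneq z y; move: h2; rewrite e cov_irr.
move=> c; rewrite (cov_le c) /=; apply/andP; split.
  by apply/eqP => e; move: c; rewrite e cov_irr.
apply/existsPn => a; rewrite negb_and; have [ha|//] := boolP (a \in _) => /=.
have [z <-] : exists z : tid n, val z = a by exists (exist _ a ha).
rewrite !neP; apply/negP.
case/andP => /andP[h1 /eqP n1] /andP[h2 /eqP n2].
by have := rk_lt h1 n1; have := rk_lt h2 n2; have := cov_rk c; rk_lia.
Qed.

Lemma dn_descents w k : k.+1 < m -> dn w k -> sr n k \in right_descents (val w).
Proof.
move=> hk; have [i [j [ei ej e]]] := sr_ex hk.
rewrite e {e}; rewrite /dn -{k hk}ei -ej -val_lt => lt; rewrite inE; apply/andP; split.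
  by rewrite inE; apply/existsP; exists i; apply/existsP; exists j; rewrite ej !eqxx.
have lij : i < j by rewrite ej.
rewrite -{2}[val w](tperm_flip _ i j) ell_tperm_iff //.
by rewrite !permM tpermL tpermR.
Qed.

Lemma in_interval x w : (val x \in tw_interval 1%g (val w)) = tle x w.
Proof.
have vP : val x \in twisted_identities m := valP x.
by rewrite inE vP /= !le_bruhatE; have -> : bruhat 1%g (val x) := te_tle x.
Qed.

Lemma covered_intervalE x y w : tle x w -> tle y w ->
  covered_in (tw_interval 1%g (val w)) (val x) (val y) = cov x y.
Proof.
move=> hx hy; rewrite -tw_coverE /tw_cover /covered_in !in_interval hx hy.
have vP (a : tid n) : val a \in twisted_identities m := valP a.
rewrite !vP /=; congr (_ && ~~ _); apply/eq_existsb => z.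
apply: andb_id2r => /andP[_ /Order.POrderTheory.ltW hz].
have [hI|hI] := boolP (z \in twisted_identities m); last by rewrite inE (negbTE hI).
have [z' e] : exists z' : tid n, val z' = z by exists (exist _ z hI).
by rewrite -e in hz *; rewrite in_interval; apply: tle_trans hy.
Qed.

(** Outside the interval [M] may leave the twisted identities; [insubd] then returns [x]. *)
Definition restrict (M : 'S_m -> 'S_m) : tid n -> tid n :=
  fun x => insubd x (M (val x)).

Lemma restrictE w (M : 'S_m -> 'S_m) x :
  special_partial_matching (tw_interval 1%g (val w)) M -> tle x w ->
  val (restrict M x) = M (val x).
Proof.
case=> h _ _ _ _; rewrite -in_interval => /h; rewrite inE => /andP[hI _].
by rewrite val_insubd hI.
Qed.

Lemma spm_restrict w (M : 'S_m -> 'S_m) :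
  special_partial_matching (tw_interval 1%g (val w)) M -> spm w (restrict M).
Proof.
move=> SP; have vM x := @restrictE w M x SP.
case: SP => h1 h2 [top [t1 t2 t3]] h4 h5.
have le x : tle x w -> tle (restrict M x) w.
  by move=> hx; rewrite -in_interval vM //; apply: h1; rewrite in_interval.
have et : top = val w.
  apply: bruhat_anti; rewrite -!le_bruhatE t2 ?in_interval ?tle_refl // andbT.
  by move: t1; rewrite inE => /and3P[].
split=> //.
- move=> x hx; apply: val_inj; rewrite !vM //; last exact: le.
  by rewrite h2 // in_interval.
- rewrite -(@covered_intervalE _ _ w) ?le ?tle_refl // vM ?tle_refl //.
  by rewrite -{2 3}et.
- move=> x hx; have := h4 (val x); rewrite in_interval => /(_ hx).
  rewrite -vM // !(@covered_intervalE _ _ w) ?le //.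
  by case=> h; [constructor 1|constructor 2; apply: val_inj|constructor 3].
- move=> x y hy c ne; have hx := tle_trans (cov_le c) hy.
  have := h5 (val x) (val y); rewrite !in_interval covered_intervalE // -!vM //.
  move=> /(_ hx hy c) h; have {h} : (val (restrict M x) < val (restrict M y))%O.
    by apply: h => /val_inj.
  rewrite Order.POrderTheory.lt_neqAle le_bruhatE => /andP[/eqP n1 n2].
  by split=> //; apply: rk_lt => // e; apply: n1; rewrite e.
Qed.

Section QPolynomials.

Variable Q : 'S_m -> 'S_m -> {poly int}.
Hypothesis hQ : KLV_Q_polynomials Q.

Definition q u w := Q (val u) (val w).

Lemma q0 u w : ~~ tle u w -> q u w = 0%R.
Proof. by case: hQ => _ h _; apply: h; apply: valP. Qed.

Lemma q_step u w k : k.+1 < m -> dn w k ->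
  q u w = step (q^~ (w \tw k)) (fun x => x \tw k) u.
Proof.
move=> hk dw; case: hQ => _ _ h.
have [h1 h2 h3] := h _ _ (valP u) (valP w) _ (dn_descents hk dw).
have dnE := tw_coverE (u \tw k) u; have upE := tw_coverE u (u \tw k).
rewrite /step; case: ifP => c1; first by apply: h1; rewrite -dnE in c1.
case: ifP => c2; first by apply: h2; rewrite -upE in c2.
have [[d _]|[[_ [d _]]|[_ [_ d]]]] := states u hk.
- by rewrite cov_dn in c1.
- by rewrite cov_up in c2.
- exact/h3/(congr1 val (fx_tcj hk d)).
Qed.

Lemma q_spm w M u : spm w M -> tle u w -> q u w = step (q^~ (M w)) M u.
Proof.
have [N] := ubnP (rk w); elim: N w M u => // N IHN w M u ltN S hu.
have [[t ht e]|[s [hs dw ne kp]]] := spm_classification S.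
  have dwt : dn w t.
    have := spm_top S; rewrite e ?tle_refl // => c.
    have [[d _]|[[_ [d _]]|[_ [_ d]]]] := states w ht => //.
      by case: (cov_asym c); apply: cov_up.
    by move: c; rewrite fx_tcj // cov_irr.
  have he x : tle x w -> M x = x \tw t by apply: e.
  by rewrite (q_step u ht dwt) (he w (tle_refl w)) /step he.
have comm x (hx : tle x w) : M x = x \tw s \/ M (x \tw s) = M x \tw s.
  apply: (spm_comm S hs _ _ dw hx) => [h _|_]; first exact: (proj1 (kp _ h)).
  exact: (proj2 (kp _ (te_tle w))).
have Ss := spm_tcj hs dw; have hw := tle_refl w.
set v := w \tw s; have cv : cov v w := cov_dn hs dw.
have nMw : M w <> v by auto.
have eMv : M v = M w \tw s by case: (comm w hw).
have cMv : cov (M v) v.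
  exact: (comm_cov_dn S Ss hw eMv nMw (spm_top S)).
have Sv := spm_sub S (cov_le cv) cMv.
have dMw : dn (M w) s.
  have ne' : M w <> w \tw s by auto.
  have [h _] := comm_states Ss S hw (esym eMv) (nesym ne').
  have h' := h; rewrite /= -/v cv in h'.
  have [[d _]|[[_ [d _]]|[_ [_ d]]]] := states (M w) hs => //.
    by case: (cov_asym h'); apply: cov_up.
  by rewrite fx_tcj // cov_irr in h'.
have ltv : rk v < N by have := cov_rk cv; rk_lia.
(* For [x] not below [v] both sides vanish: by [spm_closed] neither [x] nor [M x] is below [v],
   hence neither is below [M v]. *)
have IHv x : tle x w -> q x v = step (q^~ (M v)) M x.
  move=> hx; have [hxv|nxv] := boolP (tle x v); first exact: IHN.
  have nMx : ~~ tle (M x) v.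
    apply: contra nxv => h; rewrite -(spmK S hx).
    exact: (spm_closed Sv (tle_refl v) cMv h).
  have lev : tle (M v) v := cov_le cMv.
  have z0 y : ~~ tle y v -> q y (M v) = 0%R.
    by move=> ny; apply: q0; apply: contra ny => h; apply: tle_trans lev.
  by rewrite q0 // /step !z0 // !GRing.mulr0 GRing.addr0 !if_same.
have hs' x : tle x w -> tle (x \tw s) w by apply: (spm_le Ss).
(* Expand at [w] along [s] and at [v] along [M]; after the exchange, the inner operator for [s] is
   the recursion at [M w]. *)
transitivity (step (step (q^~ (M v)) M) (fun x => x \tw s) u).
  by rewrite (q_step u hs dw) /step !IHv ?hs'.
rewrite (step_comm _ S Ss hu); last by case: (comm u hu); auto.
by rewrite eMv /step -/(step _ _ _) !(q_step _ hs dMw).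
Qed.

End QPolynomials.

End Recursion.

Theorem theorem5p1 (n : nat) (hn : (1 <= n)%N)
    (Q : 'S_(2 * n) -> 'S_(2 * n) -> {poly int}) (hQ : KLV_Q_polynomials Q)
    (w : 'S_(2 * n)) (hw : w \in twisted_identities (2 * n))
    (M : 'S_(2 * n) -> 'S_(2 * n))
    (hM : special_partial_matching (tw_interval 1%g w) M)
    (u : 'S_(2 * n)) (hu : u \in tw_interval 1%g w) :
  [/\ tw_cover (M u) u ->
        Q u w = Q (M u) (M w),
      tw_cover u (M u) ->
        Q u w = ('X * Q (M u) (M w) + ('X - 1) * Q u (M w))%R
    & M u = u ->
        Q u w = ('X * Q u (M w))%R].
Proof.
have [w' ew] : exists w' : tid n, val w' = w by exists (exist _ w hw).
have hu' : u \in twisted_identities (2 * n) by move: hu; rewrite inE => /andP[].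
have [u' eu] : exists u' : tid n, val u' = u by exists (exist _ u hu').
rewrite -{w}ew -{u}eu in hM hu hw hu' *; rewrite in_interval in hu.
have S := spm_restrict hM; have vM x := @restrictE _ _ _ x hM.
have main := q_spm hQ S hu.
rewrite -[Q (val u') (val w')]/(q Q u' w') main /step.
rewrite -!vM ?tle_refl // !tw_coverE; split=> [->//|c|/val_inj e].
  by case: ifP => [c'|_]; [case: (cov_asym c c') | rewrite c].
by rewrite e cov_irr.
Qed.
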